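(* Let $(q^*(\cdot),u^*(\cdot))$ be an optimal solution on $[0,T]$ of the second order optimal control problem $$\min_{(q,u)}\ \mathcal{J}[q,u]=\int_0^T C(q(t),\dot q(t),u(t))\,dt\quad\text{subject to}\quad \ddot q(t)=f(q(t),\dot q(t),u(t)),\quad (q,\dot q)(0)=(q_0,v_0),\quad (q,\dot q)(T)=(q_T,v_T),$$ which is normal and of corank $1$ (see context). Let $\kappa^*(\cdot)$ be the corresponding adjoint, i.e. $(q^*,\kappa^*,u^* )$ satisfies the first order optimality conditions given in the context, and put $y^*=(q^*,\kappa^* )$. Let $$\tilde{\mathcal L}^{\mathcal E}(q,\kappa,v_q,v_\kappa,u)=v_\kappa^\top v_q+\kappa^\top f(q,v_q,u)-C(q,v_q,u).$$ Then, with $\leq 0$ meaning negative semidefinite, $$\frac{\partial^2\tilde{\mathcal L}^{\mathcal E}}{\partial u^2}(y^*(t),\dot y^*(t),u^*(t))\leq 0\qquad\text{for all } t\in[0,T].$$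
   Context: Setting. $\mathcal Q$ is a smooth $n$-dimensional configuration manifold and the control space $\mathcal N$ is a finite-dimensional real vector space. Everything is written in local coordinates, so that $q$ takes values in an open subset of $\mathbb R^n$, velocities in $\mathbb R^n$, and $u$ in $\mathcal N=\mathbb R^m$ (no control constraints). The cost $C(q,v,u)\in\mathbb R$ and the map $f(q,v,u)\in\mathbb R^n$ are of class $C^2$. $T>0$ and $q_0,v_0,q_T,v_T$ are fixed. Curves $q,\kappa$ are of class $C^2$ and controls $u$ are continuous on $[0,T]$. A pair $(q,u)$ is admissible if it satisfies $\ddot q=f(q,\dot q,u)$ and the boundary conditions. It is optimal if it minimises $\mathcal J$ among admissible pairs. Notation. For $y=(q,\kappa)$, the expression $\tilde{\mathcal L}^{\mathcal E}(y,\dot y,u)$ means $\tilde{\mathcal L}^{\mathcal E}(q,\kappa,\dot q,\dot\kappa,u)$, i.e. $v_q=\dot q$, $v_\kappa=\dot\kappa$. First order optimality conditions for $(q,\kappa,u)$ (all derivatives of $C,f$ evaluated at $(q(t),\dot q(t),u(t))$): $$\ddot q=f,\qquad \ddot\kappa=\frac{d}{dt}\Big[\frac{\partial C}{\partial\dot q}-\kappa^\top\frac{\partial f}{\partial\dot q}\Big]-\frac{\partial C}{\partial q}+\kappa^\top\frac{\partial f}{\partial q},\qquad 0=\frac{\partial C}{\partial u}-\kappa^\top\frac{\partial f}{\partial u},$$ together with the boundary conditions on $(q,\dot q)$ at $0$ and $T$. Normality and corank. With $v=\dot q$ and $\lambda=(\lambda_q,\lambda_v)$, set $\mathcal H_{\lambda^0}(q,v,\lambda_q,\lambda_v,u)=\lambda_q^\top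 v+\lambda_v^\top f(q,v,u)+\lambda^0C(q,v,u)$. Given $(q,u)$, consider all pairs $(\lambda(\cdot),\lambda^0)\ne 0$ with $\lambda$ absolutely continuous and $\lambda^0\le 0$ such that along the curve $\dot\lambda_q=-\partial\mathcal H_{\lambda^0}/\partial q$, $\dot\lambda_v=-\partial\mathcal H_{\lambda^0}/\partial v$, $\partial\mathcal H_{\lambda^0}/\partial u=0$. The corank is the dimension of the vector space spanned by the values $(\lambda(T),\lambda^0)$ over all such pairs. The normal case is $\lambda^0\neq 0$, normalised to $\lambda^0=-1$. The adjoint $\kappa$ corresponds to $\lambda_v$. *)

(* Defs.v *)
From HB Require Import structures.
From mathcomp Require Import all_boot all_order all_algebra.
From mathcomp Require Import all_classical all_reals all_analysis.
Set Implicit Arguments.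
Unset Strict Implicit.
Unset Printing Implicit Defensive.
Import Order.TTheory GRing.Theory Num.Theory.
Import numFieldNormedType.Exports.
Local Open Scope classical_set_scope.
Local Open Scope ring_scope.

Section maps.
Context {R : realType}.

(* Maps of class C^k on an open subset D of a finite-dimensional space V: all
   iterated directional derivatives up to order k exist and are continuous on
   D.  For V = R^d this amounts to continuity of the partial derivatives. *)
Fixpoint class_C {V W : normedModType R} (k : nat) (D : set V) (F : V -> W)
    : Prop :=
  (forall x, D x -> {for x, continuous F}) /\
  (if k is k'.+1 then
     forall v, (forall x, D x -> derivable F x v) /\ class_C k' D ('D_v F)
   else True).

Definition dot {d : nat} (a b : 'rV[R]_d) : R := \sum_(i < d) a 0 i * b 0 i.

Definition grad {d : nat} (g : 'rV[R]_d -> R) (x : 'rV[R]_d) : 'rV[R]_d :=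
  \row_j 'D_(delta_mx 0 j) g x.

Definition hessian {d : nat} (g : 'rV[R]_d -> R) (x : 'rV[R]_d) : 'M[R]_d :=
  \matrix_(i, j) 'D_(delta_mx 0 i) ('D_(delta_mx 0 j) g) x.

Definition negative_semidefinite {d : nat} (A : 'M[R]_d) : Prop :=
  forall w : 'rV[R]_d, (w *m A *m w^T) 0 0 <= 0.

(* The library Jacobian acts on row vectors from the right, i.e. its (j, i)
   entry is d F_i / d x_j; hence the transpose in the covector a^T dF/dx. *)
Definition pullback {d e : nat} (a : 'rV[R]_e) (F : 'rV[R]_d -> 'rV[R]_e)
    (x : 'rV[R]_d) : 'rV[R]_d := a *m ('J F x)^T.

End maps.

Section curves.
Context {R : realType}.

(* Derivatives relative to A, so that on A = [0, T] they are one-sided at the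
   end points and do not depend on the values of the curve outside [0, T]. *)
Definition diff_quot {V : normedModType R} (x : R -> V) (t : R) : R -> V :=
  fun s => (s - t)^-1 *: (x s - x t).

Definition derivable_on {V : normedModType R} (A : set R) (x : R -> V) (t : R)
    : Prop := cvg (diff_quot x t @ within A t^').

Definition derive_on {V : normedModType R} (A : set R) (x : R -> V) (t : R)
    : V := lim (diff_quot x t @ within A t^').

Fixpoint curve_C {V : normedModType R} (k : nat) (A : set R) (x : R -> V)
    : Prop :=
  {within A, continuous x} /\
  (if k is k'.+1 then
     (forall t, A t -> derivable_on A x t) /\ curve_C k' A (derive_on A x)
   else True).

Definition absolutely_continuous {V : normedModType R} (a b : R) (x : R -> V)
    : Prop :=
  forall e : R, 0 < e -> exists2 d : R, 0 < d &
    forall (N : nat) (l r : 'I_N -> R),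
      (forall i, a <= l i /\ l i <= r i /\ r i <= b) ->
      trivIset setT (fun i => `]l i, r i[%classic) ->
      \sum_(i < N) (r i - l i) < d ->
      \sum_(i < N) `|x (r i) - x (l i)| < e.

End curves.

Section linear_span.
Context {K : fieldType} {V : vectType K}.

Definition is_span_of (S : set V) (W : {vspace V}) : Prop :=
  (forall x, S x -> x \in W) /\
  (forall W' : {vspace V}, (forall x, S x -> x \in W') -> (W <= W')%VS).

End linear_span.

Section control_problem.
Context {R : realType} {n m : nat}.
(* Q is the open coordinate domain of the configurations *)
Variables (Q : set 'rV[R]_n).
Variables (C : 'rV[R]_n -> 'rV[R]_n -> 'rV[R]_m -> R).
Variables (f : 'rV[R]_n -> 'rV[R]_n -> 'rV[R]_m -> 'rV[R]_n).
Variables (T : R) (q0 v0 qT vT : 'rV[R]_n).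

Local Notation I := (`[0, T]%classic : set R).
Local Notation dt := (derive_on I).

Definition state_control_domain : set ('rV[R]_n * 'rV[R]_n * 'rV[R]_m) :=
  [set x | Q x.1.1].

Definition smooth_data : Prop :=
  class_C 2 state_control_domain (fun x => C x.1.1 x.1.2 x.2) /\
  class_C 2 state_control_domain (fun x => f x.1.1 x.1.2 x.2).

Definition cost (q : R -> 'rV[R]_n) (u : R -> 'rV[R]_m) : R :=
  \int[lebesgue_measure]_(t in I) C (q t) (dt q t) (u t).

Record admissible (q : R -> 'rV[R]_n) (u : R -> 'rV[R]_m) : Prop := {
  adm_q : curve_C 2 I q ;
  adm_u : {within I, continuous u} ;
  adm_dom : forall t, I t -> Q (q t) ;
  adm_ode : forall t, I t -> dt (dt q) t = f (q t) (dt q t) (u t) ;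
  adm_init : q 0 = q0 /\ dt q 0 = v0 ;
  adm_final : q T = qT /\ dt q T = vT }.

Definition optimal (q : R -> 'rV[R]_n) (u : R -> 'rV[R]_m) : Prop :=
  admissible q u /\ forall q1 u1, admissible q1 u1 -> cost q u <= cost q1 u1.

Definition hamiltonian (l0 : R) (q v lq lv : 'rV[R]_n) (u : 'rV[R]_m) : R :=
  dot lq v + dot lv (f q v u) + l0 * C q v u.

Record multiplier (q : R -> 'rV[R]_n) (u : R -> 'rV[R]_m)
    (lq lv : R -> 'rV[R]_n) (l0 : R) : Prop := {
  mult_neq0 : ~ ((forall t, I t -> lq t = 0 /\ lv t = 0) /\ l0 = 0) ;
  mult_le0 : l0 <= 0 ;
  mult_acq : absolutely_continuous 0 T lq ;
  mult_acv : absolutely_continuous 0 T lv ;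
  mult_adjq : {ae lebesgue_measure, forall t, I t -> derivable_on I lq t /\
    dt lq t =
      - grad (fun q' => hamiltonian l0 q' (dt q t) (lq t) (lv t) (u t)) (q t)} ;
  mult_adjv : {ae lebesgue_measure, forall t, I t -> derivable_on I lv t /\
    dt lv t =
      - grad (fun v => hamiltonian l0 (q t) v (lq t) (lv t) (u t)) (dt q t)} ;
  mult_stat : forall t, I t ->
    grad (fun w => hamiltonian l0 (q t) (dt q t) (lq t) (lv t) w) (u t) = 0 }.

Definition normal (q : R -> 'rV[R]_n) (u : R -> 'rV[R]_m) : Prop :=
  exists lq lv l0, multiplier q u lq lv l0 /\ l0 != 0.

Definition multiplier_values (q : R -> 'rV[R]_n) (u : R -> 'rV[R]_m)
    : set ('rV[R]_n * 'rV[R]_n * R^o) :=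
  [set x | exists lq lv l0,
    multiplier q u lq lv l0 /\ x = (lq T, lv T, l0)].

Definition has_corank (q : R -> 'rV[R]_n) (u : R -> 'rV[R]_m) (k : nat)
    : Prop :=
  exists W, is_span_of (multiplier_values q u) W /\ \dim W = k.

Definition momentum_term (q kappa : R -> 'rV[R]_n) (u : R -> 'rV[R]_m) (t : R)
    : 'rV[R]_n :=
  grad (fun v => C (q t) v (u t)) (dt q t)
  - pullback (kappa t) (fun v => f (q t) v (u t)) (dt q t).

(* u is merely continuous, so differentiability of the momentum term along the
   curve is part of the adjoint equation. *)
Record first_order_conditions (q kappa : R -> 'rV[R]_n) (u : R -> 'rV[R]_m)
    : Prop := {
  foc_adm : admissible q u ;
  foc_kappa : curve_C 2 I kappa ;
  foc_der : forall t, I t -> derivable_on I (momentum_term q kappa u) t ;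
  foc_adj : forall t, I t ->
    dt (dt kappa) t = dt (momentum_term q kappa u) t
      - grad (fun q' => C q' (dt q t) (u t)) (q t)
      + pullback (kappa t) (fun q' => f q' (dt q t) (u t)) (q t) ;
  foc_stat : forall t, I t ->
    0 = grad (fun w => C (q t) (dt q t) w) (u t)
      - pullback (kappa t) (fun w => f (q t) (dt q t) w) (u t) }.

Definition new_lagrangian (q kappa vq vkappa : 'rV[R]_n) (u : 'rV[R]_m) : R :=
  dot vkappa vq + dot kappa (f q vq u) - C q vq u.

End control_problem.

(* Main.v *)
Require Import Defs.
From HB Require Import structures.
From mathcomp Require Import all_boot all_order all_algebra.
From mathcomp Require Import all_classical all_reals all_analysis.
From mathcomp Require Import ring lra.
Set Implicit Arguments.
Unset Strict Implicit.
Unset Printing Implicit Defensive.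
Import Order.TTheory GRing.Theory Num.Theory.
Import numFieldNormedType.Exports.
Local Open Scope classical_set_scope.
Local Open Scope ring_scope.

(* Suppose the second derivative is positive in some direction w at a time t0.
   Add to the optimal control a needle nu of fixed height along w, supported in
   an interval of length e around t0.  Corank 1 excludes abnormal multipliers,
   hence the controllability Gramian of the linearised system is invertible,
   and a contraction argument corrects state and control by O(e) so that the
   nonlinear dynamics and both boundary conditions hold again.  Pairing the
   dynamics with the costate of the normal multiplier, the first order terms
   cancel and the change of cost is at most -int h + O(e^2), where h is the
   increment of the Hamiltonian caused by nu alone; since the control gradient
   of the Hamiltonian vanishes along the reference, int h >= c e with c > 0,
   which contradicts optimality for small e. *)

(** * Primitives of continuous functions *)

(** The needle is small in the L^1 norm only, not in the sup norm, so estimates by sup norms would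
    leave an error in the cost of the same order e as the gain. Every remainder is therefore
    measured pointwise: on a ball of radius r it is Lipschitz with constant K r, and at time t the
    radius is r = b(t) + M e, where b bounds the needle and M e the correction. Since b integrates
    to O(e), the Lipschitz constant is of order e after integration, and the error in the cost, a
    multiple of the integral of (b(t) + M e) M e, is O(e^2) although b itself does not shrink.

    Abnormal multipliers are excluded by dimension: a nonzero value (lambda(T), 0) would be
    independent of the value of a normal multiplier, so the span would have dimension at least 2.
    The costate used in the pairing is built from [kappa]: lambda_v = kappa and lambda_q = dC/dv -
    kappa df/dv - kappa'. *)

Section primitives.
Context {R : realType}.
Implicit Types (h H k K : R -> R) (a b t T : R).

Let mu := @lebesgue_measure R.

(* Integration starts at -1 so that every point of [0, T], end points included,
   has a two-sided derivative. *)
Definition prim h t : R :=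
  \int[mu]_(s in `[-1, t]) h s - \int[mu]_(s in `[-1, 0]) h s.

Definition antiderivative H h := forall t, -1 < t -> is_derive t 1 H (h t).

Lemma prim0 h : prim h 0 = 0.
Proof. by rewrite /prim subrr. Qed.

Lemma continuous_integrable h a b : continuous h ->
  mu.-integrable `[a, b] (EFin \o h).
Proof.
move=> ch; apply: continuous_compact_integrable; first exact: segment_compact.
exact: continuous_subspaceT.
Qed.

Lemma prim_antiderivative h : continuous h -> antiderivative (prim h) h.
Proof.
move=> ch t t1.
have [d e] := continuous_FTC1_closed (ltr_pwDr ltr01 (lexx t))
  (@continuous_integrable h (-1) (t + 1) ch) t1 (ch t).
have D : is_derive t 1 (fun x => \int[mu]_(s in `[-1, x]) h s) (h t).
  by apply: DeriveDef; [exact: d|rewrite -derive1E; exact: e].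
rewrite -(subr0 (h t)).
exact: (@is_deriveB _ _ _ _ (cst (\int[mu]_(s in `[-1, 0]) h s))).
Qed.

Lemma antiderivative_continuous H h a b : -1 < a -> antiderivative H h ->
  {within `[a, b], continuous H}.
Proof.
move=> a1 dH; apply: derivable_within_continuous => x.
rewrite in_itv/= => /andP[ax _]; apply: ex_derive; apply: dH.
exact: lt_le_trans ax.
Qed.

(** Inequalities between integrals are drawn from the mean value theorem for K - H, so they hold for
    arbitrary antiderivatives and the later estimates stay clear of measure theory. *)
Lemma antiderivative_le H h K k a b : -1 < a -> a <= b ->
  antiderivative H h -> antiderivative K k ->
  (forall t, a <= t <= b -> h t <= k t) -> H b - H a <= K b - K a.
Proof.
move=> a1 ab dH dK hk.
have dKH : antiderivative (fun t => K t - H t) (fun t => k t - h t).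
  by move=> t t1; apply: is_deriveB; [exact: dK|exact: dH].
have d x : x \in `]a, b[%R -> is_derive x 1 (fun t => K t - H t) (k x - h x).
  by rewrite in_itv/= => /andP[ax _]; apply: dKH; exact: lt_trans ax.
have [c cab E] := MVT_segment ab d (antiderivative_continuous a1 dKH).
have : 0 <= (k c - h c) * (b - a).
  by rewrite mulr_ge0 ?subr_ge0 ?hk // !(itvP cab).
by rewrite -E; lra.
Qed.

Lemma antiderivative_eq H h K k a b : -1 < a -> a <= b ->
  antiderivative H h -> antiderivative K k ->
  (forall t, a <= t <= b -> h t = k t) -> H b - H a = K b - K a.
Proof.
move=> a1 ab dH dK hk; apply/eqP; rewrite eq_le; apply/andP; split.
  by apply: antiderivative_le dH dK _ => // t tab; rewrite hk.
by apply: antiderivative_le dK dH _ => // t tab; rewrite hk.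
Qed.

Lemma antiderivative_le_norm H h K k a b : -1 < a -> a <= b ->
  antiderivative H h -> antiderivative K k ->
  (forall t, a <= t <= b -> `|h t| <= k t) -> `|H b - H a| <= K b - K a.
Proof.
move=> a1 ab dH dK hk; rewrite ler_norml; apply/andP; split.
  have dN : antiderivative (fun t => - K t) (fun t => - k t).
    by move=> t t1; apply: is_deriveN; exact: dK.
  have := antiderivative_le a1 ab dN dH.
  have Q : (forall t, a <= t <= b -> - k t <= h t).
    by move=> t /hk; rewrite ler_norml => /andP[].
  by move=> /(_ Q); lra.
apply: antiderivative_le dH dK _ => // t /hk.
by rewrite ler_norml => /andP[].
Qed.

Lemma antiderivative_cst_mul c : antiderivative (fun t => c * t) (cst c).
Proof.
by move=> t _; apply: is_derive_eq; rewrite /= -[_ *: _]/(_ * _) mulr1.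
Qed.

Lemma antiderivative_prim H h t : continuous h -> antiderivative H h ->
  0 <= t -> prim h t = H t - H 0.
Proof.
move=> ch dH t0; have := antiderivative_eq (ltrN10 R) t0
  (prim_antiderivative ch) dH (fun _ _ => erefl).
by rewrite prim0 subr0.
Qed.

(** Bridge between the Lebesgue integral in [cost] and the primitives in which the estimates are
    written. *)
Lemma integral_prim h T : 0 < T -> continuous h ->
  \int[mu]_(s in `[0, T]) h s = prim h T.
Proof.
move=> T0 ch.
rewrite /Rintegral (@continuous_FTC2 _ h (prim h)) //.
- by rewrite prim0 sube0.
- exact: continuous_subspaceT.
- have c := @antiderivative_continuous _ _ 0 T _ (prim_antiderivative ch).
  have /(continuous_within_itvP _ T0)[c1 c2 c3] := c (ltac:(lra)).
  split => // x; rewrite in_itv/= => /andP[x0 _].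
  by apply: ex_derive; apply: prim_antiderivative => //; lra.
- move=> x; rewrite in_itv/= => /andP[x0 _].
  have d := @prim_antiderivative _ ch x; rewrite derive1E.
  by apply: derive_val; apply: d; lra.
Qed.

End primitives.

(** * Matrix-valued curves *)

Section matrix_topology.
Context {R : realType}.

Lemma mx_norm_coord p q (A : 'M[R]_(p, q)) i j : `|A i j| <= `|A|.
Proof.
rewrite [leRHS]/Num.Def.normr/= mx_normrE.
exact: (le_bigmax _ _ (i, j)).
Qed.

Lemma mx_norm_le p q (A : 'M[R]_(p, q)) c : 0 <= c ->
  (forall i j, `|A i j| <= c) -> `|A| <= c.
Proof.
move=> c0 Ac; rewrite [leLHS]/Num.Def.normr/= mx_normrE.
by apply: bigmax_le => // -[i j] _; exact: Ac.
Qed.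

(** The norm is the largest absolute value of an entry, which is in general not submultiplicative;
    the dimension factors in the later constants come from here. *)
Lemma mx_norm_mul p q r (A : 'M[R]_(p, q)) (B : 'M[R]_(q, r)) :
  `|A *m B| <= q%:R * `|A| * `|B|.
Proof.
apply: mx_norm_le => [|i j]; first by rewrite !mulr_ge0.
rewrite mxE (le_trans (ler_norm_sum _ _ _))//.
rewrite (le_trans (y := \sum_(k < q) `|A| * `|B|))//.
  by apply: ler_sum => k _; rewrite normrM ler_pM// mx_norm_coord.
by rewrite big_const_ord iter_addr_0 -mulrA mulr_natl.
Qed.

Lemma mx_norm_tr p q (A : 'M[R]_(p, q)) : `|A^T| = `|A|.
Proof.
apply/eqP; rewrite eq_le; apply/andP; split; apply: mx_norm_le => // i j.
  by rewrite mxE mx_norm_coord.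
by have := mx_norm_coord A^T j i; rewrite mxE.
Qed.

Lemma cvg_mx (T : Type) (F : set_system T) {FF : Filter F} p q
    (X : T -> 'M[R]_(p, q)) (L : 'M[R]_(p, q)) :
  (forall i j, X t i j @[t --> F] --> L i j) -> X t @[t --> F] --> L.
Proof.
move=> XL; apply/cvgrPdist_le => e e0; near=> t.
apply: mx_norm_le => [|i j]; first exact: ltW.
have : forall ij : 'I_p * 'I_q, `|L ij.1 ij.2 - X t ij.1 ij.2| <= e.
  by near: t; apply: filter_forall => -[i' j']; move/cvgrPdist_le: (XL i' j'); exact.
by move=> /(_ (i, j)); rewrite !mxE.
Unshelve. all: by end_near. Qed.

Lemma cvg_mx_coord (T : Type) (F : set_system T) {FF : Filter F} p q
    (X : T -> 'M[R]_(p, q)) (L : 'M[R]_(p, q)) i j :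
  X t @[t --> F] --> L -> X t i j @[t --> F] --> L i j.
Proof.
move=> XL; apply: (cvg_comp _ (fun M : 'M[R]_(p, q) => M i j) XL).
exact: coord_continuous.
Qed.

Lemma cvg_mulmx (T : Type) (F : set_system T) {FF : Filter F} p q r
    (X : T -> 'M[R]_(p, q)) (Y : T -> 'M[R]_(q, r))
    (L : 'M[R]_(p, q)) (M : 'M[R]_(q, r)) :
  X t @[t --> F] --> L -> Y t @[t --> F] --> M ->
  X t *m Y t @[t --> F] --> L *m M.
Proof.
move=> XL YM; apply: cvg_mx => i j; rewrite mxE.
under eq_fun do rewrite mxE.
apply: (cvg_big (U := R)) => [|k _].
  exact: add_continuous.
by apply: cvgM; exact: cvg_mx_coord.
Qed.

Context {T : topologicalType}.

Lemma continuous_mx p q (X : T -> 'M[R]_(p, q)) :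
  (forall i j, continuous (fun t => X t i j)) -> continuous X.
Proof. by move=> cX t; apply: cvg_mx => i j; exact: cX. Qed.

Lemma continuous_mx_coord p q (X : T -> 'M[R]_(p, q)) i j :
  continuous X -> continuous (fun t => X t i j).
Proof. by move=> cX t; apply: cvg_mx_coord; exact: cX. Qed.

Lemma continuous_mulmx p q r (X : T -> 'M[R]_(p, q)) (Y : T -> 'M[R]_(q, r)) :
  continuous X -> continuous Y -> continuous (fun t => X t *m Y t).
Proof. by move=> cX cY t; apply: cvg_mulmx; [exact: cX|exact: cY]. Qed.

Lemma continuous_trmx p q (X : T -> 'M[R]_(p, q)) :
  continuous X -> continuous (fun t => (X t)^T).
Proof.
move=> cX; apply: continuous_mx => i j; under eq_fun do rewrite mxE.
exact: continuous_mx_coord.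
Qed.

End matrix_topology.

(** * Projection of the real line onto the time interval *)

Section clamp.
Context {R : realType}.
Implicit Types (t T : R).

(** Curves of the problem are meaningful on [0, T] only; composing with this projection turns
    continuity relative to [0, T] into continuity on the whole line. *)
Definition clamp T t : R := Num.max 0 (Num.min t T).

Lemma clamp_id T t : 0 <= t <= T -> clamp T t = t.
Proof. by move=> /andP[t0 tT]; rewrite /clamp min_l // max_r. Qed.

Lemma clamp_itv T t : 0 <= T -> 0 <= clamp T t <= T.
Proof.
by move=> T0; rewrite /clamp le_max lexx ge_max T0 ge_min lexx orbT.
Qed.

Lemma clamp_continuous T : continuous (clamp T).
Proof.
move=> t.
apply: (@continuous_max R R (cst 0) (fun s => Num.min s T)).
  exact: cst_continuous.
by apply: (@continuous_min R R id (cst T)); [exact: cvg_id|exact: cst_continuous].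
Qed.

Lemma continuous_clamp (V : topologicalType) T (x : R -> V) : 0 <= T ->
  {within `[0, T], continuous x} -> continuous (fun t => x (clamp T t)).
Proof.
move=> T0 cx t; have It : `[0, T]%classic (clamp T t).
  by rewrite /= in_itv/= clamp_itv.
move/subspace_continuousP : cx => /(_ _ It) cx U /cx.
rewrite /= /within/= => W; have := @clamp_continuous T t _ W.
move=> H; apply: (@filterS R (nbhs t) _ _ _ _ H) => s /=; apply.
by rewrite in_itv/= clamp_itv.
Qed.

Lemma continuous_eq_within (V : topologicalType) T (x y : R -> V) :
  continuous y -> (forall t, 0 <= t <= T -> x t = y t) ->
  {within `[0, T], continuous x}.
Proof.
move=> cy xy; apply: (@subspace_eq_continuous _ _ _ y).
  by move=> t; rewrite inE/= in_itv/= => /xy.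
exact: continuous_subspaceT.
Qed.

End clamp.

(** * Calculus of matrix-valued antiderivatives *)

Section matrix_calculus.
Context {R : realType}.

Definition mx_antiderivative p q (X X' : R -> 'M[R]_(p, q)) :=
  forall i j, antiderivative (fun t => X t i j) (fun t => X' t i j).

Definition mx_prim p q (h : R -> 'M[R]_(p, q)) (t : R) : 'M[R]_(p, q) :=
  \matrix_(i, j) prim (fun s => h s i j) t.

Lemma mx_prim0 p q (h : R -> 'M[R]_(p, q)) : mx_prim h 0 = 0.
Proof. by apply/matrixP => i j; rewrite !mxE prim0. Qed.

Lemma mx_prim_antiderivative p q (h : R -> 'M[R]_(p, q)) :
  continuous h -> mx_antiderivative (mx_prim h) h.
Proof.
move=> ch i j; rewrite (_ : (fun t => _) = prim (fun s => h s i j)).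
  by apply: prim_antiderivative; exact: continuous_mx_coord.
by apply/funext => t; rewrite mxE.
Qed.

Lemma mx_antiderivative_cst p q (A : 'M[R]_(p, q)) :
  mx_antiderivative (cst A) (cst 0).
Proof. by move=> i j t _; rewrite /= mxE; exact: is_derive_cst. Qed.

Lemma mx_antiderivativeD p q (X X' Y Y' : R -> 'M[R]_(p, q)) :
  mx_antiderivative X X' -> mx_antiderivative Y Y' ->
  mx_antiderivative (fun t => X t + Y t) (fun t => X' t + Y' t).
Proof.
move=> dX dY i j t t1; rewrite mxE; under eq_fun do rewrite mxE.
by apply: is_deriveD; [exact: dX|exact: dY].
Qed.

Lemma mx_antiderivativeN p q (X X' : R -> 'M[R]_(p, q)) :
  mx_antiderivative X X' ->
  mx_antiderivative (fun t => - X t) (fun t => - X' t).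
Proof.
move=> dX i j t t1; rewrite mxE; under eq_fun do rewrite mxE.
by apply: is_deriveN; exact: dX.
Qed.

Lemma mx_antiderivative_mul p q r (X X' : R -> 'M[R]_(p, q))
    (Y Y' : R -> 'M[R]_(q, r)) :
  mx_antiderivative X X' -> mx_antiderivative Y Y' ->
  mx_antiderivative (fun t => X t *m Y t) (fun t => X' t *m Y t + X t *m Y' t).
Proof.
move=> dX dY i j t t1.
have dk (k : 'I_q) : is_derive t 1 ((fun s => X s i k) * (fun s => Y s k j))
    (X t i k *: Y' t k j + Y t k j *: X' t i k).
  by apply: is_deriveM; [exact: dX|exact: dY].
under eq_fun do rewrite mxE.
rewrite (_ : (fun x => _) =
  \sum_(k < q) ((fun s => X s i k) * (fun s => Y s k j))).
  apply: (is_derive_eq (is_derive_sum dk)).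
  rewrite !mxE -big_split/=; apply: eq_bigr => k _.
  by rewrite /GRing.scale/= addrC [Y t k j * _]mulrC.
by rewrite fct_sumE.
Qed.

Lemma mx_antiderivative_le_norm p q (X X' : R -> 'M[R]_(p, q)) K k
    (a b : R) :
  -1 < a -> a <= b -> mx_antiderivative X X' -> antiderivative K k ->
  (forall t, a <= t <= b -> `|X' t| <= k t) -> `|X b - X a| <= K b - K a.
Proof.
move=> a1 ab dX dK Xk; apply: mx_norm_le => [|i j].
  rewrite subr_ge0 -subr_ge0.
  have d0 : antiderivative (cst 0) (cst (0 : R)) by move=> ? _; exact: is_derive_cst.
  have := antiderivative_le a1 ab d0 dK; rewrite subrr; apply => t tab /=.
  exact: le_trans (Xk t tab).
rewrite !mxE; apply: antiderivative_le_norm (dX i j) dK _ => // t /Xk.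
exact/le_trans/mx_norm_coord.
Qed.

Lemma mx_antiderivative_eq p q (X Y X' Y' : R -> 'M[R]_(p, q)) t :
  mx_antiderivative X X' -> mx_antiderivative Y Y' -> 0 <= t ->
  (forall s, 0 <= s <= t -> X' s = Y' s) -> X 0 = Y 0 -> X t = Y t.
Proof.
move=> dX dY t0 XY E; apply/matrixP => i j.
have := antiderivative_eq (ltrN10 R) t0 (dX i j) (dY i j).
rewrite E => H; have := H (fun s hs => congr1 (fun M => fun_of_matrix M i j) (XY s hs)).
by move/addIr.
Qed.


End matrix_calculus.

(** * Fixed points in spaces of curves *)

Section fixpoint.
Context {R : realType}.

Lemma exists_half_pow (c e : R) : 0 <= c -> 0 < e -> exists n, c / 2 ^+ n <= e.
Proof.
move=> c0 e0; pose n := Num.bound (c / e); exists n.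
rewrite ler_pdivrMr ?exprn_gt0// mulrC -ler_pdivrMr//.
apply: (le_trans (ltW (archi_boundP _))); first by rewrite divr_ge0 // ltW.
by rewrite -natrX ler_nat ltnW // ltn_expl.
Qed.

Lemma le_half_pow (x c : R) : 0 <= c ->
  (forall n, x <= c / 2 ^+ n) -> x <= 0.
Proof.
move=> c0 xc; apply/ler_addgt0Pr => e e0; rewrite add0r.
by have [n cn] := exists_half_pow c0 e0; exact: le_trans (xc n) cn.
Qed.

Lemma cvg_half_pow p q (z : nat -> 'M[R]_(p, q)) (c : R) : 0 <= c ->
  (forall n k, `|z (n + k)%N - z n| <= c / 2 ^+ n) ->
  exists l, forall n, `|l - z n| <= c / 2 ^+ n.
Proof.
move=> c0 zc; have cz : cvgn z.
  apply: cauchy_cvg; apply/cauchy_exP => e e0.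
  have [n cn] := exists_half_pow c0 (divr_gt0 e0 (ltr0n R 2)).
  exists (z n).
  suff : \forall m \near \oo, ball (z n) e (z m) by [].
  exists n => // m /= nm.
  rewrite -ball_normE/= distrC (@le_lt_trans _ _ (e / 2))//; last first.
    by rewrite ltr_pdivrMr// ltr_pMr// ltr1n.
  by rewrite -(subnKC nm); exact: le_trans (zc _ _) cn.
exists (limn z) => n; apply/ler_addgt0Pr => e e0.
have /cvgrPdist_le /(_ e e0) [N _ HN] := cz.
rewrite (le_trans (ler_distD (z (n + N)%N) _ _))// addrC lerD//.
by apply: HN => /=; rewrite leq_addl.
Qed.

(** Banach's theorem carried out on curves: the iterates form a uniformly Cauchy sequence with error
    2 M Om / 2^n, so the limit inherits continuity and the bound. The weight w is there for linear
    equations, where an exponential weight makes the integral operator contract on an interval of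
    any length. *)
Lemma curve_fixpoint p q (T M Om : R) (w : R -> R)
    (F : (R -> 'M[R]_(p, q)) -> R -> 'M[R]_(p, q))
    (ball := fun z : R -> 'M[R]_(p, q) =>
       continuous z /\ forall t : R, 0 <= t <= T -> `|z t| <= M * w t) :
  0 <= T -> 0 <= M -> (forall t : R, 0 <= t <= T -> 0 <= w t <= Om) ->
  (forall z, ball z -> continuous (F z)) ->
  (forall z (t : R), ball z -> 0 <= t <= T -> `|F z t| <= M * w t) ->
  (forall z1 z2 (d : R), ball z1 -> ball z2 -> 0 <= d ->
    (forall t : R, 0 <= t <= T -> `|z1 t - z2 t| <= d * w t) ->
    forall t : R, 0 <= t <= T -> `|F z1 t - F z2 t| <= d / 2 * w t) ->
  exists z, ball z /\ forall t : R, 0 <= t <= T -> z t = F z t.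
Proof.
move=> T0 M0 wb Fc FM Fd.
(* Composition with [clamp] makes every iterate constant outside [0, T], so bounds on [0, T] control
   the iterates everywhere and the limit is continuous on the whole line. *)
pose z n := iter n (fun x t => F x (clamp T t)) (cst 0).
have bz n : ball (z n).
  elim: n => [|n IH]; split => /=.
  - exact: cst_continuous.
  - by move=> t /wb/andP[w0 _]; rewrite normr0 mulr_ge0.
  - move=> t; apply: continuous_comp; first exact: clamp_continuous.
    exact: Fc.
  - by move=> t tT; rewrite clamp_id// FM.
have zd n k t : 0 <= t <= T ->
    `|z (n + k)%N t - z n t| <= 2 * M / 2 ^+ n * w t.
  elim: n t => [|n IH] t tT.
    rewrite (le_trans (ler_normB _ _))// expr0 divr1.
    have := (bz (0 + k)%N).2 t tT; have := (bz 0).2 t tT.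
    by move=> a b; rewrite (le_trans (lerD b a))// mulr2n mulrDl mul1r mulrDl.
  rewrite addSn /= clamp_id// exprSr invfM mulrA.
  by apply: Fd => //; rewrite !mulr_ge0// invr_ge0 exprn_ge0.
have Om0 : 0 <= Om.
  by have /andP[] := wb 0 (introT andP (conj (lexx 0) T0)); exact: le_trans.
have cl t : exists l, forall n, `|l - z n (clamp T t)| <= 2 * M * Om / 2 ^+ n.
  apply: cvg_half_pow => [|n k]; first by rewrite !mulr_ge0.
  have tT := clamp_itv t T0; rewrite (le_trans (zd n k _ tT))//.
  rewrite mulrAC ler_wpM2r// ?invr_ge0 ?exprn_ge0// ler_wpM2l ?mulr_ge0//.
  by have /andP[] := wb _ tT.
have [y yP] := choice cl.
have yM t : 0 <= t <= T -> `|y t| <= M * w t.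
  move=> tT; rewrite -subr_le0; apply: (@le_half_pow _ (2 * M * Om)) => [|n].
    by rewrite !mulr_ge0.
  rewrite lerBlDr; have := yP t n; rewrite clamp_id// => H.
  rewrite -[y t](subrK (z n t)) (le_trans (ler_normD _ _))// lerD//.
  exact: (bz n).2.
have yc : continuous y.
  move=> t; apply/cvgrPdist_le => e e0.
  have [n cn] : exists n, 2 * M * Om / 2 ^+ n <= e / 3.
    by apply: exists_half_pow; [rewrite !mulr_ge0|rewrite divr_gt0].
  have cz : continuous (fun s => z n (clamp T s)).
    move=> s; apply: continuous_comp; first exact: clamp_continuous.
    exact: (bz n).1.
  have e3 : 0 < e / 3 by rewrite divr_gt0.
  have /cvgrPdist_le /(_ _ e3) H := cz t.
  near=> s.
  have h1 := le_trans (yP t n) cn.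
  have h2 := le_trans (yP s n) cn.
  have h3 : `|z n (clamp T t) - z n (clamp T s)| <= e / 3 by near: s.
  rewrite (le_trans (ler_distD (z n (clamp T t)) _ _))//.
  have := ler_distD (z n (clamp T s)) (z n (clamp T t)) (y s).
  by rewrite [`|_ - y s| in X in _ <= X]distrC; lra.
have by_ : ball y by split.
exists y; split => // t tT; apply/eqP; rewrite -subr_eq0 -normr_le0.
apply: (@le_half_pow _ (2 * M * Om)) => [|n]; first by rewrite !mulr_ge0.
have yz s : 0 <= s <= T -> `|z n s - y s| <= 2 * M / 2 ^+ n * w s.
  move=> sT; rewrite -subr_le0; apply: (@le_half_pow _ (2 * M * Om)) => [|k].
    by rewrite !mulr_ge0.
  rewrite lerBlDr; have := yP s (n + k)%N; rewrite clamp_id// => H.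
  rewrite distrC (le_trans (ler_distD (z (n + k)%N s) _ _))// lerD//.
    rewrite (le_trans H)// ler_wpM2l ?mulr_ge0// lef_pV2 ?posrE ?exprn_gt0//.
    by rewrite ler_weXn2l ?ler1n ?leq_addl.
  exact: zd.
have M2 : 0 <= 2 * M / 2 ^+ n by rewrite !mulr_ge0// invr_ge0 exprn_ge0.
have := Fd _ _ _ (bz n) by_ M2 yz t tT => h1.
have := yP t n.+1; rewrite clamp_id//= clamp_id// => h2.
rewrite (le_trans (ler_distD (F (z n) t) _ _))//.
have h3 : 2 * M / 2 ^+ n / 2 * w t <= 2 * M * Om / 2 ^+ n / 2.
  rewrite mulrAC ler_wpM2r ?invr_ge0// [_ * w t]mulrAC ler_wpM2r//.
  by rewrite ler_wpM2l ?mulr_ge0//; have /andP[] := wb _ tT.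
move: h2; rewrite exprS invfM mulrCA mulrC; lra.
Unshelve. all: by end_near. Qed.

End fixpoint.

(** * Linear differential equations *)

Section linear_ode.
Context {R : realType}.

Lemma mx_antiderivative_continuous p q (X X' : R -> 'M[R]_(p, q)) (T : R) :
  0 <= T -> mx_antiderivative X X' -> continuous (fun t => X (clamp T t)).
Proof.
move=> T0 dX; apply: continuous_mx => i j.
apply: (@continuous_clamp _ _ _ (fun t => X t i j)) => //.
by apply: antiderivative_continuous (dX i j); exact: ltrN10.
Qed.

Lemma exists_mx_bound p q (X : R -> 'M[R]_(p, q)) (T : R) : 0 <= T ->
  continuous X -> exists K, 0 < K /\ forall t : R, 0 <= t <= T -> `|X t| <= K.
Proof.
move=> T0 cX; have cn : continuous (fun t => `|X t|).
  by move=> t; apply: cvg_norm; exact: cX.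
have [c _ cK] := EVT_max T0 (continuous_subspaceT cn).
exists (`|X c| + 1); split; first by rewrite ltr_wpDl.
move=> t tT; rewrite (@le_trans _ _ `|X c|)// ?lerDl//.
by apply: cK; rewrite in_itv/=.
Qed.

Lemma antiderivative_expR (c L : R) :
  antiderivative (fun t => c * expR (L * t)) (fun t => c * L * expR (L * t)).
Proof.
move=> t t1; have d : is_derive t 1 (fun s : R => L * s) L.
  exact: antiderivative_cst_mul t1.
have e : is_derive t 1 (expR \o ( *%R L)) (L *: expR (L * t)).
  by have := @is_derive1_comp _ _ _ _ _ _ (is_derive_expR (L * t)) d; rewrite [_ * L]mulrC.
by rewrite -mulrA; exact: (@is_deriveZ _ _ _ _ c t 1 _ e).
Qed.

Lemma linear_ode p q (A : R -> 'M[R]_q) (X0 : 'M[R]_(p, q)) (T : R) :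
  0 <= T -> continuous A ->
  exists X X', [/\ mx_antiderivative X X', continuous X', X 0 = X0 &
    forall t : R, 0 <= t <= T -> X' t = X t *m A t].
Proof.
move=> T0 cA; have [K [K0 AK]] := exists_mx_bound T0 cA.
pose kap := q%:R * K + 1.
have kap0 : 0 < kap by rewrite ltr_wpDl// mulr_ge0// ltW.
have zA (z : 'M[R]_(p, q)) (t : R) : 0 <= t <= T -> `|z *m A t| <= kap * `|z|.
  move=> tT; rewrite (le_trans (mx_norm_mul _ _))//.
  rewrite mulrAC ler_wpM2r// (@le_trans _ _ (q%:R * K))//.
    by rewrite ler_wpM2l// AK.
  by rewrite lerDl.
(* Picard iteration contracts by 1/2 in the norm weighted by expR (2 kap t). *)
pose L := 2 * kap; pose w t := expR (L * t).
pose F (z : R -> 'M[R]_(p, q)) t := X0 + mx_prim (fun s => z s *m A s) (clamp T t).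
have czA (z : R -> 'M[R]_(p, q)) : continuous z -> continuous (fun s => z s *m A s).
  by move=> cz; exact: continuous_mulmx.
have w1 t : 0 <= t -> 1 <= w t.
  by move=> t0; rewrite /w -expR0 ler_expR mulr_ge0// mulr_ge0// ltW.
have est (h : R -> 'M[R]_(p, q)) (d : R) (t : R) : continuous h -> 0 <= t <= T ->
    (forall s : R, 0 <= s <= T -> `|h s| <= d * kap * w s) ->
    `|mx_prim h t| <= d / 2 * w t - d / 2.
  move=> ch /andP[t0 tT] hd.
  have dK := antiderivative_expR (d / 2) L.
  have := mx_antiderivative_le_norm (ltrN10 R) t0 (mx_prim_antiderivative ch) dK.
  rewrite mx_prim0 subr0 mulr0 expR0 mulr1; apply => s /andP[s0 st].
  rewrite (_ : d / 2 * L = d * kap); last by rewrite /L; field.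
  by apply: hd; rewrite s0 (le_trans st).
have [||t /andP[t0 tT]|z [cz _]|z t [cz zM] tT|z1 z2 d [c1 _] [c2 _] d0 zd t tT|] :=
    @curve_fixpoint _ p q T (2 * `|X0|) (w T) w F.
- exact: T0.
- by rewrite mulr_ge0.
- rewrite expR_ge0 ler_expR ler_wpM2l// mulr_ge0// ltW//.
- apply: continuous_mx => i j s; rewrite /F.
  apply: (@cvg_mx_coord _ _ _ _ _ _ _ (X0 + mx_prim (fun s0 : R => z s0 *m A s0) (clamp T s))).
  apply: cvgD; first exact: cvg_cst.
  apply: mx_antiderivative_continuous; first exact: T0.
  by apply: mx_prim_antiderivative; exact: czA.
- have := est _ (2 * `|X0|) t (czA _ cz) tT; rewrite /F clamp_id// => H.
  rewrite (le_trans (ler_normD _ _))//.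
  have h2 : 1 <= w t by apply: w1; case/andP: tT.
  have /H h1 s : 0 <= s <= T -> `|z s *m A s| <= 2 * `|X0| * kap * w s.
    move=> sT; rewrite (le_trans (zA _ _ sT))// -mulrA mulrCA ler_wpM2l ?(ltW kap0)//.
    exact: zM.
  have : `|X0| <= `|X0| * w t by rewrite ler_peMr.
  move=> h3; rewrite (le_trans (lerD (lexx _) h1))//.
  by have := normr_ge0 X0; lra.
- have cd : continuous (fun s => (z1 s - z2 s) *m A s).
    by apply: czA => s; apply: cvgB; [exact: c1|exact: c2].
  have := est _ d t cd tT; rewrite /F clamp_id// => H.
  have /H h1 s : 0 <= s <= T -> `|(z1 s - z2 s) *m A s| <= d * kap * w s.
    move=> sT; rewrite (le_trans (zA _ _ sT))// -mulrA mulrCA ler_wpM2l ?(ltW kap0)//.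
    exact: zd.
  have -> : X0 + mx_prim (fun s => z1 s *m A s) t -
      (X0 + mx_prim (fun s => z2 s *m A s) t) =
      mx_prim (fun s => (z1 s - z2 s) *m A s) t.
    rewrite opprD addrACA subrr add0r.
    have d1 := mx_prim_antiderivative (czA _ c1).
    have d2 := mx_antiderivativeN (mx_prim_antiderivative (czA _ c2)).
    have [t0 _] := andP tT.
    apply: (mx_antiderivative_eq (mx_antiderivativeD d1 d2)
      (mx_prim_antiderivative cd) t0) => [s _|]; first by rewrite mulmxBl.
    by rewrite !mx_prim0 subrr.
  by rewrite (le_trans h1)// gerBl divr_ge0.
move=> z [[cz _] zF].
(* The fixed point z solves the integral equation on [0, T] only. Integrating once more without the
   clamp gives a curve that agrees with z there and has a two-sided derivative also at 0 and T. *)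
exists (fun t => X0 + mx_prim (fun s => z s *m A s) t), (fun t => z t *m A t).
split; last 1 first.
- by move=> t tT; rewrite {1}zF// /F clamp_id.
- move=> i j t t1; have := mx_antiderivativeD (mx_antiderivative_cst X0)
    (mx_prim_antiderivative (czA _ cz)) i j t1.
  by rewrite /= add0r.
- exact: czA.
- by rewrite mx_prim0 addr0.
Qed.

(** S is the transpose of a solution of the transposed adjoint equation. The product P S has zero
    derivative and starts at the identity, and a one-sided inverse of a square matrix is
    two-sided. *)
Lemma fundamental_matrix q (A : R -> 'M[R]_q) (T : R) : 0 <= T -> continuous A ->
  exists P P' S S' : R -> 'M[R]_q,
  [/\ mx_antiderivative P P', mx_antiderivative S S',
    forall t : R, 0 <= t <= T -> P' t = P t *m A t,
    forall t : R, 0 <= t <= T -> S' t = - (A t *m S t) &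
    forall t : R, 0 <= t <= T -> P t *m S t = 1%:M /\ S t *m P t = 1%:M].
Proof.
move=> T0 cA; have [P [P' [dP cP P0 PA]]] := linear_ode 1%:M T0 cA.
have cAT : continuous (fun t => - (A t)^T).
  by move=> t; apply: cvgN; exact: continuous_trmx.
have [Y [Y' [dY cY Y0 YA]]] := linear_ode 1%:M T0 cAT.
have dS : mx_antiderivative (fun t => (Y t)^T) (fun t => (Y' t)^T).
  by move=> i j t t1; rewrite mxE; under eq_fun do rewrite mxE; exact: dY.
have SA (t : R) : 0 <= t <= T -> (Y' t)^T = - (A t *m (Y t)^T).
  by move=> tT; rewrite YA// trmx_mul linearN/= trmxK mulNmx.
exists P, P', (fun t => (Y t)^T), (fun t => (Y' t)^T); split => // t tT.
have E : P t *m (Y t)^T = 1%:M; last by split => //; exact: mulmx1C.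
have [t0 tT'] := andP tT.
apply: (mx_antiderivative_eq (mx_antiderivative_mul dP dS)
  (mx_antiderivative_cst (1%:M : 'M[R]_q)) t0); last first.
  by rewrite P0 Y0 trmx1 mulmx1.
move=> s /andP[s0 st]; have sT : 0 <= s <= T by rewrite s0 (le_trans st).
by rewrite PA// SA// mulmxN mulmxA subrr.
Qed.

End linear_ode.

(** * The controllability Gramian *)

Section gramian.
Context {R : realType}.

(** Near an end point only one side of t0 may lie in [0, T]. Since d <= T, an interval of length d /
    2 on one of the two sides always fits, whence the factor d / 2. *)
Lemma prim_ge_bump (phi : R -> R) (T t0 d c : R) : continuous phi ->
  (forall t : R, 0 <= t <= T -> 0 <= phi t) -> 0 <= t0 <= T -> 0 < d <= T ->
  (forall t : R, 0 <= t <= T -> `|t - t0| <= d / 2 -> c <= phi t) ->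
  c * (d / 2) <= prim phi T.
Proof.
move=> cphi phi0 /andP[t00 t0T] /andP[d0 dT] phic.
have [a [a0 aT ad]] : exists a, [/\ 0 <= a, a + d / 2 <= T &
    forall t, a <= t <= a + d / 2 -> `|t - t0| <= d / 2].
  have [h|h] := leP (t0 + d / 2) T.
    by exists t0; split => // t /andP[h1 h2]; rewrite ger0_norm; lra.
  exists (t0 - d / 2); split; [lra|lra|].
  by move=> t /andP[h1 h2]; rewrite ler0_norm; lra.
have dphi := prim_antiderivative cphi.
have dc r := @antiderivative_cst_mul R r.
have h1 : prim phi 0 <= prim phi a.
  have := antiderivative_le (ltrN10 R) a0 (dc 0) dphi.
  rewrite !mul0r subrr subr_ge0; apply => t /andP[h1 h2] /=.
  by apply: phi0; rewrite h1/=; lra.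
have h2 : c * (d / 2) <= prim phi (a + d / 2) - prim phi a.
  have a1 : -1 < a by lra.
  have ab : a <= a + d / 2 by lra.
  have := antiderivative_le a1 ab (dc c) dphi.
  rewrite -mulrBr [_ - a]addrAC subrr add0r; apply => t tab /=.
  apply: phic; last exact: ad.
  by case/andP: tab => h3 h4; apply/andP; split; lra.
have h3 : prim phi (a + d / 2) <= prim phi T.
  have a1 : -1 < a + d / 2 by lra.
  have := antiderivative_le a1 aT (dc 0) dphi.
  rewrite !mul0r subrr subr_ge0; apply => t /andP[h3 h4] /=.
  by apply: phi0; apply/andP; split; lra.
by rewrite prim0 in h1; lra.
Qed.

(** p W p^T is the integral of the sum of squares of E(s) p^T. A continuous nonnegative function
    with integral zero vanishes, by the bump estimate at a point where it would be positive. *)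
Lemma gramian_kernel N m (E : R -> 'M[R]_(m, N)) (p : 'rV[R]_N) (T : R) :
  0 < T -> continuous E ->
  p *m mx_prim (fun s => (E s)^T *m E s) T = 0 ->
  forall t : R, 0 <= t <= T -> E t *m p^T = 0.
Proof.
move=> T0 cE pW t tT.
pose h s := p *m ((E s)^T *m E s) *m p^T.
have hE s : h s 0 0 = \sum_(k < m) ((E s *m p^T) k 0) ^+ 2.
  have -> : h s = (E s *m p^T)^T *m (E s *m p^T).
    by rewrite /h trmx_mul trmxK !mulmxA.
  by rewrite mxE; apply: eq_bigr => k _; rewrite [X in X * _]mxE expr2.
have ch : continuous (fun s => h s 0 0).
  apply: continuous_mx_coord; apply: continuous_mulmx; last exact: cst_continuous.
  apply: continuous_mulmx; first exact: cst_continuous.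
  by apply: continuous_mulmx => //; exact: continuous_trmx.
have h0 s : 0 <= h s 0 0 by rewrite hE sumr_ge0// => k _; rewrite sqr_ge0.
have hT : prim (fun s => h s 0 0) T = 0.
  have cG : continuous (fun s => (E s)^T *m E s).
    by apply: continuous_mulmx => //; exact: continuous_trmx.
  have d1 := mx_antiderivative_mul (mx_antiderivative_cst p)
    (mx_prim_antiderivative cG).
  have d2 := mx_antiderivative_mul d1 (mx_antiderivative_cst p^T).
  have d3 : antiderivative (fun s => (p *m mx_prim (fun s => (E s)^T *m E s) s
      *m p^T) 0 0) (fun s => h s 0 0).
    move=> s s1; have := d2 0 0 s s1.
    by rewrite /= mul0mx add0r mulmx0 addr0.
  rewrite (antiderivative_prim ch d3 (ltW T0)) pW mul0mx mx_prim0 mulmx0 mul0mx.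
  by rewrite subrr.
have ht : h t 0 0 = 0.
  apply/eqP; rewrite eq_le h0 andbT leNgt; apply/negP => htp.
  have /cvgrPdist_le /(_ _ (divr_gt0 htp (ltr0n R 2))) := ch t.
  move=> /nbhs_ballP[d /= d0 hd].
  have d1 : 0 < Num.min d T by rewrite lt_min d0.
  have := @prim_ge_bump (fun s => h s 0 0) T t (Num.min d T) (h t 0 0 / 2) ch.
  rewrite hT => /(_ (fun s _ => h0 s) tT); rewrite d1 ge_min lexx orbT/= => H.
  have : h t 0 0 / 2 * (Num.min d T / 2) <= 0.
    apply: H => // s sT st; have : ball t d s.
      rewrite -ball_normE/= distrC (le_lt_trans st)//.
      have : Num.min d T <= d by rewrite ge_min lexx.
      by lra.
    by move=> /hd; rewrite ler_distl => /andP[]; lra.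
  by rewrite leNgt !mulr_gt0.
apply/matrixP => k j; rewrite ord1 [RHS]mxE; apply/eqP; rewrite -sqrf_eq0.
move: ht; rewrite hE => /eqP; rewrite psumr_eq0 => [/allP/(_ k)|i _].
  by rewrite mem_index_enum => /(_ isT).
exact: sqr_ge0.
Qed.

(** A kernel vector p of the Gramian yields l = S p^T, a solution of the adjoint equation
    annihilated by B. The last hypothesis, absence of abnormal costates for the linear system,
    forces l T = 0, and S T is invertible. *)
Lemma gramian_unitmx N m (A : R -> 'M[R]_N) (B : R -> 'M[R]_(m, N))
    (P S S' : R -> 'M[R]_N) (T : R) : 0 < T -> continuous B ->
  mx_antiderivative S S' ->
  (forall t : R, 0 <= t <= T -> S' t = - (A t *m S t)) ->
  (forall t : R, 0 <= t <= T -> P t *m S t = 1%:M) ->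
  (forall l l' : R -> 'cV[R]_N, mx_antiderivative l l' ->
    (forall t : R, 0 <= t <= T -> l' t = - (A t *m l t)) ->
    (forall t : R, 0 <= t <= T -> B t *m l t = 0) -> l T = 0) ->
  mx_prim (fun s => (B s *m S (clamp T s))^T *m (B s *m S (clamp T s))) T
    \in unitmx.
Proof.
move=> T0 cB dS SA PS ctrl; set W := mx_prim _ T.
rewrite -row_free_unit; apply/inj_row_free => p pW.
have cE : continuous (fun s => B s *m S (clamp T s)).
  apply: continuous_mulmx => //.
  exact: mx_antiderivative_continuous (ltW T0) dS.
have Ep := gramian_kernel T0 cE pW.
have T0T : 0 <= T <= T by rewrite lexx ltW.
have dl : mx_antiderivative (fun t => S t *m p^T) (fun t => S' t *m p^T).
  move=> i j t t1.
  have := mx_antiderivative_mul dS (mx_antiderivative_cst p^T) i j t1.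
  by rewrite /= mulmx0 addr0.
have l0 : S T *m p^T = 0.
  apply: (ctrl _ _ dl) => t tT; first by rewrite SA// mulNmx mulmxA.
  by rewrite mulmxA -[S t](congr1 S (clamp_id tT)) Ep.
apply: trmx_inj; rewrite trmx0 -[LHS]mul1mx -(PS _ T0T) -mulmxA.
by rewrite l0 mulmx0.
Qed.

End gramian.

(** * Perturbed trajectories with prescribed end points *)

Section perturbation.
Context {R : realType}.

Lemma antiderivative_affine (c : R) (b : R -> R) (k : R) : continuous b ->
  antiderivative (fun t => c * (prim b t + k * t)) (fun t => c * (b t + k)).
Proof.
move=> cb t t1.
have d := @is_deriveD _ _ _ _ _ _ _ _ _ (prim_antiderivative cb t1)
  (antiderivative_cst_mul k t1).
exact: (@is_deriveZ _ _ _ _ c t 1 _ d).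
Qed.

Lemma prim_homo (b : R -> R) (t T : R) : continuous b ->
  (forall s : R, 0 <= s <= T -> 0 <= b s) -> 0 <= t <= T ->
  prim b t <= prim b T.
Proof.
move=> cb b0 /andP[t0 tT]; have t1 : -1 < t by lra.
have := antiderivative_le t1 tT (antiderivative_cst_mul 0) (prim_antiderivative cb).
rewrite !mul0r subrr subr_ge0; apply => s /andP[h1 h2] /=.
by apply: b0; apply/andP; split; lra.
Qed.

Lemma row_rearrange N (a b c d e f : 'rV[R]_N) :
  a - (c + d) - (b - (e + f)) = a - b - ((c - e) + (d - f)).
Proof. by apply/rowP => j; rewrite !mxE; ring. Qed.

Lemma mx_primB p q (h k : R -> 'M[R]_(p, q)) (t : R) :
  continuous h -> continuous k -> 0 <= t ->
  mx_prim h t - mx_prim k t = mx_prim (fun s => h s - k s) t.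
Proof.
move=> ch ck t0.
have d1 := mx_prim_antiderivative ch.
have d2 := mx_antiderivativeN (mx_prim_antiderivative ck).
have chk : continuous (fun s => h s - k s).
  by move=> s; apply: cvgB; [exact: ch|exact: ck].
apply: (mx_antiderivative_eq (mx_antiderivativeD d1 d2)
  (mx_prim_antiderivative chk) t0) => //.
by rewrite !mx_prim0 subrr.
Qed.

(** [G] governs the deviation from a reference trajectory and has linear part (A, B). M and e0 are
    chosen before the needle nu: smallness is asked of the integral of its bound b, while b itself
    may reach rho / 2. *)
Lemma controlled_perturbation N m (T rho K : R)
    (A : R -> 'M[R]_N) (B : R -> 'M[R]_(m, N))
    (G : R -> 'rV[R]_N -> 'rV[R]_m -> 'rV[R]_N) :
  0 < T -> 0 < rho -> 0 <= K -> continuous A -> continuous B ->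
  (forall t : R, 0 <= t <= T -> G t 0 0 = 0) ->
  (forall (t : R) x1 x2 u1 u2 r, 0 <= t <= T -> r <= rho ->
    `|x1| <= r -> `|x2| <= r -> `|u1| <= r -> `|u2| <= r ->
    `|G t x1 u1 - G t x2 u2 - ((x1 - x2) *m A t + (u1 - u2) *m B t)|
      <= K * r * (`|x1 - x2| + `|u1 - u2|)) ->
  (forall (x : R -> 'rV[R]_N) (u : R -> 'rV[R]_m), continuous x -> continuous u ->
    (forall t, `|x t| <= rho /\ `|u t| <= rho) ->
    continuous (fun t => G (clamp T t) (x t) (u t))) ->
  (forall l l' : R -> 'cV[R]_N, mx_antiderivative l l' ->
    (forall t : R, 0 <= t <= T -> l' t = - (A t *m l t)) ->
    (forall t : R, 0 <= t <= T -> B t *m l t = 0) -> l T = 0) ->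
  exists M e0 : R, [/\ 0 < M, 0 < e0, M * e0 <= rho / 2 &
    forall (nu : R -> 'rV[R]_m) (b : R -> R) e,
    continuous nu -> continuous b ->
    (forall t, `|nu t| <= b t <= rho / 2) -> prim b T <= e -> e <= e0 ->
    exists x x' u, [/\ mx_antiderivative x x', continuous u, x 0 = 0, x T = 0 &
      forall t : R, 0 <= t <= T -> [/\ x' t = G t (x t) (u t),
        `|x t| <= M * e & `|u t - nu t| <= M * e]]].
Proof.
move=> T0 rho0 K0 cA cB G0 GK cG ctrl; have T0' := ltW T0.
have [P [P' [S [S' [dP dS PA SA PS]]]]] := fundamental_matrix T0' cA.
have cS := mx_antiderivative_continuous T0' dS.
have cP := mx_antiderivative_continuous T0' dP.
pose E t := B t *m S (clamp T t).
have cE : continuous E by exact: continuous_mulmx.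
have cET : continuous (fun t => (E t)^T) by exact: continuous_trmx.
have cEE : continuous (fun t => (E t)^T *m E t) by exact: continuous_mulmx.
pose W := mx_prim (fun s => (E s)^T *m E s).
have dW : mx_antiderivative W (fun s => (E s)^T *m E s).
  exact: mx_prim_antiderivative.
have cW := mx_antiderivative_continuous T0' dW.
have Wu : W T \in unitmx.
  by apply: (gramian_unitmx T0 cB dS SA (P := P) _ ctrl) => t /PS[].
(* The unknown is z t = int_0^t r S, where r is the nonlinear remainder: variation
   of constants gives the state dx z, and c z steers dx z to 0 at time T. *)
pose c (z : R -> 'rV[R]_N) := - (z T *m invmx (W T)).
pose dx z t := (z t + c z *m W t) *m P t.
pose du z t := c z *m (E t)^T.
have TT : 0 <= T <= T by rewrite lexx andbT.
have cB_ z1 z2 : c z1 - c z2 = c (fun s => z1 s - z2 s).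
  by rewrite /c mulmxBl opprB opprK addrC.
have dxB z1 z2 t : dx z1 t - dx z2 t = dx (fun s => z1 s - z2 s) t.
  by rewrite /dx -mulmxBl opprD addrACA -mulmxBl cB_.
have duB z1 z2 t : du z1 t - du z2 t = du (fun s => z1 s - z2 s) t.
  by rewrite /du -mulmxBl cB_.
have [KB [KB0 BK]] := exists_mx_bound T0' cB.
have [KS [KS0 SK]] := exists_mx_bound T0' cS.
have [KP [KP0 PK]] := exists_mx_bound T0' cP.
have [KW [KW0 WK]] := exists_mx_bound T0' cW.
have [KE [KE0 EK]] := exists_mx_bound T0' cET.
pose k0 : R := N%:R * `|invmx (W T)|.
have k00 : 0 <= k0 by rewrite mulr_ge0.
have cK z d : 0 <= d -> (forall t : R, 0 <= t <= T -> `|z t| <= d) ->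
    `|c z| <= k0 * d.
  move=> d0 zd; rewrite normrN (le_trans (mx_norm_mul _ _))//.
  by rewrite mulrAC ler_wpM2l// zd.
pose k1 : R := N%:R * (1 + N%:R * k0 * KW) * KP + N%:R * k0 * KE + 1.
have k10 : 0 < k1.
  by rewrite ltr_wpDl// addr_ge0// !mulr_ge0// ?addr_ge0// ?mulr_ge0// ltW.
have lin z d t : 0 <= d -> (forall t : R, 0 <= t <= T -> `|z t| <= d) ->
    0 <= t <= T -> `|dx z t| <= k1 * d /\ `|du z t| <= k1 * d.
  move=> d0 zd tT; have cz := cK z d d0 zd.
  have h1 : `|z t + c z *m W t| <= (1 + N%:R * k0 * KW) * d.
    rewrite mulrDl mul1r (le_trans (ler_normD _ _))// lerD ?zd//.
    rewrite (le_trans (mx_norm_mul _ _))// -!mulrA ler_wpM2l// mulrA.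
    rewrite [k0 * _]mulrCA [X in _ <= X]mulrC ler_pM//.
    by have := WK t tT; rewrite clamp_id.
  have h2 : `|dx z t| <= N%:R * (1 + N%:R * k0 * KW) * KP * d.
    have PKt := PK t tT; rewrite clamp_id// in PKt.
    rewrite (le_trans (mx_norm_mul _ _))//.
    rewrite (_ : _ * d = N%:R * ((1 + N%:R * k0 * KW) * d) * KP); last by ring.
    by rewrite ler_pM ?mulr_ge0// ler_wpM2l.
  have h3 : `|du z t| <= N%:R * k0 * KE * d.
    have EKt := EK t tT.
    rewrite (le_trans (mx_norm_mul _ _))//.
    rewrite (_ : _ * d = N%:R * (k0 * d) * KE); last by ring.
    by rewrite ler_pM ?mulr_ge0// ler_wpM2l.
  have p1 : 0 <= N%:R * (1 + N%:R * k0 * KW) * KP * d.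
    exact: le_trans h2.
  have p2 : 0 <= N%:R * k0 * KE * d by exact: le_trans h3.
  rewrite /k1 !mulrDl mul1r in p1 p2 h2 h3 *.
  by clear -p1 p2 h2 h3 d0; split; lra.
pose g0 : R := N%:R * (K * rho + m%:R * KB) * KS.
have g00 : 0 <= g0.
  by rewrite !mulr_ge0// ?addr_ge0// ?mulr_ge0// ltW.
(* The image of 0 has size at most g0 e and the map contracts by 1/2, so the ball of radius M1 e is
   preserved once g0 + M1 / 2 <= M1. *)
pose M1 : R := 2 * g0 + 1.
have M10 : 0 < M1 by rewrite ltr_wpDl// mulr_ge0.
pose g1 : R := N%:R * KS * K * (2 * k1).
have g10 : 0 <= g1 by rewrite !mulr_ge0// ltW.
pose M : R := k1 * M1.
have M0 : 0 < M by rewrite mulr_gt0.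
(* The first bound keeps b + M e below rho, where the Lipschitz estimate applies; the second makes
   the Lipschitz constant g1 (e + M e T) at most 1/2. *)
pose e0 : R := Num.min (rho / (2 * M)) ((2 * (g1 * (1 + M * T) + 1))^-1).
have g2 : 0 < g1 * (1 + M * T) + 1.
  by rewrite ltr_wpDl// mulr_ge0// addr_ge0// mulr_ge0// ltW.
have eM0 : M * e0 <= rho / 2.
  rewrite -ler_pdivlMl// /e0 ge_min; apply/orP; left.
  by rewrite invfM mulrA [M^-1 * _]mulrC.
exists M, e0; split => //.
  by rewrite lt_min divr_gt0 ?mulr_gt0//= invr_gt0 mulr_gt0.
move=> nu b e cnu cb nub be ee0.
have b0 t : 0 <= b t by have /andP[h _] := nub t; exact: le_trans h.
have e_ge0 : 0 <= e.
  have := @prim_homo b 0 T cb (fun s _ => b0 s); rewrite prim0 lexx.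
  by move=> /(_ T0') h; exact: le_trans be.
have eM : M * e <= rho / 2.
  by rewrite (le_trans _ eM0)// ler_wpM2l// ltW.
have eg : e * (g1 * (1 + M * T)) <= 2^-1.
  have h : e * (g1 * (1 + M * T) + 1) <= 2^-1.
    rewrite -ler_pdivlMr// (le_trans ee0)// ge_min; apply/orP; right.
    by rewrite invfM.
  by rewrite (le_trans _ h)// ler_wpM2l// lerDl.
pose X z s := dx z (clamp T s).
pose U z s := nu (clamp T s) + du z (clamp T s).
(* Only the linear effect of the correction du is subtracted; the forcing by the needle nu stays in
   the remainder. Multiplying by S, the inverse of P, is variation of constants. *)
pose rr (z : R -> 'rV[R]_N) s := (G (clamp T s) (X z s) (U z s)
  - (X z s *m A (clamp T s) + du z (clamp T s) *m B (clamp T s))) *m S (clamp T s).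
pose F z t := mx_prim (rr z) (clamp T t).
pose ballM (z : R -> 'rV[R]_N) := continuous z /\
  forall t : R, 0 <= t <= T -> `|z t| <= M1 * e * 1.
have M1e : 0 <= M1 * e by rewrite mulr_ge0// ltW.
have kM : k1 * (M1 * e) = M * e by rewrite mulrA.
have bnd z s : ballM z -> [/\ `|X z s| <= M * e, `|du z (clamp T s)| <= M * e &
    `|U z s| <= b (clamp T s) + M * e].
  move=> [_ zM]; have sT := clamp_itv s T0'.
  have zM1 (t : R) : 0 <= t <= T -> `|z t| <= M1 * e.
    by move=> /zM; rewrite mulr1.
  have [h1 h2] := lin z (M1 * e) (clamp T s) M1e zM1 sT.
  rewrite -kM; split => //; rewrite (le_trans (ler_normD _ _))// lerD//.
  by have /andP[] := nub (clamp T s).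
have br s : b (clamp T s) + M * e <= rho.
  by have /andP[_ h] := nub (clamp T s); clear -eM h; lra.
have Me0 : 0 <= M * e by rewrite mulr_ge0// ltW.
have ccl (V : topologicalType) (y : R -> V) : continuous y ->
    continuous (fun s => y (clamp T s)).
  by move=> cy s; apply: continuous_comp; [exact: clamp_continuous|exact: cy].
have cX z : ballM z -> continuous (X z).
  move=> [cz _]; apply: continuous_mulmx => //.
  move=> s; apply: cvgD; first exact: (ccl _ _ cz).
  by apply: cvg_mulmx; [exact: cvg_cst|exact: cW].
have cdu z : continuous (fun s => du z (clamp T s)).
  by apply: continuous_mulmx; [exact: cst_continuous|exact: (ccl _ _ cET)].
have cU z : continuous (U z).
  by move=> s; apply: cvgD; [exact: (ccl _ _ cnu)|exact: cdu].
have crr z : ballM z -> continuous (rr z).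
  move=> bz; apply: continuous_mulmx => //; move=> s; apply: cvgB.
    apply: cG; [exact: cX|exact: cU|move=> t; have [h1 _ h2] := bnd z t bz].
    rewrite (le_trans h2)//; split => //; rewrite (le_trans h1)//.
    by have h3 := br t; have h4 := b0 (clamp T t); clear -h3 h4; lra.
  by apply: cvgD; apply: cvg_mulmx; [exact: cX|exact: (ccl _ _ cA)|
    exact: cdu|exact: (ccl _ _ cB)].
have Fest h (t C d : R) : continuous h -> 0 <= t <= T -> 0 <= C -> 0 <= d ->
    (forall s : R, 0 <= s <= T -> `|h s| <= C * (b s + d)) ->
    `|(mx_prim h t : 'rV[R]_N)| <= C * (e + d * T).
  move=> ch tT C0 d0 hC; have [t0 tT'] := andP tT.
  have := mx_antiderivative_le_norm (ltrN10 R) t0 (mx_prim_antiderivative ch)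
    (antiderivative_affine C d cb).
  rewrite mx_prim0 subr0 prim0 mulr0 addr0 mulr0 subr0 => H.
  apply: (le_trans (H _)) => [s /andP[s0 st]|].
    by apply: hC; rewrite s0 (le_trans st).
  rewrite ler_wpM2l// lerD ?ler_wpM2l//.
  by rewrite (le_trans _ be)//; apply: prim_homo => // s _.
have rrB z1 z2 d s : ballM z1 -> ballM z2 -> 0 <= d ->
    (forall t : R, 0 <= t <= T -> `|z1 t - z2 t| <= d * 1) -> 0 <= s <= T ->
    `|rr z1 s - rr z2 s| <= g1 * d * (b s + M * e).
  move=> b1 b2 d0 zd sT.
  have [x1 v1 u1] := bnd z1 s b1; have [x2 v2 u2] := bnd z2 s b2.
  have bs := b0 s.
  have zd1 (t : R) : 0 <= t <= T -> `|z1 t - z2 t| <= d.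
    by move=> /zd; rewrite mulr1.
  have [l1 l2] := lin (fun t => z1 t - z2 t) d s d0 zd1 sT.
  rewrite /rr -mulmxBl; have := br s; rewrite /X /U !clamp_id// in x1 x2 u1 u2 *.
  move=> brs.
  have xle x : x <= M * e -> x <= b s + M * e.
    by clear -bs; lra.
  have := GK s _ _ _ _ (b s + M * e) sT brs (xle _ x1) (xle _ x2) u1 u2.
  have e2 : nu s + du z1 s - (nu s + du z2 s) = du z1 s - du z2 s.
    by rewrite opprD addrACA subrr add0r.
  rewrite e2 dxB duB.
  move=> H.
  rewrite (le_trans (mx_norm_mul _ _))//.
  have := SK s sT; rewrite clamp_id// => Ss.
  have e1 : G s (dx z1 s) (nu s + du z1 s) - (dx z1 s *m A s + du z1 s *m B s) -
      (G s (dx z2 s) (nu s + du z2 s) - (dx z2 s *m A s + du z2 s *m B s)) =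
      G s (dx z1 s) (nu s + du z1 s) - G s (dx z2 s) (nu s + du z2 s) -
      (dx (fun t => z1 t - z2 t) s *m A s + du (fun t => z1 t - z2 t) s *m B s).
    by rewrite -dxB -duB !mulmxBl; exact: row_rearrange.
  rewrite e1.
  have sum2 : `|dx (fun t => z1 t - z2 t) s| + `|du (fun t => z1 t - z2 t) s|
      <= 2 * k1 * d.
    by clear -l1 l2; lra.
  have H2 := le_trans H (ler_wpM2l (mulr_ge0 K0 (addr_ge0 bs Me0)) sum2).
  have H3 := ler_pM (normr_ge0 _) (normr_ge0 _) H2 Ss.
  rewrite -mulrA (le_trans (ler_wpM2l (ler0n _ N) H3))//.
  by rewrite le_eqVlt; apply/orP; left; apply/eqP; rewrite /g1; ring.
have b00 : ballM (cst 0).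
  split; first exact: cst_continuous.
  by move=> t _; rewrite normr0 mulr1.
have rr0 (s : R) : 0 <= s <= T -> `|rr (cst 0) s| <= g0 * (b s + 0).
  move=> sT; have bs := b0 s.
  have c0 : c (cst 0) = 0 by rewrite /c mul0mx oppr0.
  have x0 : dx (cst 0) s = 0 by rewrite /dx c0 mul0mx addr0 mul0mx.
  have u0 : du (cst 0) s = 0 by rewrite /du c0 mul0mx.
  rewrite /rr /X /U clamp_id// x0 u0 !mul0mx !addr0 subr0.
  rewrite (le_trans (mx_norm_mul _ _))//.
  have := SK s sT; rewrite clamp_id// => Ss.
  have /andP[n1 n2] := nub s.
  have brho : b s <= rho by clear -n2 rho0; lra.
  have := GK s 0 0 (nu s) 0 (b s) sT brho.
  rewrite !normr0 => /(_ bs bs n1 bs); rewrite G0// !subr0 mul0mx add0r normr0 add0r => H.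
  have nB : `|nu s *m B s| <= m%:R * KB * b s.
    rewrite (le_trans (mx_norm_mul _ _))// -mulrA -[X in _ <= X]mulrA ler_wpM2l//.
    by rewrite mulrC ler_pM// BK.
  have nK : K * b s * `|nu s| <= K * rho * b s.
    by rewrite ler_pM ?mulr_ge0// ler_wpM2l.
  have nG : `|G s 0 (nu s)| <= (K * rho + m%:R * KB) * b s.
    rewrite -[G s 0 (nu s)](subrK (nu s *m B s)) (le_trans (ler_normD _ _))//.
    by rewrite mulrDl lerD// (le_trans H).
  rewrite (_ : g0 * b s = N%:R * ((K * rho + m%:R * KB) * b s) * KS); last first.
    by rewrite /g0; ring.
  by rewrite ler_pM ?mulr_ge0// ler_wpM2l.
have FB z1 z2 d t : ballM z1 -> ballM z2 -> 0 <= d ->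
    (forall t : R, 0 <= t <= T -> `|z1 t - z2 t| <= d * 1) -> 0 <= t <= T ->
    `|F z1 t - F z2 t| <= d / 2 * 1.
  move=> b1 b2 d0 zd tT; have [t0 _] := andP tT.
  have crB : continuous (fun s => rr z1 s - rr z2 s).
    by move=> s; apply: cvgB; exact: crr.
  rewrite /F clamp_id// (mx_primB (crr _ b1) (crr _ b2) t0).
  have := Fest _ t (g1 * d) (M * e) crB tT (mulr_ge0 g10 d0) Me0
    (fun s sT => rrB z1 z2 d s b1 b2 d0 zd sT).
  move=> H; apply: (le_trans H).
  have -> : g1 * d * (e + M * e * T) = d * (e * (g1 * (1 + M * T))) by ring.
  by rewrite mulr1 ler_wpM2l.
have [|||z1 z2 d b1 b2 d0 zd t tT|z [bz zF]] :=
    @curve_fixpoint _ 1 N T (M1 * e) 1 (cst 1) F T0' M1e.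
- by move=> t _ /=; rewrite ler01 lexx.
- move=> z bz; apply: (mx_antiderivative_continuous T0').
  exact: mx_prim_antiderivative (crr _ bz).
- move=> z t bz tT /=.
  have h1 : `|F (cst 0) t| <= g0 * e.
    have := Fest _ t g0 0 (crr _ b00) tT g00 (lexx 0) rr0.
    by rewrite mul0r addr0 /F clamp_id.
  have h2 : `|F z t - F (cst 0) t| <= M1 * e / 2 * 1.
    apply: FB => // s sT; rewrite subr0; exact: bz.2.
  rewrite -[F z t](subrK (F (cst 0) t)) (le_trans (ler_normD _ _))//.
  rewrite (le_trans (lerD h2 h1))// !mulr1 /M1.
  clear -e_ge0; lra.
- exact: (FB _ _ _ _ b1 b2 d0 zd tT).
have cu : continuous (fun t => nu t + c z *m (E t)^T).
  move=> t; apply: cvgD; first exact: cnu.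
  by apply: cvg_mulmx; [exact: cvg_cst|exact: cET].
have dY : mx_antiderivative (fun t => mx_prim (rr z) t + c z *m W t)
    (fun t => rr z t + c z *m ((E t)^T *m E t)).
  apply: mx_antiderivativeD; first exact: mx_prim_antiderivative (crr _ bz).
  move=> i j t t1; have := mx_antiderivative_mul (mx_antiderivative_cst (c z)) dW i j t1.
  by rewrite /= mul0mx add0r.
have xX (t : R) : 0 <= t <= T ->
    (mx_prim (rr z) t + c z *m W t) *m P t = dx z t.
  by move=> tT; rewrite /dx (zF t tT) /F (clamp_id tT).
exists (fun t => (mx_prim (rr z) t + c z *m W t) *m P t),
  (fun t => (rr z t + c z *m ((E t)^T *m E t)) *m P t
    + (mx_prim (rr z) t + c z *m W t) *m P' t),
  (fun t => nu t + c z *m (E t)^T); split => //.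
- exact: mx_antiderivative_mul.
- by rewrite mx_prim0 /W mx_prim0 mulmx0 addr0 mul0mx.
- by rewrite xX// /dx /c mulNmx mulmxKV// subrr mul0mx.
move=> t tT; have [h1 h2 _] := bnd z t bz.
rewrite /X clamp_id// in h1; rewrite clamp_id// in h2.
rewrite xX//; split => //; last by rewrite addrC addKr.
have [_ SP] := PS t tT.
rewrite PA// mulmxA xX// mulmxDl /rr /X /U clamp_id// -mulmxA SP mulmx1.
have -> : c z *m ((E t)^T *m E t) *m P t = du z t *m B t.
  rewrite [c z *m _]mulmxA.
  have EP : E t *m P t = B t by rewrite /E clamp_id// -mulmxA SP mulmx1.
  by rewrite -/(du z t) -mulmxA EP.
by rewrite -/(du z t) -addrA [_ + dx z t *m A t]addrC subrK.
Qed.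

End perturbation.

(** * Cost of a needle variation *)

Section needle.
Context {R : realType}.

(** Profile of the needle. Admissible controls are continuous, so a tent takes the place of the
    indicator function of a classical needle variation. *)
Definition tent (t0 e t : R) : R := Num.max 0 (1 - `|t - t0| / e).

Lemma tent_continuous (t0 e : R) : continuous (tent t0 e).
Proof.
move=> t; apply: (@continuous_max R R (cst 0) (fun s => 1 - `|s - t0| / e)).
  exact: cst_continuous.
apply: cvgB; first exact: cvg_cst.
apply: cvgMr_tmp; apply: cvg_norm; apply: cvgB.
  exact: cvg_id.
exact: cvg_cst.
Qed.

Lemma tent_itv (t0 e t : R) : 0 < e -> 0 <= tent t0 e t <= 1.
Proof.
move=> e0; rewrite /tent le_max lexx/= ge_max ler01/= gerBl divr_ge0//.
exact: ltW.
Qed.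

Lemma tent_eq0 (t0 e t : R) : 0 < e -> e <= `|t - t0| -> tent t0 e t = 0.
Proof.
by move=> e0 h; rewrite /tent max_l// subr_le0 ler_pdivlMr// mul1r.
Qed.

Lemma tent_ge (t0 e t : R) : 0 < e -> `|t - t0| <= e / 2 -> 2^-1 <= tent t0 e t.
Proof.
move=> e0 h; rewrite /tent le_max; apply/orP; right.
have : `|t - t0| / e <= 2^-1 by rewrite ler_pdivrMr// mulrC.
by lra.
Qed.

(** Only the order e matters. A majorant with an elementary antiderivative on the whole line spares
    a piecewise integration and the question of where the support of the tent leaves [0, T]. *)
Lemma prim_tent_le (t0 e T : R) : 0 < e -> 0 <= T ->
  prim (tent t0 e) T <= 2 * pi * e.
Proof.
move=> e0 T0; pose K t : R := 2 * e * atan ((t - t0) / e).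
have dK : antiderivative K (fun t => 2 * (1 + ((t - t0) / e) ^+ 2)^-1).
  move=> t t1; have d : is_derive t 1 (fun s : R => (s - t0) / e) e^-1.
    have d1 : is_derive t 1 (fun s : R => s - t0) 1.
      by apply: is_derive_eq; rewrite subr0.
    have := @is_deriveZ _ _ _ _ e^-1 t 1 _ d1; rewrite /GRing.scale/= mulr1.
    by congr is_derive; apply/funext => s; rewrite mulrC.
  have d2 := @is_derive1_comp _ atan (fun s => (s - t0) / e) _ _ _
    (is_derive1_atan ((t - t0) / e)) d.
  have s2 : 0 < 1 + ((t - t0) / e) ^+ 2 by rewrite ltr_pwDl// sqr_ge0.
  rewrite (_ : 2 / _ = 2 * e * ((1 + ((t - t0) / e) ^+ 2)^-1 / e)).
    exact: (@is_deriveZ _ _ _ _ (2 * e) t 1 _ d2).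
  have sn := lt0r_neq0 s2; have en := lt0r_neq0 e0.
  by rewrite mulrACA -[2 * _ * (e * _)]mulrA mulrCA mulfV// mulr1 mulrC.
have := antiderivative_le (ltrN10 R) T0
  (prim_antiderivative (@tent_continuous t0 e)) dK.
(* max (0, 1 - |s|) <= 2 / (1 + s^2) *)
rewrite prim0 subr0 => H; apply: (le_trans (H _)) => [t _|].
  have s2 : 0 < 1 + ((t - t0) / e) ^+ 2 by rewrite ltr_pwDl// sqr_ge0.
  have [h|h] := leP e `|t - t0|.
    by rewrite tent_eq0// mulr_ge0// invr_ge0 ltW.
  have /andP[_ h1] := tent_itv t0 t e0; rewrite (le_trans h1)//.
  rewrite ler_pdivlMr// mul1r -(real_normK (num_real _)) normf_div (gtr0_norm e0).
  have : `|t - t0| / e <= 1 by rewrite ler_pdivrMr// mul1r ltW.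
  have := divr_ge0 (normr_ge0 (t - t0)) (ltW e0).
  set y := `|t - t0| / e => y0 y1; have : y ^+ 2 <= 1 by rewrite exprn_ile1.
  by lra.
rewrite /K -mulrBr -mulrA [pi * e]mulrC mulrA ler_wpM2l//.
  by rewrite mulr_ge0// ltW.
have := atan_ltpi2 ((T - t0) / e); have := atan_gtNpi2 ((0 - t0) / e).
by lra.
Qed.

(** Since x vanishes at both ends, (x l)' integrates to zero, so the cost increment is minus the
    integral of h(t, x, u) + x l'. By the costate equation and B l = d this integrand is h(t, 0, nu)
    up to a remainder bounded by the pointwise radius times the size of the correction. *)
Lemma needle_improvement N m (T rho K : R)
    (A : R -> 'M[R]_N) (B : R -> 'M[R]_(m, N))
    (G : R -> 'rV[R]_N -> 'rV[R]_m -> 'rV[R]_N)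
    (a : R -> 'cV[R]_N) (d : R -> 'cV[R]_m)
    (c : R -> 'rV[R]_N -> 'rV[R]_m -> R) (l l' : R -> 'cV[R]_N)
    (h := fun t x u => (G t x u *m l t) 0 0 - c t x u)
    (t0 del c0 : R) (w : 'rV[R]_m) :
  0 < T -> 0 < rho -> 0 <= K -> continuous A -> continuous B ->
  (forall t : R, 0 <= t <= T -> G t 0 0 = 0) ->
  (forall (t : R) x1 x2 u1 u2 r, 0 <= t <= T -> r <= rho ->
    `|x1| <= r -> `|x2| <= r -> `|u1| <= r -> `|u2| <= r ->
    `|G t x1 u1 - G t x2 u2 - ((x1 - x2) *m A t + (u1 - u2) *m B t)|
      <= K * r * (`|x1 - x2| + `|u1 - u2|)) ->
  (forall (x : R -> 'rV[R]_N) (u : R -> 'rV[R]_m), continuous x -> continuous u ->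
    (forall t, `|x t| <= rho /\ `|u t| <= rho) ->
    continuous (fun t => G (clamp T t) (x t) (u t))) ->
  (forall l l' : R -> 'cV[R]_N, mx_antiderivative l l' ->
    (forall t : R, 0 <= t <= T -> l' t = - (A t *m l t)) ->
    (forall t : R, 0 <= t <= T -> B t *m l t = 0) -> l T = 0) ->
  (forall t : R, 0 <= t <= T -> c t 0 0 = 0) ->
  (forall (t : R) x1 x2 u1 u2 r, 0 <= t <= T -> r <= rho ->
    `|x1| <= r -> `|x2| <= r -> `|u1| <= r -> `|u2| <= r ->
    `|c t x1 u1 - c t x2 u2 - ((x1 - x2) *m a t + (u1 - u2) *m d t) 0 0|
      <= K * r * (`|x1 - x2| + `|u1 - u2|)) ->
  (forall (x : R -> 'rV[R]_N) (u : R -> 'rV[R]_m), continuous x -> continuous u ->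
    (forall t, `|x t| <= rho /\ `|u t| <= rho) ->
    continuous (fun t => c (clamp T t) (x t) (u t))) ->
  mx_antiderivative l l' ->
  (forall t : R, 0 <= t <= T -> l' t = - (A t *m l t - a t)) ->
  (forall t : R, 0 <= t <= T -> B t *m l t = d t) ->
  0 <= t0 <= T -> 0 < del -> 0 < c0 -> `|w| <= rho / 2 ->
  (forall t s : R, 0 <= t <= T -> `|t - t0| <= del -> 0 <= s <= 1 ->
    c0 * s ^+ 2 <= h t 0 (s *: w)) ->
  exists x x' u, [/\ mx_antiderivative x x', continuous u, x 0 = 0, x T = 0 &
    [/\ forall t : R, 0 <= t <= T ->
      [/\ x' t = G t (x t) (u t), `|x t| <= rho & `|u t| <= rho] &
    prim (fun t => c (clamp T t) (x (clamp T t)) (u (clamp T t))) T < 0]].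
Proof.
move=> T0 rho0 K0 cA cB G0 GK cG ctrl c00 cK cc dl lA lB t0T del0 c00' wrho hw.
have T0' := ltW T0.
have cl := mx_antiderivative_continuous T0' dl.
have [M [e0 [M0 e00 Me0 pert]]] :=
  controlled_perturbation T0 rho0 K0 cA cB G0 GK cG ctrl.
have [L [L0 lL]] := exists_mx_bound T0' cl.
pose K3 := N%:R * K * L + K.
have K30 : 0 <= K3 by rewrite addr_ge0// !mulr_ge0// ltW.
(* Comparison with the pure needle (0, v): the terms linear in x add up to - x l' by the costate
   equation, and those linear in u - v cancel because B l = d. *)
have hest (t : R) x u v r : 0 <= t <= T -> r <= rho ->
    `|x| <= r -> `|v| <= r -> `|u| <= r ->
    h t 0 v - K3 * r * (`|x| + `|u - v|)
      <= h t x u + (x *m l' t) 0 0.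
  move=> tT rr xr vr ur.
  have r0 : 0 <= r by exact: le_trans xr.
  have n0 : `|0 : 'rV[R]_N| <= r by rewrite normr0.
  have gk := GK t x 0 u v r tT rr xr n0 ur vr.
  have ck := cK t x 0 u v r tT rr xr n0 ur vr.
  rewrite !subr0 in gk ck.
  set q := G t x u - G t 0 v - _ in gk; set p := (X in `|X|) in ck.
  have E : h t x u + (x *m l' t) 0 0 = h t 0 v + ((q *m l t) 0 0 - p).
    rewrite /h /q /p lA// -lB// !mulmxBl !mulmxDl mulmxN mulmxBr !mulmxA !mulNmx !mxE.
    by ring.
  have ql : `|(q *m l t) 0 0| <= N%:R * K * L * r * (`|x| + `|u - v|).
    rewrite (le_trans (mx_norm_coord _ _ _))// (le_trans (mx_norm_mul _ _))//.
    have -> : N%:R * K * L * r * (`|x| + `|u - v|) =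
      N%:R * (K * r * (`|x| + `|u - v|)) * L by ring.
    have lt := lL t tT; rewrite clamp_id// in lt.
    by rewrite ler_pM ?mulr_ge0// ler_wpM2l.
  have b1 := ler_norm (- (q *m l t) 0 0); rewrite normrN in b1.
  have b2 := ler_norm p.
  rewrite E lerD2l /K3 !mulrDl.
  by clear -b1 b2 ql ck; lra.
(* With this e1 the integral of b is at most e1 e; the summand 1 keeps e1 positive whatever w is. *)
pose e1 : R := 2 * pi * (`|w| + 1).
have pi0 := pi_gt0 R.
have e10 : 0 < e1 by rewrite mulr_gt0 ?mulr_gt0// ltr_wpDl.
pose K4 : R := K3 * (2 * M) * (1 + M * T) * e1 ^+ 2.
have K40 : 0 <= K4.
  have M0' := ltW M0; rewrite mulr_ge0 ?exprn_ge0 ?(ltW e10)//.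
  by rewrite mulr_ge0 ?addr_ge0 ?mulr_ge0.
(* The gain is at least c0 e / 8, since tent^2 >= 1/4 on an interval of length e / 2, and the loss
   is at most K4 e^2; the condition e (8 K4 + 8) <= c0 makes the gain strictly larger. The bound T
   lets that interval fit into [0, T], and del keeps the needle where h is bounded below. *)
pose e : R := Num.min (Num.min T del) (Num.min (e0 / e1) (c0 / (8 * K4 + 8))).
have k8 : 0 < 8 * K4 + 8 by rewrite ltr_wpDl// mulr_ge0.
have ep : 0 < e by rewrite !lt_min T0 del0 divr_gt0//= divr_gt0.
have eT : e <= T by rewrite !ge_min lexx.
have edel : e <= del by rewrite !ge_min lexx orbT.
have ee0 : e1 * e <= e0.
  by rewrite mulrC -ler_pdivlMr// !ge_min lexx !orbT.
have ec0 : e * (8 * K4 + 8) <= c0.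
  by rewrite -ler_pdivlMr// !ge_min lexx !orbT.
pose nu t : 'rV[R]_m := tent t0 e t *: w.
pose b t : R := tent t0 e t * (`|w|).
have cnu : continuous nu.
  by move=> t; apply: cvgZr_tmp; exact: tent_continuous.
have cb : continuous b.
  by move=> t; apply: cvgMr_tmp; exact: tent_continuous.
have nb t : `|nu t| <= b t <= rho / 2.
  have /andP[h1 h2] := tent_itv t0 t ep.
  rewrite normrZ ger0_norm// lexx/= (le_trans _ wrho)// ler_piMl//.
have b0 t : 0 <= b t.
  by rewrite mulr_ge0//; have /andP[] := tent_itv t0 t ep.
have pb : prim b T <= e1 * e.
  have db := antiderivative_affine `|w| 0 (@tent_continuous t0 e).
  have dbb : antiderivative (fun t => `|w| * (prim (tent t0 e) t + 0 * t)) b.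
    by move=> t t1; apply: (is_derive_eq (db t t1)); rewrite /b addr0 mulrC.
  rewrite (antiderivative_prim cb dbb T0').
  rewrite prim0 !mul0r !addr0 mulr0 subr0.
  have h1 := prim_tent_le t0 ep T0'.
  rewrite (le_trans (ler_wpM2l (normr_ge0 w) h1))// /e1.
  have : 0 <= 2 * pi * e by rewrite !mulr_ge0// ltW.
  by clear; set p := `|w|; nra.
have [x [x' [u [dx cu x0 xT xu]]]] := pert nu b (e1 * e) cnu cb nb pb ee0.
have Mee : M * (e1 * e) <= rho / 2.
  by rewrite (le_trans _ Me0)// ler_wpM2l// ltW.
have Mee0 : 0 <= M * (e1 * e) by rewrite !mulr_ge0// ltW.
have brho t : b t + M * (e1 * e) <= rho.
  by have /andP[_ h2] := nb t; clear -h2 Mee; lra.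
have unorm (t : R) : 0 <= t <= T -> `|u t| <= b t + M * (e1 * e).
  move=> /xu[_ _ h2]; have /andP[h3 _] := nb t.
  by rewrite -[u t](subrK (nu t)) (le_trans (ler_normD _ _))// addrC lerD.
have xnorm (t : R) : 0 <= t <= T -> `|x t| <= b t + M * (e1 * e).
  by move=> /xu[_ h2 _]; rewrite (le_trans h2)// lerDr.
exists x, x', u; split => //; split.
  move=> t tT; have [h1 _ _] := xu t tT; split => //.
    exact: le_trans (xnorm t tT) (brho t).
  exact: le_trans (unorm t tT) (brho t).
have cxc := mx_antiderivative_continuous T0' dx.
have cuc : continuous (fun s => u (clamp T s)).
  by move=> s; apply: continuous_comp; [exact: clamp_continuous|exact: cu].
set cs := (fun t => c _ _ _).
have ccs : continuous cs.
  apply: cc => // t; have tT := clamp_itv t T0'.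
  by split; [exact: le_trans (xnorm _ tT) (brho _)|
    exact: le_trans (unorm _ tT) (brho _)].
pose th t : R := tent t0 e t ^+ 2.
have cth : continuous th.
  move=> t; rewrite /th; under eq_fun do rewrite expr2.
  by apply: cvgM; exact: tent_continuous.
pose C2 : R := K3 * (2 * (M * (e1 * e))).
have C20 : 0 <= C2 by rewrite mulr_ge0// mulr_ge0.
have dR := antiderivative_affine C2 (M * (e1 * e)) cb.
have dxl := mx_antiderivative_mul dx dl.
have dTot : antiderivative (fun t => prim cs t + c0 * (prim th t + 0 * t))
    (fun t => cs t + c0 * (th t + 0)).
  move=> t t1; apply: is_deriveD; first exact: prim_antiderivative.
  exact: antiderivative_affine.
have dTot2 : antiderivative
    (fun t => (x t *m l t) 0 0 + C2 * (prim b t + (M * (e1 * e)) * t))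
    (fun t => (x' t *m l t + x t *m l' t) 0 0 + C2 * (b t + M * (e1 * e))).
  by move=> t t1; apply: is_deriveD; [exact: dxl|exact: dR].
have := antiderivative_le (ltrN10 R) T0' dTot dTot2.
rewrite !prim0 !mul0r !mulr0 !addr0 !mulr0 x0 xT !mul0mx mxE !addr0 add0r !subr0.
move=> main.
have {main} : prim cs T + c0 * prim th T <= C2 * (prim b T + M * (e1 * e) * T).
  apply: main => t tT; rewrite /cs clamp_id// !addr0.
  have [x't xt ut] := xu t tT.
  have := hest t (x t) (u t) (nu t) _ tT (brho t) (xnorm t tT) _ (unorm t tT).
  have nut : `|nu t| <= b t + M * (e1 * e).
    by have /andP[h2 _] := nb t; rewrite (le_trans h2)// lerDl.
  move=> /(_ nut) H.
  (* Farther than del from t0 the tent is zero, and both sides vanish. *)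
  have hnu : c0 * th t <= h t 0 (nu t).
    have [hd|hd] := leP `|t - t0| del.
      by apply: hw => //; exact: tent_itv.
    rewrite /th /nu tent_eq0//; last by rewrite ltW// (le_lt_trans edel).
    by rewrite expr0n mulr0 scale0r /h G0// mul0mx c00// mxE subr0.
  have S2 : `|x t| + `|u t - nu t| <= 2 * (M * (e1 * e)).
    by clear -xt ut; lra.
  have H2 : K3 * (b t + M * (e1 * e)) * (`|x t| + `|u t - nu t|)
      <= C2 * (b t + M * (e1 * e)).
    have -> : C2 * (b t + M * (e1 * e)) =
        K3 * (b t + M * (e1 * e)) * (2 * (M * (e1 * e))) by rewrite /C2; ring.
    by rewrite ler_wpM2l// mulr_ge0// addr_ge0.
  have -> : (x' t *m l t + x t *m l' t) 0 0 =
    (x' t *m l t) 0 0 + (x t *m l' t) 0 0 by rewrite mxE.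
  move: H; rewrite {2}/h -x't => H.
  by clear -H hnu H2; lra.
have thp : 4^-1 * (e / 2) <= prim th T.
  apply: (prim_ge_bump (t0 := t0)) => //.
  - by move=> t _; exact: sqr_ge0.
  - by rewrite ep.
  - move=> t tT td; have := tent_ge ep td.
    rewrite /th (_ : 4^-1 = 2^-1 ^+ 2 :> R); last by field.
    by move=> h2; rewrite ler_pXn2r// nnegrE; case/andP: (tent_itv t0 t ep).
have rhs : C2 * (prim b T + M * (e1 * e) * T) <= K4 * e ^+ 2.
  have -> : K4 * e ^+ 2 = C2 * (e1 * e + M * (e1 * e) * T).
    by rewrite /K4 /C2; ring.
  by rewrite ler_wpM2l// lerD2r.
have h1 : c0 * (4^-1 * (e / 2)) <= c0 * prim th T by rewrite ler_wpM2l// ltW.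
have h2 : e * (e * (8 * K4 + 8)) <= e * c0 by rewrite ler_wpM2l// ltW.
have h3 : 0 < e * e by rewrite mulr_gt0.
by clear -rhs h1 h2 h3; nra.
Qed.

End needle.

(** * Maps of class C^k on normed spaces *)

Section directional.
Context {R : realType}.
Implicit Types V W : normedModType R.

Lemma is_derive_line V W (F : V -> W) (x v : V) (s : R) (d : W) :
  is_derive (x + s *: v) v F d <-> is_derive s 1 (fun s : R => F (x + s *: v)) d.
Proof.
have E : (fun h : R => h^-1 *: ((F \o shift (x + s *: v)) (h *: v) - F (x + s *: v)))
    = (fun h : R => h^-1 *: (((fun s : R => F (x + s *: v)) \o shift s) (h *: 1)
        - F (x + s *: v))).
  apply/funext => h /=; congr (_ *: (F _ - _)).
  by rewrite scalerDl [h%:A]mulr1 addrCA.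
have D : 'D_v F (x + s *: v) = 'D_1 (fun s : R => F (x + s *: v)) s.
  by rewrite /derive E.
by split=> -[dF <-]; apply: DeriveDef; rewrite ?D // /derivable ?E // -E.
Qed.

Lemma is_derive_line0 V W (F : V -> W) (x v : V) (d : W) :
  is_derive x v F d <-> is_derive (0 : R) 1 (fun s : R => F (x + s *: v)) d.
Proof. by rewrite -is_derive_line scale0r addr0. Qed.

Lemma class_C_continuous V W k (D : set V) (F : V -> W) x :
  class_C k D F -> D x -> {for x, continuous F}.
Proof. by case: k => [|k] [cF _]; exact: cF. Qed.

Lemma class_C_derive V W k (D : set V) (F : V -> W) x v :
  class_C k.+1 D F -> D x -> is_derive x v F ('D_v F x).
Proof.
by move=> [_ /(_ v)[dF _]] Dx; apply/derivableP; exact: dF.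
Qed.

Lemma class_CS V W k (D : set V) (F : V -> W) :
  class_C k.+1 D F -> class_C k D F.
Proof.
elim: k F => [|k IH] F [cF dF]; split => // v.
by have [dv cv] := dF v; split => //; exact: IH.
Qed.

Lemma class_C_D V W k (D : set V) (F : V -> W) v :
  class_C k.+1 D F -> class_C k D ('D_v F).
Proof. by move=> [_ /(_ v)[_]]. Qed.

Lemma segment_MVT V (S : V -> R) (D : set V) (x v : V) : class_C 1 D S ->
  (forall s : R, 0 <= s <= 1 -> D (x + s *: v)) ->
  exists s : R, 0 <= s <= 1 /\ S (x + v) - S x = 'D_v S (x + s *: v).
Proof.
move=> cS xD; pose g s := S (x + s *: v).
have dg (s : R) : 0 <= s <= 1 -> is_derive s 1 g ('D_v S (x + s *: v)).
  move=> sD; have := class_C_derive v cS (xD s sD).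
  by move=> /is_derive_line.
have [s sD E] : exists2 s, s \in `[0, 1]%R & g 1 - g 0 = 'D_v S (x + s *: v) * (1 - 0).
  apply: MVT_segment => //.
    move=> s; rewrite in_itv/= => /andP[s0 s1].
    by apply: dg; rewrite !ltW.
  apply: derivable_within_continuous => s; rewrite in_itv/= => sD.
  by have [] := dg s sD.
exists s; split; first by rewrite in_itv/= in sD.
by move: E; rewrite /g scale1r scale0r addr0 subr0 mulr1.
Qed.

Lemma derive_scale V (S : V -> R) (x v : V) (a : R) :
  derivable S x v -> 'D_(a *: v) S x = a * 'D_v S x.
Proof.
move=> dS; have d1 : is_derive x v S ('D_v S x) by exact/derivableP.
have d2 : is_derive (0 : R) 1 (fun s : R => a * s) a.
  exact: (@antiderivative_cst_mul R a 0 (ltrN10 R)).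
have d3 : is_derive (a * 0) 1 (fun s : R => S (x + s *: v)) ('D_v S x).
  by rewrite mulr0; have [h _] := is_derive_line0 S x v ('D_v S x); exact: h.
have d4 := @is_derive1_comp _ (fun s : R => S (x + s *: v)) (fun s => a * s) _ _ _ d3 d2.
have : is_derive x (a *: v) S (a * 'D_v S x).
  rewrite mulrC; apply/is_derive_line0; move: d4; congr is_derive; apply/funext => s /=.
  by rewrite scalerA mulrC.
by case.
Qed.

(** [class_C] speaks of directional derivatives, which need not be additive in the direction.
    Walking from x to x + h v and then to x + h v + h w, the second leg is a derivative along w at a
    nearby point by the mean value theorem, and continuity of that derivative concludes. *)
Lemma derive_add V (S : V -> R) (D : set V) (x v w : V) : open D ->
  class_C 1 D S -> D x -> 'D_(v + w) S x = 'D_v S x + 'D_w S x.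
Proof.
move=> oD cS Dx.
have dv := class_C_derive v cS Dx.
have dw := class_C_derive w cS Dx.
suff L : h^-1 *: ((S \o shift x) (h *: (v + w)) - S x) @[h --> 0^'] -->
    'D_v S x + 'D_w S x by apply: cvg_lim.
have Lv : h^-1 *: ((S \o shift x) (h *: v) - S x) @[h --> 0^'] --> 'D_v S x.
  by have [dS _] := dv; exact: dS.
have cw : {for x, continuous ('D_w S)}.
  exact: class_C_continuous (class_C_D w cS) Dx.
apply/cvgrPdist_le => e e0; have e20 : 0 < e / 2 by rewrite divr_gt0.
have /nbhs_ballP[d /= d0 dP] : \forall y \near x, D y /\
    `|'D_w S x - 'D_w S y| <= e / 2.
  apply: filterI; first exact: open_nbhs_nbhs.
  by move/cvgrPdist_le : cw => /(_ _ e20).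
have n1 : 0 < `|v| + `|w| + 1 by rewrite ltr_wpDl.
near=> h.
have h0 : h != 0 by near: h; exact: nbhs_dnbhs_neq.
have hd : `|h| * (`|v| + `|w| + 1) < d.
  rewrite -ltr_pdivlMr//; near: h; apply: dnbhs0_lt.
  by rewrite divr_gt0.
have yD (s : R) : 0 <= s <= 1 -> ball x d (x + h *: v + s *: (h *: w)).
  move=> /andP[s0 s1]; rewrite -ball_normE/= -addrA opprD addrA subrr add0r normrN.
  rewrite (le_lt_trans _ hd)// (le_trans (ler_normD _ _))// !normrZ (ger0_norm s0).
  rewrite !mulrDr mulr1 mulrA -!addrA lerD// ler_wpDr// ler_wpM2r//.
  by rewrite ler_piMl.
have [s [s01 sE]] := segment_MVT cS (fun s s01 => (dP _ (yD s s01)).1).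
have dwy : derivable S (x + h *: v + s *: (h *: w)) w.
  by have [] := class_C_derive w cS (dP _ (yD s s01)).1.
rewrite derive_scale// in sE.
have -> : h^-1 *: ((S \o shift x) (h *: (v + w)) - S x) =
    h^-1 *: ((S \o shift x) (h *: v) - S x) +
    'D_w S (x + h *: v + s *: (h *: w)).
  have -> : 'D_w S (x + h *: v + s *: (h *: w)) =
      h^-1 *: (S (x + h *: v + h *: w) - S (x + h *: v)).
    by rewrite sE /GRing.scale/= mulKf.
  rewrite /= -scalerDr; congr (_ *: _).
  have -> : h *: (v + w) + x = x + h *: v + h *: w.
    by rewrite scalerDr addrC addrA.
  by rewrite [h *: v + x]addrC [RHS]addrC subrKA.
rewrite opprD addrACA (le_trans (ler_normD _ _))// (splitr e) lerD//; last first.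
  exact: (dP _ (yD s s01)).2.
by near: h; move/cvgrPdist_le : Lv => /(_ _ e20).
Unshelve. all: by end_near. Qed.

Lemma derive_sum_vec V (S : V -> R) (D : set V) (x : V) (J : Type) (r : seq J)
    (xi : J -> R) (e : J -> V) : open D -> class_C 1 D S -> D x ->
  'D_(\sum_(j <- r) xi j *: e j) S x = \sum_(j <- r) xi j * 'D_(e j) S x.
Proof.
move=> oD cS Dx; elim: r => [|j r IH]; first by rewrite !big_nil derive0.
rewrite !big_cons (derive_add _ _ oD cS Dx) IH derive_scale//.
by have [] := class_C_derive (e j) cS Dx.
Qed.

Lemma near_eq_continuous V W (F G : V -> W) (x : V) :
  (\forall y \near x, F y = G y) -> {for x, continuous F} ->
  {for x, continuous G}.
Proof.
move=> FG cF; rewrite /prop_for /continuous_at -(nbhs_singleton FG).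
by apply: cvg_trans cF; apply: near_eq_cvg.
Qed.

Lemma class_C_ext V W k (D : set V) (F G : V -> W) : open D ->
  (forall x, D x -> F x = G x) -> class_C k D F -> class_C k D G.
Proof.
move=> oD; have nD (F' G' : V -> W) x : (forall x, D x -> F' x = G' x) -> D x ->
    \forall y \near x, F' y = G' y.
  move=> FG Dx; have : nbhs x D by exact: open_nbhs_nbhs.
  by apply: filterS => y; exact: FG.
elim: k F G => [|k IH] F G FG [cF dF]; split => //.
- by move=> x Dx; apply: near_eq_continuous (cF x Dx); exact: nD.
- by move=> x Dx; apply: near_eq_continuous (cF x Dx); exact: nD.
- move=> v; have [dv cv] := dF v; split.
    by move=> x Dx; apply: near_eq_derivable (dv x Dx); exact: nD.
  by apply: IH cv => x Dx; apply: near_eq_derive; exact: nD.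
Qed.

Lemma class_C_coord V k (D : set V) p q (F : V -> 'M[R]_(p, q)) i j :
  open D -> class_C k D F -> class_C k D (fun x => F x i j).
Proof.
move=> oD; elim: k F => [|k IH] F [cF dF]; split => //.
- by move=> x Dx; apply: cvg_mx_coord; exact: cF.
- by move=> x Dx; apply: cvg_mx_coord; exact: cF.
- move=> v; have [dv cv] := dF v; split.
    by move=> x Dx; have /derivable_mxP := dv x Dx; exact.
  apply: class_C_ext oD _ (IH _ cv) => x Dx.
  by rewrite derive_mx ?mxE//; exact: dv.
Qed.

(** [lam] is the linear part of the affine map [io]. The intended instances are the slices q, v or u
    to (q, v, u), which carry derivatives on the product space to partial derivatives. *)
Lemma diff_quotient_affine V V' W (F : V -> W) (io lam : V' -> V) (v y : V') :
  (forall (h : R) v y, io (h *: v + y) = h *: lam v + io y) ->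
  (fun h : R => h^-1 *: (((F \o io) \o shift y) (h *: v) - (F \o io) y)) =
  (fun h : R => h^-1 *: ((F \o shift (io y)) (h *: lam v) - F (io y))).
Proof. by move=> ioE; apply/funext => h /=; rewrite ioE. Qed.

Lemma derive_affine V V' W (F : V -> W) (io lam : V' -> V) (v : V') :
  (forall (h : R) v y, io (h *: v + y) = h *: lam v + io y) ->
  'D_v (F \o io) = 'D_(lam v) F \o io.
Proof.
move=> ioE; apply/funext => y; rewrite /derive /=.
by rewrite (diff_quotient_affine F v y ioE).
Qed.

Lemma class_C_affine V V' W k (D : set V) (F : V -> W) (io lam : V' -> V) :
  (forall (h : R) v y, io (h *: v + y) = h *: lam v + io y) -> continuous io ->
  class_C k D F -> class_C k (io @^-1` D) (F \o io).
Proof.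
move=> ioE cio; elim: k F => [|k IH] F [cF dF]; split => //.
- by move=> x Dx; apply: continuous_comp; [exact: cio|exact: cF].
- by move=> x Dx; apply: continuous_comp; [exact: cio|exact: cF].
- move=> v; have [dv cv] := dF (lam v); split.
    move=> y Dy; have := dv _ Dy; rewrite /derivable.
    by rewrite (diff_quotient_affine F v y ioE).
  by rewrite (derive_affine _ _ ioE); exact: IH.
Qed.

Lemma tube_bound V (D : set V) (L : finType) (g : L -> V -> R) (z : R -> V)
    (T : R) : open D ->
  (forall l x, D x -> {for x, continuous (g l)}) -> continuous z ->
  (forall t : R, 0 <= t <= T -> D (z t)) ->
  exists rho K : R, [/\ 0 < rho, 0 <= K & forall (t : R) h, 0 <= t <= T ->
    `|h| <= rho -> D (z t + h) /\ forall l, `|g l (z t + h)| <= K].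
Proof.
move=> oD cg cz Dz.
have /compact_near_coveringP nc := @segment_compact R 0 T.
(* A single small r serves both as radius of the tube and, through r^-1, as bound, so one filter at
   0 suffices for the compactness argument. *)
pose P (r t : R) := forall h, `|h| <= r ->
  D (z t + h) /\ forall l, `|g l (z t + h)| <= r^-1.
have H : forall t, `[0, T]%classic t -> \forall t' \near t & r \near 0^'+, P r t'.
  move=> t /=; rewrite in_itv/= => tT; have Dt := Dz t tT.
  have /nbhs_ballP[d /= d0 dP] : \forall y \near z t, D y /\
      forall l, `|g l (z t) - g l y| <= 1.
    apply: filterI; first exact: open_nbhs_nbhs.
    apply: filter_forall => l.
    by move/cvgrPdist_le : (cg l _ Dt) => /(_ 1 ltr01).
  pose K0 := \sum_l `|g l (z t)| + 1.
  have K00 : 0 < K0 by rewrite ltr_wpDl// sumr_ge0.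
  have gK l : `|g l (z t)| + 1 <= K0.
    by rewrite lerD2r (bigD1 l)//= lerDl sumr_ge0.
  have d2 : 0 < d / 2 by rewrite divr_gt0.
  near=> t' r => h hr.
  have r0 : 0 < r by near: r; exact: nbhs_right_gt.
  have rd : r < d / 2 by near: r; exact: nbhs_right_lt.
  have rK : r < K0^-1 by near: r; apply: nbhs_right_lt; rewrite invr_gt0.
  have zd : `|z t - z t'| < d / 2.
    by near: t'; move/cvgrPdist_lt : (cz t) => /(_ _ d2).
  have /dP[h1 h2] : ball (z t) d (z t' + h).
    rewrite -ball_normE/= opprD addrA (le_lt_trans (ler_normB _ _))//.
    by rewrite (splitr d) ltrD// (le_lt_trans hr).
  split => // l; have Kr : K0 <= r^-1.
    by rewrite -[K0]invrK lef_pV2 ?posrE ?invr_gt0// ltW.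
  rewrite (le_trans _ Kr)// (le_trans _ (gK l))//.
  rewrite -[g l (z t' + h)](subrK (g l (z t))) addrC.
  by rewrite (le_trans (ler_normD _ _))// lerD2l distrC.
have N := nc _ _ _ _ H.
have [r [rP r0]] : exists r : R, `[0, T]%classic `<=` P r /\ 0 < r.
  near (0 : R)^'+ => r; exists r; split.
    by near: r; exact: N.
  by near: r; exact: nbhs_right_gt.
exists r, r^-1; split; [exact: r0|by rewrite invr_ge0 ltW|].
by move=> t h tT; apply: rP; rewrite /= in_itv.
Unshelve. all: by end_near. Qed.

(** Two increments h1 and h2 are compared because a contraction needs the remainder to be Lipschitz,
    not merely quadratic. The mean value theorem is used twice, on the segment from h2 to h1 and
    then from 0 to the intermediate point; it brings in second derivatives along basis vectors,
    which are bounded on a tube. The basis is a parameter so as to cover row vectors as well as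
    triples (q, v, u). *)
Lemma quadratic_remainder V (D : set V) (J : finType) (e : J -> V)
    (xi : J -> V -> R) (L : finType) (S : L -> V -> R) (z : R -> V) (T : R) :
  (forall v, v = \sum_j xi j v *: e j) -> (forall j v, `|xi j v| <= `|v|) ->
  open D -> (forall l, class_C 2 D (S l)) -> continuous z ->
  (forall t : R, 0 <= t <= T -> D (z t)) ->
  exists rho K : R, [/\ 0 < rho, 0 <= K & forall t : R, 0 <= t <= T ->
    (forall h, `|h| <= rho -> D (z t + h)) /\
    forall l h1 h2 r, r <= rho -> `|h1| <= r -> `|h2| <= r ->
      `|S l (z t + h1) - S l (z t + h2) - 'D_(h1 - h2) (S l) (z t)|
        <= K * r * `|h1 - h2|].
Proof.
move=> xiE xiB oD cS cz Dz.
pose g (l : L * J * J) := 'D_(e l.2) ('D_(e l.1.2) (S l.1.1)).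
have cg l x : D x -> {for x, continuous (g l)}.
  exact: class_C_continuous (class_C_D _ (class_C_D _ (cS _))).
have [rho [K [rho0 K0 tube]]] := tube_bound oD cg cz Dz.
exists rho, (#|J|%:R * (#|J|%:R * K)); split => //.
  by rewrite !mulr_ge0.
move=> t tT; split=> [h /tube-/(_ t tT)[]//|l h1 h2 r rr hr1 hr2].
have cS1 : class_C 1 D (S l) by exact: class_CS.
have expand (F : V -> R) x v : class_C 1 D F -> D x ->
    'D_v F x = \sum_j xi j v * 'D_(e j) F x.
  by move=> cF Dx; rewrite {1}(xiE v); apply: derive_sum_vec oD cF Dx.
have sumB (F : J -> R) v c : 0 <= c -> (forall j, `|F j| <= c) ->
    `|\sum_j xi j v * F j| <= #|J|%:R * c * `|v|.
  move=> c0 Fc; rewrite (le_trans (ler_norm_sum _ _ _))//.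
  rewrite (le_trans (y := \sum_(j : J) c * `|v|))//.
    apply: ler_sum => j _; rewrite normrM mulrC ler_pM//.
  by rewrite sumr_const -mulrA mulr_natl.
have Dh (h : V) : `|h| <= r -> D (z t + h).
  by move=> hr; have [] := tube t h tT (le_trans hr rr).
have seg (s : R) : 0 <= s <= 1 -> `|h2 + s *: (h1 - h2)| <= r.
  move=> /andP[s0 s1].
  have -> : h2 + s *: (h1 - h2) = (1 - s) *: h2 + s *: h1.
    by rewrite scalerBr scalerBl scale1r -addrA [- _ + _]addrC.
  rewrite (le_trans (ler_normD _ _))// !normrZ (ger0_norm s0) ger0_norm ?subr_ge0//.
  have h3 := ler_wpM2l (_ : 0 <= 1 - s) hr2.
  have h4 := ler_wpM2l s0 hr1.
  have : (1 - s) * `|h2| <= (1 - s) * r by apply: h3; rewrite subr_ge0.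
  by clear -h4; lra.
have [s [s01 sE]] : exists s : R, 0 <= s <= 1 /\
    S l (z t + h2 + (h1 - h2)) - S l (z t + h2) =
    'D_(h1 - h2) (S l) (z t + h2 + s *: (h1 - h2)).
  by apply: (segment_MVT cS1) => s s01; rewrite -addrA; exact/Dh/seg.
have E1 : z t + h2 + (h1 - h2) = z t + h1 by rewrite -addrA [h2 + _]addrC subrK.
rewrite E1 in sE; rewrite sE -addrA; have := seg s s01.
set k := h2 + _ => kr.
have Dzt := Dz t tT; have Dk := Dh k kr.
rewrite (expand _ _ _ cS1 Dk) (expand _ _ _ cS1 Dzt) -sumrB.
under eq_bigr do rewrite -mulrBr.
have r0 : 0 <= r by exact: le_trans hr1.
rewrite -[X in _ <= X * _]mulrA; apply: (sumB); first by rewrite !mulr_ge0.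
move=> j; have cj := class_C_D (e j) (cS l).
have [s' [s'01 ->]] : exists s' : R, 0 <= s' <= 1 /\
    'D_(e j) (S l) (z t + k) - 'D_(e j) (S l) (z t) =
    'D_k ('D_(e j) (S l)) (z t + s' *: k).
  apply: (segment_MVT cj) => s' /andP[h3 h4]; apply: Dh.
  by rewrite normrZ ger0_norm// (le_trans _ kr)// ler_piMl.
have s'k : `|s' *: k| <= r.
  by have /andP[h3 h4] := s'01; rewrite normrZ ger0_norm// (le_trans _ kr)// ler_piMl.
rewrite (expand _ _ _ cj (Dh _ s'k)).
rewrite (le_trans (sumB _ _ K K0 _))// => [i|].
  exact: ((tube t _ tT (le_trans s'k rr)).2 (l, j, i)).
by rewrite ler_wpM2l ?mulr_ge0.
Qed.

End directional.

(** * Jacobians, Hessians and derivatives relative to [0, T] *)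

Section row_vectors.
Context {R : realType}.

Lemma row_basis d (v : 'rV[R]_d) : v = \sum_j v 0 j *: delta_mx 0 j.
Proof. exact: row_sum_delta. Qed.

(** The Jacobian is defined through the Fréchet differential, whereas [class_C] offers directional
    derivatives. The remainder estimate along a constant curve supplies Fréchet differentiability
    and identifies the differential. *)
Lemma jacobian_class_C d e (D : set 'rV[R]_d) (F : 'rV[R]_d -> 'rV[R]_e)
    (x : 'rV[R]_d) j k : open D -> class_C 2 D F -> D x ->
  'J F x j k = 'D_(delta_mx 0 j) (fun y => F y 0 k) x.
Proof.
move=> oD cF Dx.
pose Jm : 'M[R]_(d, e) := \matrix_(j, k) 'D_(delta_mx 0 j) (fun y => F y 0 k) x.
have cS k' : class_C 2 D (fun y => F y 0 k') by exact: class_C_coord.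
have cS1 k' : class_C 1 D (fun y => F y 0 k') by exact: class_CS.
have [rho [K [rho0 K0 H]]] := @quadratic_remainder R _ D _
  (fun j : 'I_d => delta_mx 0 j) (fun j v => v 0 j) _
  (fun k' y => F y 0 k') (cst x) 1 (@row_basis d)
  (fun j v => mx_norm_coord v 0 j) oD cS (@cst_continuous _ _ x) (fun _ _ => Dx).
have := H 0; rewrite lexx ler01 => /(_ isT)[_ {}H].
have dE : 'd F x = mulmxr Jm :> ('rV[R]_d -> 'rV[R]_e).
  apply: diff_unique.
    move=> v; apply: (@cvg_mulmx _ _ (nbhs v) _ _ _ _ id (cst Jm)).
      exact: cvg_id.
    exact: cvg_cst.
  apply/eqaddoP => eps eps0 /=.
  have r0 : 0 < Num.min rho (eps / (K + 1)).
    by rewrite lt_min rho0 divr_gt0// ltr_wpDl.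
  have : \forall y \near (0 : 'rV[R]_d), `|y| < Num.min rho (eps / (K + 1)).
    exact: nbhs0_lt.
  apply: filterS => y; rewrite lt_min => /andP[yr ye].
  have Ky : K * `|y| <= eps.
    move: ye; rewrite ltr_pdivlMr ?ltr_wpDl// mulrDr mulr1 mulrC => /ltW.
    by apply: le_trans; rewrite lerDl.
  apply: mx_norm_le => [|i k']; first by rewrite mulr_ge0// ltW.
  rewrite ord1 !mxE.
  have := H k' y 0 `|y| (ltW yr) (lexx _).
  rewrite normr0 => /(_ (normr_ge0 _)); rewrite subr0 addr0 [x + y]addrC.
  rewrite [X in 'D_X _ _](row_basis y) (derive_sum_vec _ _ _ oD (cS1 k') Dx).
  rewrite opprD addrA.
  under [X in _ -> `|_ - X| <= _]eq_bigr do rewrite mxE.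
  by move=> h; rewrite (le_trans h)// ler_wpM2r.
by rewrite /jacobian mxE dE /= -rowE !mxE.
Qed.

Lemma hessian_quadratic d (S : 'rV[R]_d -> R) (u w : 'rV[R]_d) :
  class_C 2 setT S ->
  (w *m hessian S u *m w^T) 0 0 = 'D_w ('D_w S) u.
Proof.
move=> cS; have cS1 : class_C 1 setT S by exact: class_CS.
have expand (G : 'rV[R]_d -> R) x : class_C 1 setT G ->
    'D_w G x = \sum_j w 0 j * 'D_(delta_mx 0 j) G x.
  by move=> cG; rewrite {1}(row_basis w); exact: derive_sum_vec openT cG I.
have E : 'D_w S = fun x => \sum_j w 0 j * 'D_(delta_mx 0 j) S x.
  by apply/funext => x; exact: expand.
rewrite (expand _ _ (class_C_D w cS)).
rewrite -mulmxA mxE; apply: eq_bigr => i _; congr (_ * _).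
have dj j : is_derive u (delta_mx 0 i) (fun x => w 0 j * 'D_(delta_mx 0 j) S x)
    (w 0 j * 'D_(delta_mx 0 i) ('D_(delta_mx 0 j) S) u).
  have dd := class_C_derive (delta_mx 0 i) (class_C_D (delta_mx 0 j) cS) I.
  exact: (@is_deriveZ _ _ _ _ (w 0 j) _ _ _ (dd u)).
have := is_derive_sum dj; rewrite fct_sumE -E => -[_ ->].
by rewrite mxE; apply: eq_bigr => j _; rewrite !mxE mulrC.
Qed.

End row_vectors.

(** * Derivatives relative to the time interval, end points included *)

Section interval_derivatives.
Context {R : realType}.
Variables (T : R).
Local Notation I := (`[0, T]%classic : set R).

(** Properness of this filter makes the limit in [derive_on] unique, also at the end points. *)
Lemma within_dnbhs_proper (t : R) : 0 < T -> 0 <= t <= T ->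
  ProperFilter (within I t^').
Proof.
move=> T0 /andP[t0 tT]; apply: Build_ProperFilter_ex => // A.
rewrite /within/= => /nbhs_ballP[d /= d0 dA].
have [h|h] := ltP t T.
  exists (t + Num.min (d / 2) (T - t)).
  have m0 : 0 < Num.min (d / 2) (T - t) by rewrite lt_min divr_gt0//= subr_gt0.
  have m1 : Num.min (d / 2) (T - t) <= d / 2 by rewrite ge_min lexx.
  have m2 : Num.min (d / 2) (T - t) <= T - t by rewrite ge_min lexx orbT.
  apply: dA.
  - rewrite /ball/= opprD addrA subrr sub0r normrN gtr0_norm//.
    by clear -m1 d0; lra.
  - by rewrite -subr_eq0 addrAC subrr add0r gt_eqF.
  - rewrite in_itv/=; apply/andP; clear -m0 m2 t0; split; lra.
exists (t - Num.min (d / 2) T).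
have m0 : 0 < Num.min (d / 2) T by rewrite lt_min divr_gt0.
have m1 : Num.min (d / 2) T <= d / 2 by rewrite ge_min lexx.
have m2 : Num.min (d / 2) T <= T by rewrite ge_min lexx orbT.
apply: dA.
- rewrite /ball/= opprB addrCA subrr addr0 gtr0_norm//.
  by clear -m1 d0; lra.
- by rewrite -subr_eq0 addrAC subrr add0r oppr_eq0 gt_eqF.
- rewrite in_itv/=; apply/andP; clear -m0 m2 t0 tT h; split; lra.
Qed.

Lemma derive_on_val (V : normedModType R) (x : R -> V) (t : R) (l : V) :
  0 < T -> 0 <= t <= T -> diff_quot x t @ within I t^' --> l ->
  derivable_on I x t /\ derive_on I x t = l.
Proof.
move=> T0 tT xl; have pf := within_dnbhs_proper T0 tT.
split; first by apply/cvg_ex; exists l.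
by apply: cvg_lim.
Qed.

Lemma is_derive_diff_quot (f : R -> R) (t d : R) :
  is_derive t 1 f d <-> diff_quot f t @ t^' --> d.
Proof.
have E e : (\forall h \near (0 : R)^',
      `|d - h^-1 *: ((f \o shift t) (h *: 1) - f t)| <= e) <->
    (\forall s \near t^', `|d - diff_quot f t s| <= e).
  split => /nbhs_ballP[r /= r0 rP]; apply/nbhs_ballP; exists r => //= s sr s0.
    have := rP (s - t); rewrite /diff_quot /= [_%:A]mulr1 subrK; apply.
      by move: sr; rewrite /ball/= sub0r normrN distrC.
    by rewrite subr_eq0.
  have := rP (s + t); rewrite /diff_quot /= addrK [_%:A]mulr1; apply.
    by move: sr; rewrite /ball/= sub0r normrN opprD addrC subrK normrN.
  by rewrite -subr_eq0 addrK.
split=> [[df dE]|H].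
  apply/cvgrPdist_le => e e0; apply/E.
  by have := df; rewrite /derivable => /cvgrPdist_le; rewrite -/(derive _ _ _) dE; exact.
have L : h^-1 *: ((f \o shift t) (h *: 1) - f t) @[h --> (0 : R)^'] --> d.
  by apply/cvgrPdist_le => e e0; apply/E; move/cvgrPdist_le : H; exact.
by apply: DeriveDef; [apply/cvg_ex; exists d|apply: cvg_lim].
Qed.

Lemma derive_on_antiderivative p q (X X' : R -> 'M[R]_(p, q)) (t : R) :
  0 < T -> mx_antiderivative X X' -> 0 <= t <= T ->
  derivable_on I X t /\ derive_on I X t = X' t.
Proof.
move=> T0 dX tT; apply: derive_on_val => //.
apply: cvg_mx => i j.
have t1 : -1 < t by have /andP[t0 _] := tT; clear -t0; lra.
have /is_derive_diff_quot := dX i j t t1.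
rewrite /diff_quot => H; under eq_fun do rewrite !mxE.
by apply: cvg_within_filter; exact: H.
Qed.

(** Passage from derivatives relative to [0, T] to the two-sided calculus of antiderivatives:
    integrate the clamped derivative and identify the result with x on [0, T] by the mean value
    theorem. *)
Lemma antiderivative_extension p q (x : R -> 'M[R]_(p, q)) : 0 < T ->
  (forall t, I t -> derivable_on I x t) -> {within I, continuous x} ->
  {within I, continuous (derive_on I x)} ->
  exists X, mx_antiderivative X (fun t => derive_on I x (clamp T t)) /\
    forall t : R, 0 <= t <= T -> X t = x t.
Proof.
move=> T0 dx cx cx'; have T0' := ltW T0.
have cy := continuous_clamp T0' cx'.
set y := (fun t => derive_on I x (clamp T t)) in cy *.
exists (fun t => x 0 + mx_prim y t).
have dX : mx_antiderivative (fun t => x 0 + mx_prim y t) y.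
  move=> i j t t1; have := mx_antiderivativeD (mx_antiderivative_cst (x 0))
    (mx_prim_antiderivative cy) i j t1.
  by rewrite /= add0r.
split => // t tT; apply/matrixP => i j.
pose g s := (x 0 + mx_prim y s) i j - x s i j.
have [t0 tT'] := andP tT.
have g0 : g 0 = 0 by rewrite /g mx_prim0 addr0 subrr.
suff : g t - g 0 = 0 by rewrite g0 subr0 => /eqP; rewrite subr_eq0 => /eqP.
have [c cT ->] : exists2 c, c \in `[0, t]%R & g t - g 0 = cst 0 c * (t - 0).
  apply: MVT_segment => // [s|].
    rewrite in_itv/= => /andP[s0 st].
    have sT : s < T by rewrite (lt_le_trans st).
    have sI : 0 <= s <= T by rewrite !ltW.
    have s1 : -1 < s by clear -s0; lra.
    have d2 : is_derive s 1 (fun r => x r i j) (y s i j).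
      apply/is_derive_diff_quot.
      have Is : I s by rewrite /= in_itv.
      have := dx s Is; rewrite /derivable_on.
      rewrite -[lim _]/(derive_on I x s) => H.
      have {}H : diff_quot x s @ s^' --> y s.
        (* At an interior point of [0, T] the relative punctured neighbourhoods are the ordinary
           ones. *)
        rewrite /y clamp_id//; move: H; rewrite (_ : within I s^' = s^')//.
        apply/seteqP; split => U; rewrite /within/=.
          have nI : \forall r \near s, I r.
            have := @near_in_itvoo R 0 T s.
            rewrite in_itv/= s0 sT => /(_ isT); apply: filterS => r.
            by rewrite /= !in_itv/= => /andP[r0 rT]; rewrite !ltW.
          move=> UI; have : \forall r \near s^', I r by exact: (nbhs_dnbhs nI).
          move: UI; apply: filterS2 => r; apply.
        by apply: filterS => r Ur _.
      have := @cvg_mx_coord R _ (s^') _ p q _ _ i j H.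
      have FF : Filter s^' by exact: _.
      by move=> /(_ FF); rewrite /diff_quot; under eq_fun do rewrite !mxE.
    have := @is_deriveB _ _ _ _ _ _ _ _ _ (dX i j s s1) d2.
    by rewrite subrr.
  have cs : {within `[0, t], continuous (fun s => x s i j)}.
    have c1 : {within `[0, t], continuous x}.
      by apply: continuous_subspaceW cx => r; rewrite /= !in_itv/= => /andP[-> h];
        exact: le_trans tT'.
    by move=> r; apply: cvg_mx_coord; exact: c1.
  have c0 : {within `[0, t], continuous (fun s => (x 0 + mx_prim y s) i j)}.
    exact: antiderivative_continuous (ltrN10 R) (dX i j).
  by move=> r; apply: cvgB; [exact: c0|exact: cs].
by rewrite /= mul0r.
Qed.

Lemma antiderivative_absolutely_continuous d (X X' : R -> 'rV[R]_d) (K : R) :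
  mx_antiderivative X X' -> 0 < K ->
  (forall t : R, 0 <= t <= T -> `|X' t| <= K) -> absolutely_continuous 0 T X.
Proof.
move=> dX K0 XK e e0; exists (e / K); first by rewrite divr_gt0.
move=> N l r lr _; rewrite ltr_pdivlMr// => H.
apply: le_lt_trans H; rewrite mulr_suml; apply: ler_sum => i _.
have [l0 [lri rT]] := lr i.
have l1 : -1 < l i by clear -l0; lra.
have := mx_antiderivative_le_norm l1 lri dX (antiderivative_cst_mul K).
rewrite -mulrBr mulrC; apply => t /andP[h1 h2]; apply: XK.
by rewrite (le_trans l0)// (le_trans h2).
Qed.

End interval_derivatives.

(** A line containing a vector with nonzero last coordinate meets the hyperplane where that
    coordinate is 0 only at the origin. *)
Lemma corank1_last_coordinate (R : realType) n (S : set ('rV[R]_n * 'rV[R]_n * R^o))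
    W (p1 p2 q1 q2 : 'rV[R]_n) (b : R) :
  is_span_of S W -> \dim W = 1%N -> S (p1, p2, 0) -> S (q1, q2, b) -> b != 0 ->
  p1 = 0 /\ p2 = 0.
Proof.
move=> [SW _] W1 Sp Sq b0.
pose v : 'rV[R]_n * 'rV[R]_n * R^o := (p1, p2, 0).
have [v0|v0] := eqVneq v 0.
  by split; [exact: (congr1 (fun x => x.1.1) v0)|exact: (congr1 (fun x => x.1.2) v0)].
have vW : (<[v]> <= W)%VS by rewrite -memvE; exact: SW.
have /eqP E : (<[v]> == W)%VS by rewrite eqEdim vW dim_vline v0 W1.
have := SW _ Sq; rewrite -E => /vlineP[k /(congr1 snd)/= bE].
by move: b0; rewrite bE scaler0 eqxx.
Qed.

(** * The space of triples (q, v, u) *)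

Section state_control_space.
Context {R : realType} {n m : nat}.
Local Notation V3 := ('rV[R]_n * 'rV[R]_n * 'rV[R]_m)%type.

Definition triple_basis (j : 'I_n + 'I_n + 'I_m) : V3 :=
  match j with
  | inl (inl i) => (delta_mx 0 i, 0, 0)
  | inl (inr i) => (0, delta_mx 0 i, 0)
  | inr i => (0, 0, delta_mx 0 i)
  end.

Definition triple_coord (j : 'I_n + 'I_n + 'I_m) (x : V3) : R :=
  match j with
  | inl (inl i) => x.1.1 0 i
  | inl (inr i) => x.1.2 0 i
  | inr i => x.2 0 i
  end.

Lemma pair_norm (V W : normedModType R) (x : V * W) :
  `|x| = Num.max `|x.1| `|x.2|.
Proof. by []. Qed.

Lemma triple_norm_le (x : V3) (r : R) :
  (`|x| <= r) = [&& `|x.1.1| <= r, `|x.1.2| <= r & `|x.2| <= r].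
Proof. by rewrite pair_norm ge_max pair_norm ge_max andbA. Qed.

Lemma triple_coord_le j (x : V3) : `|triple_coord j x| <= `|x|.
Proof.
have := lexx `|x|; rewrite {1}triple_norm_le => /and3P[h1 h2 h3].
by case: j => [[j|j]|j] /=;
  [apply: le_trans h1|apply: le_trans h2|apply: le_trans h3]; exact: mx_norm_coord.
Qed.

Lemma addpE (V W : nmodType) (x y : V) (x' y' : W) :
  (x, x') + (y, y') = (x + y, x' + y').
Proof. by []. Qed.

Lemma scalepE (V W : lmodType R) (k : R) (y : V) (y' : W) :
  k *: (y, y') = (k *: y, k *: y').
Proof. by []. Qed.

Lemma sum_pair (V W : lmodType R) (J : Type) (r : seq J) (F : J -> V) (G : J -> W) :
  \sum_(j <- r) (F j, G j) = (\sum_(j <- r) F j, \sum_(j <- r) G j).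
Proof.
elim: r => [|j r IH]; first by rewrite !big_nil.
by rewrite !big_cons IH.
Qed.

Lemma triple_basisE (x : V3) :
  x = \sum_j triple_coord j x *: triple_basis j.
Proof.
case: x => [[a b] c]; rewrite !big_sumType/=.
under eq_bigr do rewrite !scalepE !scaler0.
under [X in _ + X + _]eq_bigr do rewrite !scalepE !scaler0.
under [X in _ + X]eq_bigr do rewrite !scalepE !scaler0.
rewrite !sum_pair -!row_sum_delta !big1_eq.
by rewrite !addpE !addr0 !add0r.
Qed.

Lemma derive_triple (S : V3 -> R) (D : set V3) (z : V3) a b c : open D ->
  class_C 1 D S -> D z -> 'D_((a, b, c) : V3) S z =
  \sum_j a 0 j * 'D_((delta_mx 0 j, 0, 0) : V3) S z +
  \sum_j b 0 j * 'D_((0, delta_mx 0 j, 0) : V3) S z +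
  \sum_j c 0 j * 'D_((0, 0, delta_mx 0 j) : V3) S z.
Proof.
move=> oD cS Dz; rewrite {1}(triple_basisE (a, b, c)).
by rewrite (derive_sum_vec _ _ _ oD cS Dz) !big_sumType.
Qed.

Definition slice_q (v : 'rV[R]_n) (u : 'rV[R]_m) (q : 'rV[R]_n) : V3 := (q, v, u).
Definition slice_v (q : 'rV[R]_n) (u : 'rV[R]_m) (v : 'rV[R]_n) : V3 := (q, v, u).
Definition slice_u (q v : 'rV[R]_n) (u : 'rV[R]_m) : V3 := (q, v, u).
Definition dir_q (w : 'rV[R]_n) : V3 := (w, 0, 0).
Definition dir_v (w : 'rV[R]_n) : V3 := (0, w, 0).
Definition dir_u (w : 'rV[R]_m) : V3 := (0, 0, w).

Lemma slice_qE v u (h : R) w q :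
  slice_q v u (h *: w + q) = h *: dir_q w + slice_q v u q.
Proof. by rewrite /slice_q /dir_q !scalepE !addpE !scaler0 !add0r. Qed.

Lemma slice_vE q u (h : R) w v :
  slice_v q u (h *: w + v) = h *: dir_v w + slice_v q u v.
Proof. by rewrite /slice_v /dir_v !scalepE !addpE !scaler0 !add0r. Qed.

Lemma slice_uE q v (h : R) w u :
  slice_u q v (h *: w + u) = h *: dir_u w + slice_u q v u.
Proof. by rewrite /slice_u /dir_u !scalepE !addpE !scaler0 !add0r. Qed.

Lemma slice_q_continuous v u : continuous (slice_q v u).
Proof.
move=> q; exact: (cvg_pair (cvg_pair (@cvg_id _ (nbhs q)) (cvg_cst v)) (cvg_cst u)).
Qed.

Lemma slice_v_continuous q u : continuous (slice_v q u).
Proof.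
move=> v; exact: (cvg_pair (cvg_pair (cvg_cst q) (@cvg_id _ (nbhs v))) (cvg_cst u)).
Qed.

Lemma slice_u_continuous q v : continuous (slice_u q v).
Proof.
move=> u; exact: (cvg_pair (cvg_pair (cvg_cst q) (cvg_cst v)) (@cvg_id _ (nbhs u))).
Qed.

Lemma pullback_affine d e (D : set V3) (F : V3 -> 'rV[R]_e)
    (io lam : 'rV[R]_d -> V3) (y : 'rV[R]_d) (k : 'rV[R]_e) : open D ->
  (forall (h : R) v y, io (h *: v + y) = h *: lam v + io y) -> continuous io ->
  class_C 2 D F -> D (io y) ->
  pullback k (F \o io) y =
    (\matrix_(i, j) 'D_(lam (delta_mx 0 i)) (fun x => F x 0 j) (io y) *m k^T)^T.
Proof.
move=> oD ioE cio cF Dy; rewrite /pullback trmx_mul trmxK; congr (_ *m _^T).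
have oD' : open (io @^-1` D) by apply: open_comp => // ? _; exact: cio.
apply/matrixP => i j; rewrite [RHS]mxE.
rewrite (jacobian_class_C _ _ oD' (class_C_affine ioE cio cF) Dy).
have E := derive_affine (fun x => F x 0 j) (delta_mx 0 i) ioE.
exact: (congr1 (fun g => g y) E).
Qed.

Lemma is_derive_dot_affine d e (D : set V3) (F : V3 -> 'rV[R]_e)
    (io lam : 'rV[R]_d -> V3) (y w : 'rV[R]_d) (k : 'rV[R]_e) : open D ->
  (forall (h : R) v y, io (h *: v + y) = h *: lam v + io y) -> continuous io ->
  class_C 1 D F -> D (io y) ->
  is_derive y w (fun y => dot k (F (io y)))
    (\sum_j k 0 j * 'D_(lam w) (fun x => F x 0 j) (io y)).
Proof.
move=> oD ioE cio cF Dy.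
have dj (j : 'I_e) : is_derive y w (fun y => k 0 j * F (io y) 0 j)
    (k 0 j * 'D_(lam w) (fun x => F x 0 j) (io y)).
  have cFj := class_C_coord 0 j oD cF.
  have dd := class_C_derive w (class_C_affine ioE cio cFj) Dy.
  have E := derive_affine (fun x => F x 0 j) w ioE.
  have {}dd := is_derive_eq dd (congr1 (fun g => g y) E).
  exact: (@is_deriveZ _ _ _ _ (k 0 j) _ _ _ dd).
by have := is_derive_sum dj; rewrite fct_sumE.
Qed.

End state_control_space.

(** * Deviations from a reference curve *)

Section deviation.
Context {R : realType} {n m : nat}.
Local Notation V3 := ('rV[R]_n * 'rV[R]_n * 'rV[R]_m)%type.
Implicit Types (S : V3 -> R) (F : V3 -> 'rV[R]_n) (z : V3).

Definition grad_q S z : 'cV[R]_n := \col_j 'D_(dir_q (delta_mx 0 j) : V3) S z.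
Definition grad_v S z : 'cV[R]_n := \col_j 'D_(dir_v (delta_mx 0 j) : V3) S z.
Definition grad_u S z : 'cV[R]_m := \col_j 'D_(dir_u (delta_mx 0 j) : V3) S z.

Definition jac_q F z : 'M[R]_n := \matrix_(i, j) grad_q (fun x => F x 0 j) z i 0.
Definition jac_v F z : 'M[R]_n := \matrix_(i, j) grad_v (fun x => F x 0 j) z i 0.
Definition jac_u F z : 'M[R]_(m, n) := \matrix_(i, j) grad_u (fun x => F x 0 j) z i 0.

(* Row vectors (dq, dv) of length n + n are the states of the first order form
   of the linearised equation, on which matrices act from the right. *)
Definition state_mx F z : 'M[R]_(n + n) := block_mx 0 (jac_q F z) 1%:M (jac_v F z).
Definition control_mx F z : 'M[R]_(m, n + n) := row_mx 0 (jac_u F z).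
Definition state_grad S z : 'cV[R]_(n + n) := col_mx (grad_q S z) (grad_v S z).

Definition dev (x : 'rV[R]_(n + n)) (u : 'rV[R]_m) : V3 := (lsubmx x, rsubmx x, u).

(** First order form of the equation for the difference between a trajectory and the reference: the
    position part is exactly linear, and only the velocity part carries a remainder. *)
Definition dyn_dev F z (x : 'rV[R]_(n + n)) (u : 'rV[R]_m) : 'rV[R]_(n + n) :=
  row_mx (rsubmx x) (F (z + dev x u) - F z).

Definition cost_dev S z (x : 'rV[R]_(n + n)) (u : 'rV[R]_m) : R :=
  S (z + dev x u) - S z.

Lemma dev0 : dev 0 0 = 0.
Proof. by rewrite /dev !linear0. Qed.

Lemma devB x1 x2 u1 u2 : dev (x1 - x2) (u1 - u2) = dev x1 u1 - dev x2 u2.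
Proof. by rewrite /dev !linearB. Qed.

Lemma submx_norm p (x : 'rV[R]_(p + p)) : `|lsubmx x| <= `|x| /\ `|rsubmx x| <= `|x|.
Proof.
by split; apply: mx_norm_le => // i j; rewrite !mxE; exact: mx_norm_coord.
Qed.

Lemma dev_norm x u r : `|x| <= r -> `|u| <= r -> `|dev x u| <= r.
Proof.
move=> xr ur; have [h1 h2] := submx_norm x; rewrite triple_norm_le /=.
by rewrite ur andbT; apply/andP; split; [apply: le_trans h1 _|apply: le_trans h2 _].
Qed.

Lemma dev_continuous (X : topologicalType) (x : X -> 'rV[R]_(n + n)) (u : X -> 'rV[R]_m) :
  continuous x -> continuous u -> continuous (fun t => dev (x t) (u t)).
Proof.
move=> cx cu.
have cl : continuous (fun t => lsubmx (x t)).
  apply: continuous_mx => i j; under eq_fun do rewrite mxE.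
  exact: continuous_mx_coord.
have cr : continuous (fun t => rsubmx (x t)).
  apply: continuous_mx => i j; under eq_fun do rewrite mxE.
  exact: continuous_mx_coord.
by move=> t; exact: (cvg_pair (cvg_pair (cl t) (cr t)) (cu t)).
Qed.

Lemma mul_state_grad S z (x : 'rV[R]_(n + n)) :
  (x *m state_grad S z) 0 0 =
  \sum_j lsubmx x 0 j * 'D_(dir_q (delta_mx 0 j) : V3) S z +
  \sum_j rsubmx x 0 j * 'D_(dir_v (delta_mx 0 j) : V3) S z.
Proof.
rewrite /state_grad -[in LHS](hsubmxK x) mul_row_col mxE.
by congr (_ + _); rewrite mxE; apply: eq_bigr => j _; congr (_ * _); rewrite mxE.
Qed.

Lemma mul_grad_u S z (u : 'rV[R]_m) :
  (u *m grad_u S z) 0 0 = \sum_j u 0 j * 'D_(dir_u (delta_mx 0 j) : V3) S z.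
Proof. by rewrite mxE; apply: eq_bigr => j _; congr (_ * _); rewrite mxE. Qed.

Lemma derive_dev S D z x u : open D -> class_C 1 D S -> D z ->
  'D_(dev x u) S z = (x *m state_grad S z + u *m grad_u S z) 0 0.
Proof.
move=> oD cS Dz; rewrite /dev (derive_triple _ _ _ oD cS Dz).
by rewrite [RHS]mxE mul_state_grad mul_grad_u.
Qed.

Lemma dyn_dev_l F z x u k : dyn_dev F z x u 0 (lshift n k) = rsubmx x 0 k.
Proof. by rewrite /dyn_dev row_mxEl. Qed.

Lemma dyn_dev_r F z x u k :
  dyn_dev F z x u 0 (rshift n k) = F (z + dev x u) 0 k - F z 0 k.
Proof. by rewrite /dyn_dev row_mxEr 2!mxE. Qed.

Lemma mul_state_mx_l F z (x : 'rV[R]_(n + n)) k :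
  (x *m state_mx F z) 0 (lshift n k) = rsubmx x 0 k.
Proof.
rewrite /state_mx -[in LHS](hsubmxK x) mul_row_block row_mxEl.
by rewrite mulmx0 add0r mulmx1.
Qed.

Lemma mul_state_mx_r F z (x : 'rV[R]_(n + n)) k :
  (x *m state_mx F z) 0 (rshift n k) =
  (x *m state_grad (fun x => F x 0 k) z) 0 0.
Proof.
rewrite mul_state_grad /state_mx -[in LHS](hsubmxK x) mul_row_block row_mxEr.
rewrite [LHS]mxE; congr (_ + _).
  by rewrite mxE; apply: eq_bigr => i _; congr (_ * _); rewrite mxE mxE.
by rewrite mxE; apply: eq_bigr => i _; congr (_ * _); rewrite mxE mxE.
Qed.

Lemma mul_control_mx_l F z (u : 'rV[R]_m) k : (u *m control_mx F z) 0 (lshift n k) = 0.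
Proof. by rewrite /control_mx mul_mx_row row_mxEl mulmx0 mxE. Qed.

Lemma mul_control_mx_r F z (u : 'rV[R]_m) k :
  (u *m control_mx F z) 0 (rshift n k) = (u *m grad_u (fun x => F x 0 k) z) 0 0.
Proof.
rewrite /control_mx mul_mx_row row_mxEr mxE [RHS]mxE.
by apply: eq_bigr => i _; congr (_ * _); rewrite mxE.
Qed.

Section remainder.
Variables (F : V3 -> 'rV[R]_n) (S : V3 -> R) (D : set V3) (z : R -> V3) (T : R).
Hypotheses (oD : open D) (cF : class_C 2 D F) (cS : class_C 2 D S).
Hypotheses (cz : continuous z) (Dz : forall t, D (z t)).

Lemma deviation_remainder : exists rho K : R, [/\ 0 < rho, 0 <= K &
  forall t : R, 0 <= t <= T ->
    (forall h, `|h| <= rho -> D (z t + h)) /\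
    forall x1 x2 u1 u2 r, r <= rho ->
      `|x1| <= r -> `|x2| <= r -> `|u1| <= r -> `|u2| <= r ->
      `|dyn_dev F (z t) x1 u1 - dyn_dev F (z t) x2 u2 -
          ((x1 - x2) *m state_mx F (z t) + (u1 - u2) *m control_mx F (z t))|
        <= K * r * (`|x1 - x2| + `|u1 - u2|) /\
      `|cost_dev S (z t) x1 u1 - cost_dev S (z t) x2 u2 -
          ((x1 - x2) *m state_grad S (z t) + (u1 - u2) *m grad_u S (z t)) 0 0|
        <= K * r * (`|x1 - x2| + `|u1 - u2|)].
Proof.
(* The cost and the components of the dynamics form one finite family, so that a single rho and a
   single K serve all of them. *)
pose fam (k : option 'I_n) : V3 -> R :=
  if k is Some i then fun x => F x 0 i else S.
have cfam k : class_C 2 D (fam k).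
  by case: k => [i|]; [exact: class_C_coord|exact: cS].
have [rho [K [rho0 K0 H]]] := @quadratic_remainder R _ D _
  (@triple_basis R n m) (@triple_coord R n m) _ fam z T
  (@triple_basisE R n m) (@triple_coord_le R n m) oD cfam cz (fun t _ => Dz t).
exists rho, K; split => // t tT; have [Dh {}H] := H t tT; split => //.
move=> x1 x2 u1 u2 r rr xr1 xr2 ur1 ur2.
have r0 : 0 <= r by exact: le_trans xr1.
have est k : `|fam k (z t + dev x1 u1) - fam k (z t + dev x2 u2) -
    ((x1 - x2) *m state_grad (fam k) (z t) + (u1 - u2) *m grad_u (fam k) (z t)) 0 0|
    <= K * r * (`|x1 - x2| + `|u1 - u2|).
  have := H k _ _ r rr (dev_norm xr1 ur1) (dev_norm xr2 ur2).
  rewrite -devB (derive_dev _ _ oD (class_CS (cfam k)) (Dz t)) => h.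
  rewrite (le_trans h)// ler_wpM2l ?mulr_ge0//.
  by apply: dev_norm; [rewrite lerDl|rewrite lerDr].
split; last first.
  by have := est None; rewrite /cost_dev opprB [_ - _ + (_ - _)]addrA subrK.
apply: mx_norm_le => [|i j]; first by rewrite !mulr_ge0// addr_ge0.
have E p (a b c d : 'rV[R]_p) l :
    (a - b - (c + d)) 0 l = a 0 l - b 0 l - (c 0 l + d 0 l) by rewrite !mxE.
rewrite ord1 -[j](splitK j) E; case: (fintype.split j) => k /=.
  rewrite !dyn_dev_l mul_state_mx_l mul_control_mx_l addr0.
  rewrite linearB/= !mxE subrr normr0.
  by rewrite !mulr_ge0// addr_ge0.
have := est (Some k); rewrite /fam => h; apply: le_trans h.
rewrite !dyn_dev_r mul_state_mx_r mul_control_mx_r.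
rewrite [((x1 - x2) *m _ + _) 0 0]mxE.
set p := F _ 0 k; set q := F (z t) 0 k; set r' := F _ 0 k.
by rewrite opprB [p - q + (q - r')]addrA subrK.
Qed.

Lemma continuous_along (G : V3 -> R) v : class_C 1 D G ->
  continuous (fun t => 'D_v G (z t)).
Proof.
move=> cG t; apply: (@continuous_comp _ _ _ z ('D_v G)); first exact: cz.
exact: class_C_continuous (class_C_D v cG) (Dz t).
Qed.

Lemma grad_q_continuous (G : V3 -> R) : class_C 1 D G ->
  continuous (fun t => grad_q G (z t)).
Proof.
move=> cG; apply: continuous_mx => i j; under eq_fun do rewrite mxE.
exact: continuous_along.
Qed.

Let cFk k : class_C 1 D (fun x => F x 0 k).
Proof. by apply: class_CS; exact: class_C_coord. Qed.

Lemma jac_q_continuous : continuous (fun t => jac_q F (z t)).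
Proof.
apply: continuous_mx => i j; under eq_fun do rewrite !mxE.
exact: continuous_along.
Qed.

Lemma jac_v_continuous : continuous (fun t => jac_v F (z t)).
Proof.
apply: continuous_mx => i j; under eq_fun do rewrite !mxE.
exact: continuous_along.
Qed.

Lemma jac_u_continuous : continuous (fun t => jac_u F (z t)).
Proof.
apply: continuous_mx => i j; under eq_fun do rewrite !mxE.
exact: continuous_along.
Qed.

Lemma state_mx_continuous : continuous (fun t => state_mx F (z t)).
Proof.
apply: continuous_mx => i j; rewrite /state_mx -[i](splitK i) -[j](splitK j).
case: (fintype.split i) => i'; case: (fintype.split j) => j' /=.
- under eq_fun do rewrite block_mxEul; exact: cst_continuous.
- under eq_fun do rewrite block_mxEur; exact: continuous_mx_coord jac_q_continuous.
- under eq_fun do rewrite block_mxEdl; exact: cst_continuous.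
- under eq_fun do rewrite block_mxEdr; exact: continuous_mx_coord jac_v_continuous.
Qed.

Lemma control_mx_continuous : continuous (fun t => control_mx F (z t)).
Proof.
apply: continuous_mx => i j; rewrite /control_mx -[j](splitK j).
case: (fintype.split j) => j' /=.
- under eq_fun do rewrite row_mxEl; exact: cst_continuous.
- under eq_fun do rewrite row_mxEr; exact: continuous_mx_coord jac_u_continuous.
Qed.

Lemma value_continuous (W : normedModType R) (G : V3 -> W) (h : R -> V3) k :
  class_C k D G -> continuous h -> (forall t, D (z t + h t)) ->
  continuous (fun t => G (z t + h t)).
Proof.
move=> cG ch Dh t; apply: (@continuous_comp _ _ _ (fun t => z t + h t) G).
  by apply: cvgD; [exact: cz|exact: ch].
exact: class_C_continuous cG (Dh t).
Qed.

Lemma dyn_dev_continuous (x : R -> 'rV[R]_(n + n)) (u : R -> 'rV[R]_m) :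
  continuous x -> continuous u -> (forall t, D (z t + dev (x t) (u t))) ->
  continuous (fun t => dyn_dev F (z t) (x t) (u t)).
Proof.
move=> cx cu Dh.
have c1 := value_continuous cF (dev_continuous cx cu) Dh.
have c2 : continuous (fun t => F (z t)).
  move=> t; apply: (@continuous_comp _ _ _ z F); first exact: cz.
  exact: class_C_continuous cF (Dz t).
apply: continuous_mx => i j; rewrite -[j](splitK j); case: (fintype.split j) => k /=.
  under eq_fun do rewrite row_mxEl mxE; exact: continuous_mx_coord.
under eq_fun do rewrite row_mxEr.
apply: (@continuous_mx_coord _ _ _ _ (fun t => F (z t + dev (x t) (u t)) - F (z t))).
by move=> t; apply: cvgB; [exact: c1|exact: c2].
Qed.

Lemma cost_dev_continuous (x : R -> 'rV[R]_(n + n)) (u : R -> 'rV[R]_m) :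
  continuous x -> continuous u -> (forall t, D (z t + dev (x t) (u t))) ->
  continuous (fun t => cost_dev S (z t) (x t) (u t)).
Proof.
move=> cx cu Dh t; apply: cvgB.
  exact: (value_continuous cS (dev_continuous cx cu) Dh).
apply: (@continuous_comp _ _ _ z S); first exact: cz.
exact: class_C_continuous cS (Dz t).
Qed.

End remainder.

End deviation.

(** * Hamiltonian, abnormal multipliers and second order expansion *)

Section slices.
Context {R : realType} {n m : nat}.
Local Notation V3 := ('rV[R]_n * 'rV[R]_n * 'rV[R]_m)%type.
Variables (Q : set 'rV[R]_n) (C : 'rV[R]_n -> 'rV[R]_n -> 'rV[R]_m -> R).
Variables (f : 'rV[R]_n -> 'rV[R]_n -> 'rV[R]_m -> 'rV[R]_n).

Definition cost_map (x : V3) : R := C x.1.1 x.1.2 x.2.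
Definition dyn_map (x : V3) : 'rV[R]_n := f x.1.1 x.1.2 x.2.

Local Notation D := (@state_control_domain R n m Q).

Lemma open_state_control_domain : open Q -> open D.
Proof.
move=> oQ; have -> : D = (fun x : V3 => x.1.1) @^-1` Q by [].
by apply: open_comp => // x _; apply: (@continuous_comp _ _ _ fst fst);
  exact: cvg_fst.
Qed.

Lemma grad_slice_q q v u :
  grad (fun q' => C q' v u) q = (grad_q cost_map (q, v, u))^T.
Proof.
apply/rowP => j; rewrite !mxE.
exact: (congr1 (fun g => g q) (derive_affine cost_map _ (slice_qE v u))).
Qed.

Lemma grad_slice_v q v u :
  grad (fun v' => C q v' u) v = (grad_v cost_map (q, v, u))^T.
Proof.
apply/rowP => j; rewrite !mxE.
exact: (congr1 (fun g => g v) (derive_affine cost_map _ (slice_vE q u))).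
Qed.

Lemma grad_slice_u q v u :
  grad (fun u' => C q v u') u = (grad_u cost_map (q, v, u))^T.
Proof.
apply/rowP => j; rewrite !mxE.
exact: (congr1 (fun g => g u) (derive_affine cost_map _ (slice_uE q v))).
Qed.

Hypotheses (oQ : open Q) (cf : class_C 2 D dyn_map).
Let oD := open_state_control_domain oQ.

Lemma pullback_slice_q q v u k : Q q ->
  pullback k (fun q' => f q' v u) q = (jac_q dyn_map (q, v, u) *m k^T)^T.
Proof.
move=> Qq; have := pullback_affine k oD (slice_qE v u) (@slice_q_continuous _ _ _ v u) cf Qq.
move=> -> ; congr ((_ *m _)^T); apply/matrixP => i j.
by rewrite [RHS]mxE [RHS]mxE [LHS]mxE.
Qed.

Lemma pullback_slice_v q v u k : Q q ->
  pullback k (fun v' => f q v' u) v = (jac_v dyn_map (q, v, u) *m k^T)^T.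
Proof.
move=> Qq; have := pullback_affine k oD (slice_vE q u) (@slice_v_continuous _ _ _ q u) cf Qq.
move=> -> ; congr ((_ *m _)^T); apply/matrixP => i j.
by rewrite [RHS]mxE [RHS]mxE [LHS]mxE.
Qed.

Lemma pullback_slice_u q v u k : Q q ->
  pullback k (fun u' => f q v u') u = (jac_u dyn_map (q, v, u) *m k^T)^T.
Proof.
move=> Qq; have := pullback_affine k oD (slice_uE q v) (@slice_u_continuous _ _ _ q v) cf Qq.
move=> -> ; congr ((_ *m _)^T); apply/matrixP => i j.
by rewrite [RHS]mxE [RHS]mxE [LHS]mxE.
Qed.

Lemma is_derive_dot d (a x w : 'rV[R]_d) : is_derive x w (dot a) (dot a w).
Proof.
apply/is_derive_line0.
have E : (fun s : R => dot a (x + s *: w)) = cst (dot a x) + (fun s => dot a w * s).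
  apply/funext => s; rewrite /dot /= -[RHS]/(_ + _) mulr_suml -big_split/=.
  by apply: eq_bigr => i _; rewrite !mxE; ring.
have dd := @is_deriveD _ _ _ _ _ _ _ _ _ (is_derive_cst (dot a x) (0 : R) 1)
  (@antiderivative_cst_mul R (dot a w) 0 (ltrN10 R)).
by rewrite E; apply: (is_derive_eq dd); rewrite add0r.
Qed.

Lemma is_derive_dot_slice_q (k w q v : 'rV[R]_n) u : Q q ->
  is_derive q w (fun q' => dot k (f q' v u))
    (\sum_j k 0 j * 'D_(dir_q w) (fun x => dyn_map x 0 j) (q, v, u)).
Proof.
exact: (is_derive_dot_affine w k oD (slice_qE v u)
  (@slice_q_continuous _ _ _ v u) (class_CS cf)).
Qed.

Lemma is_derive_dot_slice_v (k w q v : 'rV[R]_n) u : Q q ->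
  is_derive v w (fun v' => dot k (f q v' u))
    (\sum_j k 0 j * 'D_(dir_v w) (fun x => dyn_map x 0 j) (q, v, u)).
Proof.
exact: (is_derive_dot_affine w k oD (slice_vE q u)
  (@slice_v_continuous _ _ _ q u) (class_CS cf)).
Qed.

Lemma is_derive_dot_slice_u (k q v : 'rV[R]_n) (w u : 'rV[R]_m) : Q q ->
  is_derive u w (fun u' => dot k (f q v u'))
    (\sum_j k 0 j * 'D_(dir_u w) (fun x => dyn_map x 0 j) (q, v, u)).
Proof.
exact: (is_derive_dot_affine w k oD (slice_uE q v)
  (@slice_u_continuous _ _ _ q v) (class_CS cf)).
Qed.

(** Only the abnormal Hamiltonian has to be differentiated: the costate of the normal case is
    obtained from the first order conditions on [kappa]. *)
Lemma hamiltonian0E q v lq lv u :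
  hamiltonian C f 0 q v lq lv u = dot lq v + dot lv (f q v u).
Proof. by rewrite /hamiltonian mul0r addr0. Qed.

Lemma grad_hamiltonian_q (lq lv q v : 'rV[R]_n) u : Q q ->
  grad (fun q' => hamiltonian C f 0 q' v lq lv u) q =
  (jac_q dyn_map (q, v, u) *m lv^T)^T.
Proof.
move=> Qq; under [fun q' => _]eq_fun do rewrite hamiltonian0E.
apply/rowP => j; rewrite [LHS]mxE [RHS]mxE [RHS]mxE.
have d := @is_deriveD _ _ _ _ _ _ _ _ _ (is_derive_cst (dot lq v) q (delta_mx 0 j))
  (is_derive_dot_slice_q lv (delta_mx 0 j) v u Qq).
rewrite add0r in d; case: d => _ ->.
by apply: eq_bigr => k _; rewrite mulrC; congr (_ * _); rewrite [RHS]mxE ?[RHS]mxE.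
Qed.

Lemma grad_hamiltonian_v (lq lv q v : 'rV[R]_n) u : Q q ->
  grad (fun v' => hamiltonian C f 0 q v' lq lv u) v =
  lq + (jac_v dyn_map (q, v, u) *m lv^T)^T.
Proof.
move=> Qq; under [fun q' => _]eq_fun do rewrite hamiltonian0E.
apply/rowP => j; rewrite [LHS]mxE [RHS]mxE [X in _ + X]mxE [X in _ + X]mxE.
have d := @is_deriveD _ _ _ _ _ _ _ _ _ (is_derive_dot lq v (delta_mx 0 j))
  (is_derive_dot_slice_v lv (delta_mx 0 j) v u Qq).
case: d => _ ->; congr (_ + _).
  rewrite /dot (bigD1 j)//= mxE !eqxx mulr1 big1 ?addr0// => i ij.
  by rewrite mxE (negbTE ij) andbF mulr0.
by apply: eq_bigr => k _; rewrite mulrC; congr (_ * _); rewrite [RHS]mxE ?[RHS]mxE.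
Qed.

Lemma grad_hamiltonian_u (lq lv q v : 'rV[R]_n) u : Q q ->
  grad (fun u' => hamiltonian C f 0 q v lq lv u') u =
  (jac_u dyn_map (q, v, u) *m lv^T)^T.
Proof.
move=> Qq; under [fun q' => _]eq_fun do rewrite hamiltonian0E.
apply/rowP => j; rewrite [LHS]mxE [RHS]mxE [RHS]mxE.
have d := @is_deriveD _ _ _ _ _ _ _ _ _ (is_derive_cst (dot lq v) u (delta_mx 0 j))
  (is_derive_dot_slice_u lv v (delta_mx 0 j) u Qq).
rewrite add0r in d; case: d => _ ->.
by apply: eq_bigr => k _; rewrite mulrC; congr (_ * _); rewrite [RHS]mxE ?[RHS]mxE.
Qed.

Lemma mul_state_mx (z : V3) (l : 'cV[R]_(n + n)) :
  state_mx dyn_map z *m l = col_mx (jac_q dyn_map z *m dsubmx l)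
    (usubmx l + jac_v dyn_map z *m dsubmx l).
Proof.
by rewrite /state_mx -{1}[l]vsubmxK mul_block_col mul0mx add0r mul1mx.
Qed.

Lemma mul_control_mx (z : V3) (l : 'cV[R]_(n + n)) :
  control_mx dyn_map z *m l = jac_u dyn_map z *m dsubmx l.
Proof. by rewrite /control_mx -{1}[l]vsubmxK mul_row_col mul0mx add0r. Qed.

(* A nonzero costate annihilated by the control matrix is an abnormal
   multiplier, and corank 1 leaves no room for it beside a normal one. *)
Lemma no_abnormal_costate (T : R) (q : R -> 'rV[R]_n) (u : R -> 'rV[R]_m)
    (z : R -> V3) (l l' : R -> 'cV[R]_(n + n)) : 0 < T ->
  (forall t : R, 0 <= t <= T ->
    z t = (q t, derive_on `[0, T] q t, u t) /\ Q (q t)) ->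
  continuous (fun t => state_mx dyn_map (z t)) ->
  normal C f T q u -> has_corank C f T q u 1 ->
  mx_antiderivative l l' ->
  (forall t : R, 0 <= t <= T -> l' t = - (state_mx dyn_map (z t) *m l t)) ->
  (forall t : R, 0 <= t <= T -> control_mx dyn_map (z t) *m l t = 0) -> l T = 0.
Proof.
move=> T0 zq cA [lq0 [lv0 [l0 [mult0 l00]]]] [W [WS W1]] dl lA lB.
have T0' := ltW T0; have TT : 0 <= T <= T by rewrite T0' lexx.
pose lq t := (usubmx (l t))^T; pose lv t := (dsubmx (l t))^T.
have dq : mx_antiderivative lq (fun t => (usubmx (l' t))^T).
  move=> i j t t1; rewrite !mxE; under eq_fun do rewrite !mxE; exact: dl.
have dv : mx_antiderivative lv (fun t => (dsubmx (l' t))^T).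
  move=> i j t t1; rewrite !mxE; under eq_fun do rewrite !mxE; exact: dl.
have eq_q (t : R) : 0 <= t <= T ->
    (usubmx (l' t))^T = - (jac_q dyn_map (z t) *m (lv t)^T)^T.
  by move=> tT; rewrite lA// mul_state_mx linearN/= col_mxKu linearN/= trmxK.
have eq_v (t : R) : 0 <= t <= T ->
    (dsubmx (l' t))^T = - (lq t + (jac_v dyn_map (z t) *m (lv t)^T)^T).
  move=> tT; rewrite lA// mul_state_mx linearN/= col_mxKd linearN/= trmxK.
  by rewrite linearD.
have [K [K0 lK]] : exists K, 0 < K /\ forall t : R, 0 <= t <= T -> `|l' t| <= K.
  have cl := mx_antiderivative_continuous T0' dl.
  have [K [K0 HK]] := exists_mx_bound T0' (continuous_mulmx cA cl).
  exists K; split => // t tT; rewrite lA// normrN.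
  by have := HK t tT; rewrite clamp_id.
(* A multiplier must be nontrivial, hence the argument by contradiction: if l T were nonzero, (lq,
   lv, 0) would be a genuine multiplier, and the corank would then make its value at T zero. *)
apply: contrapT => lT; have l_neq0 : ~ (lq T = 0 /\ lv T = 0).
  move=> [h1 h2]; apply: lT; rewrite -[l T]vsubmxK.
  by rewrite -[usubmx _]trmxK -[dsubmx _]trmxK -/(lq T) -/(lv T) h1 h2 !trmx0 col_mx0.
apply: (l_neq0).
have mult : multiplier C f T q u lq lv 0.
  split => //.
  - by move=> [h _]; apply: (l_neq0); apply: h; rewrite /= in_itv/=.
  - apply: (antiderivative_absolutely_continuous dq K0) => t tT.
    rewrite mx_norm_tr; apply: le_trans (lK t tT).
    by apply: mx_norm_le => // i j; rewrite mxE mx_norm_coord.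
  - apply: (antiderivative_absolutely_continuous dv K0) => t tT.
    rewrite mx_norm_tr; apply: le_trans (lK t tT).
    by apply: mx_norm_le => // i j; rewrite mxE mx_norm_coord.
  - apply: aeW => t; rewrite /= in_itv/= => tT; have [zt Qt] := zq t tT.
    have [h ->] := derive_on_antiderivative T0 dq tT; split => //.
    by rewrite grad_hamiltonian_q// -zt eq_q.
  - apply: aeW => t; rewrite /= in_itv/= => tT; have [zt Qt] := zq t tT.
    have [h ->] := derive_on_antiderivative T0 dv tT; split => //.
    by rewrite grad_hamiltonian_v// -zt eq_v.
  - move=> t; rewrite /= in_itv/= => tT; have [zt Qt] := zq t tT.
    rewrite grad_hamiltonian_u// -zt trmxK -mul_control_mx.
    by rewrite lB// trmx0.
apply: (@corank1_last_coordinate _ _ (multiplier_values C f T q u) W _ _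
  (lq0 T) (lv0 T) l0) => //.
  by exists lq, lv, 0.
by exists lq0, lv0, l0.
Qed.

End slices.

(** * Hamiltonian-type combinations of the dynamics and the cost *)

Section linear_combinations.
Context {R : realType} {V : normedModType R} {L : finType}.

(** Common shape of the Lagrangian (a is the term v_kappa . v_q, c the covector kappa) and of its
    derivatives: differentiation sends a to 0 and acts on g and g0, so the family is closed under
    it. *)
Definition lincomb (a : R) (c : L -> R) (g : L -> V -> R) (g0 : V -> R) (x : V) : R :=
  a + \sum_i c i * g i x - g0 x.

Lemma is_derive_lincomb a c g g0 (x v : V) (dg : L -> R) (dg0 : R) :
  (forall i, is_derive x v (g i) (dg i)) -> is_derive x v g0 dg0 ->
  is_derive x v (lincomb a c g g0) (\sum_i c i * dg i - dg0).
Proof.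
move=> dgi dg0'; rewrite -[X in X - _]add0r.
apply: (@is_deriveB _ _ _ (cst a + (fun x => \sum_i c i * g i x))) => //.
apply: is_deriveD.
have -> : (fun x => \sum_i c i * g i x) = \sum_i (fun x => c i * g i x).
  by rewrite fct_sumE.
elim/big_ind2 : _ => [|f1 d1 f2 d2 h1 h2|i _]; first exact: is_derive_cst.
  exact: is_deriveD.
exact: (@is_deriveZ _ _ _ _ (c i) _ _ _ (dgi i)).
Qed.

Lemma class_C_lincomb k (D : set V) a c g g0 : open D ->
  (forall i, class_C k D (g i)) -> class_C k D g0 ->
  class_C k D (lincomb a c g g0).
Proof.
move=> oD; elim: k a g g0 => [|k IH] a g g0 cg cg0.
all: have cl x : D x -> {for x, continuous (lincomb a c g g0)}.
1,3: move=> Dx; apply: cvgB; last exact: class_C_continuous cg0 Dx.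
1,2: apply: cvgD; first exact: cvg_cst.
1,2: apply: (cvg_big (U := R)) => [|i _]; first exact: add_continuous.
1,2: apply: cvgMl_tmp; exact: class_C_continuous (cg i) Dx.
  by split.
split => // v; have dl x : D x -> is_derive x v (lincomb a c g g0)
    (lincomb 0 c (fun i => 'D_v (g i)) ('D_v g0) x).
  move=> Dx; rewrite /lincomb add0r; apply: is_derive_lincomb => [i|].
    exact: class_C_derive (cg i) Dx.
  exact: class_C_derive cg0 Dx.
split=> [x /dl[]//|].
apply: (@class_C_ext _ _ _ k D (lincomb 0 c (fun i => 'D_v (g i)) ('D_v g0))) => //.
  by move=> x /dl[].
by apply: IH => [i|]; exact: class_C_D.
Qed.

Lemma derive_lincomb k (D : set V) a c g g0 v x :
  (forall i, class_C k.+1 D (g i)) -> class_C k.+1 D g0 -> D x ->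
  is_derive x v (lincomb a c g g0)
    (lincomb 0 c (fun i => 'D_v (g i)) ('D_v g0) x).
Proof.
move=> cg cg0 Dx; rewrite /lincomb add0r; apply: is_derive_lincomb => [i|].
  exact: class_C_derive (cg i) Dx.
exact: class_C_derive cg0 Dx.
Qed.

(** Taylor's inequality at a stationary point: the lower bound c1 on the second derivative gives a
    first derivative of at least c1 s, so the function minus c1 s^2 / 2 is nondecreasing. *)
Lemma line_second_order (D : set V) c g g0 (z e : V) (eta c1 : R) :
  (forall i, class_C 2 D (g i)) -> class_C 2 D g0 -> 0 <= eta ->
  (forall s : R, 0 <= s <= eta -> D (z + s *: e)) ->
  lincomb 0 c (fun i => 'D_e (g i)) ('D_e g0) z = 0 ->
  (forall s : R, 0 <= s <= eta -> c1 <=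
    lincomb 0 c (fun i => 'D_e ('D_e (g i))) ('D_e ('D_e g0)) (z + s *: e)) ->
  c1 * eta ^+ 2 / 2 <= lincomb 0 c g g0 (z + eta *: e) - lincomb 0 c g g0 z.
Proof.
move=> cg cg0 eta0 zD st h.
pose phi s := lincomb 0 c g g0 (z + s *: e).
pose phi1 s := lincomb 0 c (fun i => 'D_e (g i)) ('D_e g0) (z + s *: e).
pose phi2 s :=
  lincomb 0 c (fun i => 'D_e ('D_e (g i))) ('D_e ('D_e g0)) (z + s *: e).
have d1 (s : R) : 0 <= s <= eta -> is_derive s 1 phi (phi1 s).
  move=> /zD Ds; have := @derive_lincomb 1 D 0 c g g0 e _ cg cg0 Ds.
  by move=> /is_derive_line.
have d2 (s : R) : 0 <= s <= eta -> is_derive s 1 phi1 (phi2 s).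
  move=> /zD Ds; have := @derive_lincomb 0 D 0 c (fun i => 'D_e (g i)) ('D_e g0) e
    _ (fun i => class_C_D e (cg i)) (class_C_D e cg0) Ds.
  by move=> /is_derive_line.
have p1 (s : R) : 0 <= s <= eta -> c1 * s <= phi1 s.
  move=> /andP[s0 se].
  have dd (r : R) : 0 <= r <= s -> is_derive r 1 phi1 (phi2 r).
    by move=> /andP[r0 rs]; apply: d2; rewrite r0 (le_trans rs).
  have [r] : exists2 r, r \in `[0, s]%R & phi1 s - phi1 0 = phi2 r * (s - 0).
    apply: MVT_segment s0 _ _ => [r|].
      by rewrite in_itv/= => /andP[r0 rs]; apply: dd; rewrite !ltW.
    apply: derivable_within_continuous => r; rewrite in_itv/= => rs.
    by have [] := dd r rs.
  rewrite in_itv/= => /andP[r0 rs].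
  rewrite {2}/phi1 scale0r addr0 st !subr0 => ->.
  by rewrite ler_wpM2r// h// r0 (le_trans rs).
pose G s := phi s - c1 / 2 * (s * s).
have dG (s : R) : 0 <= s <= eta -> is_derive s 1 G (phi1 s - c1 * s).
  move=> sI; have dm : is_derive s 1 ((id : R -> R) * id) (s *: 1 + s *: 1).
    by apply: is_deriveM.
  have := @is_deriveB _ _ _ _ _ _ _ _ _ (d1 s sI)
    (@is_deriveZ _ _ _ _ (c1 / 2) _ _ _ dm).
  rewrite (_ : phi1 s - c1 * s = phi1 s - (c1 / 2) *: (s *: 1 + s *: 1)) //.
  by rewrite /GRing.scale/=; field.
have [r] : exists2 r, r \in `[0, eta]%R &
    G eta - G 0 = (phi1 r - c1 * r) * (eta - 0).
  apply: (@MVT_segment _ G (fun r => phi1 r - c1 * r)) => // [r|].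
    by rewrite in_itv/= => /andP[r0 rs]; apply: dG; rewrite !ltW.
  apply: derivable_within_continuous => r; rewrite in_itv/= => rs.
  by have [] := dG r rs.
rewrite in_itv/= => rI; have := p1 r rI; rewrite -subr_ge0 => h1.
rewrite subr0 => h2; have : 0 <= G eta - G 0 by rewrite h2 mulr_ge0.
rewrite /G /phi scale0r addr0 !mul0r mulr0 subr0 expr2.
by lra.
Qed.

End linear_combinations.

Lemma derive2_affine (R : realType) (V V' W : normedModType R) (F : V -> W)
    (io lam : V' -> V) (v y : V') :
  (forall (h : R) v y, io (h *: v + y) = h *: lam v + io y) ->
  'D_v ('D_v (F \o io)) y = 'D_(lam v) ('D_(lam v) F) (io y).
Proof.
move=> E; rewrite (derive_affine F v E).
exact: (congr1 (fun h => h y) (derive_affine ('D_(lam v) F) v E)).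
Qed.

Lemma lincomb_eq (R : realType) (V V' : normedModType R) (L : finType) a
    (c : L -> R) (g : L -> V -> R) (h : L -> V' -> R) (g0 : V -> R) (h0 : V' -> R)
    (x : V) (y : V') :
  (forall i, g i x = h i y) -> g0 x = h0 y ->
  lincomb a c g g0 x = lincomb a c h h0 y.
Proof.
by move=> gh gh0; rewrite /lincomb gh0; congr (_ + _ - _); apply: eq_bigr => i _;
  rewrite gh.
Qed.

(** The Hessian concerns the slice in u alone. Its quadratic form is rewritten with derivatives on
    the product space along [dir_u w], which makes its continuity in time and in (q, v, u) jointly
    available. *)
Lemma hessian_new_lagrangian (R : realType) n m (Q : set 'rV[R]_n)
    (C : 'rV[R]_n -> 'rV[R]_n -> 'rV[R]_m -> R)
    (f : 'rV[R]_n -> 'rV[R]_n -> 'rV[R]_m -> 'rV[R]_n) q kap vq vkap u w :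
  open Q -> class_C 2 (state_control_domain Q) (cost_map C) ->
  class_C 2 (state_control_domain Q) (dyn_map f) -> Q q ->
  (w *m hessian (new_lagrangian C f q kap vq vkap) u *m w^T) 0 0 =
  lincomb 0 (fun j => kap 0 j)
    (fun j => 'D_(dir_u w) ('D_(dir_u w) (fun x => dyn_map f x 0 j)))
    ('D_(dir_u w) ('D_(dir_u w) (cost_map C))) (q, vq, u).
Proof.
move=> oQ cC cf Qq; have oD := @open_state_control_domain _ _ m _ oQ.
pose io := @slice_u R n m q vq.
have ioT : io @^-1` state_control_domain Q = setT by apply/seteqP; split.
pose g j := (fun x => dyn_map f x 0 j) \o io.
pose g0 := cost_map C \o io.
have cg j : class_C 2 setT (g j).
  rewrite -ioT; apply: (class_C_affine (slice_uE q vq)).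
    exact: slice_u_continuous.
  exact: class_C_coord.
have cg0 : class_C 2 setT g0.
  rewrite -ioT; apply: (class_C_affine (slice_uE q vq)) => //.
  exact: slice_u_continuous.
have -> : new_lagrangian C f q kap vq vkap =
    lincomb (dot vkap vq) (fun j => kap 0 j) g g0 by [].
rewrite hessian_quadratic; last exact: class_C_lincomb openT cg cg0.
have -> : 'D_w (lincomb (dot vkap vq) (fun j => kap 0 j) g g0) =
    lincomb 0 (fun j => kap 0 j) (fun i => 'D_w (g i)) ('D_w g0).
  apply/funext => x.
  by have [] := derive_lincomb (dot vkap vq) (fun j => kap 0 j) w cg cg0 (I : setT x).
have [_ ->] := derive_lincomb 0 (fun j => kap 0 j) w
  (fun i => class_C_D w (cg i)) (class_C_D w cg0) (I : setT u).
apply: lincomb_eq => [j|].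
  exact: (derive2_affine (fun x => dyn_map f x 0 j) w u (slice_uE q vq)).
exact: (derive2_affine (cost_map C) w u (slice_uE q vq)).
Qed.

(** * The Legendre condition *)

Section relative_derivatives.
Context {R : realType}.
Variables (T : R).
Hypothesis T0 : 0 < T.
Local Notation I := (`[0, T]%classic : set R).

(** Meant for second derivatives: a first derivative relative to [0, T] is known to agree with an
    antiderivative on [0, T] only. *)
Lemma derive_on_antiderivative_eq p q (X X' x : R -> 'M[R]_(p, q)) (t : R) :
  mx_antiderivative X X' -> (forall s : R, 0 <= s <= T -> x s = X s) ->
  0 <= t <= T -> derivable_on I x t /\ derive_on I x t = X' t.
Proof.
move=> dX xX tT; have [d1 e1] := derive_on_antiderivative T0 dX tT.
apply: derive_on_val => //.
have H : diff_quot X t @ within I t^' --> X' t by rewrite -e1; exact: d1.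
apply: cvg_trans H; apply: near_eq_cvg.
have : \forall s \near within I t^', I s by exact: withinT.
by apply: filterS => s; rewrite /= in_itv/= => sT; rewrite /diff_quot !xX.
Qed.

Lemma derive_on_sub (V : normedModType R) (x y : R -> V) (t : R) :
  0 <= t <= T -> derivable_on I x t -> derivable_on I y t ->
  derivable_on I (fun s => x s - y s) t /\
  derive_on I (fun s => x s - y s) t = derive_on I x t - derive_on I y t.
Proof.
move=> tT dx dy; apply: derive_on_val => //.
have -> : diff_quot (fun s => x s - y s) t = diff_quot x t - diff_quot y t.
  apply/funext => s; rewrite /diff_quot /= -[RHS]/(_ - _) -scalerBr.
  by congr (_ *: _); rewrite !opprD !opprK addrACA.
exact: cvgB.
Qed.

Lemma derivable_on_continuous (V : normedModType R) (x : R -> V) :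
  (forall t, I t -> derivable_on I x t) -> {within I, continuous x}.
Proof.
move=> dx; apply/subspace_continuousP => t It.
have H : diff_quot x t @ within I t^' --> derive_on I x t by exact: dx.
have /cvgrPdist_le /(_ 1 ltr01) H1 := H.
apply/cvgrPdist_le => e e0; pose M := `|derive_on I x t| + 1.
have M0 : 0 < M by rewrite ltr_wpDl.
have ne : \forall s \near t, `|t - s| <= e / M.
  have /cvgrPdist_le := @cvg_id _ (nbhs t).
  by move=> /(_ (e / M)); apply; rewrite divr_gt0.
have H1' : nbhs t (fun s => s != t -> I s -> `|derive_on I x t - diff_quot x t s| <= 1) := H1.
suff : nbhs t (fun s => I s -> `|x t - x s| <= e) by [].
apply: (filterS2 _ _ H1' ne) => s Hs se Is.
have [->|st] := eqVneq s t; first by rewrite subrr normr0 ltW.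
have dM : `|diff_quot x t s| <= M.
  rewrite -[diff_quot x t s](subrK (derive_on I x t)) addrC.
  rewrite (le_trans (ler_normD _ _))// lerD2l distrC.
  exact: Hs.
have -> : x t - x s = (t - s) *: diff_quot x t s.
  rewrite /diff_quot scalerA -opprB -[t - s]opprB mulNr mulfV ?subr_eq0//.
  by rewrite scaleN1r.
rewrite normrZ (le_trans (ler_pM _ _ se dM))//.
by rewrite divfK// gt_eqF.
Qed.

End relative_derivatives.

Lemma primB (R : realType) (h k : R -> R) (t : R) : continuous h ->
  continuous k -> 0 <= t -> prim (fun s => h s - k s) t = prim h t - prim k t.
Proof.
move=> ch ck t0; have chk : continuous (fun s => h s - k s).
  by move=> s; apply: cvgB; [exact: ch|exact: ck].
rewrite (antiderivative_prim chk (H := fun s => prim h s - prim k s))//.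
  by rewrite !prim0 !subr0.
by move=> s s1; apply: is_deriveB; exact: prim_antiderivative.
Qed.

Lemma mx_antiderivative_tr (R : realType) p q (X X' : R -> 'M[R]_(p, q)) :
  mx_antiderivative X X' -> mx_antiderivative (fun t => (X t)^T) (fun t => (X' t)^T).
Proof. by move=> dX i j t t1; rewrite mxE; under eq_fun do rewrite mxE; exact: dX. Qed.

Lemma mx_antiderivative_col (R : realType) p1 p2 q (X X' : R -> 'M[R]_(p1, q))
    (Y Y' : R -> 'M[R]_(p2, q)) :
  mx_antiderivative X X' -> mx_antiderivative Y Y' ->
  mx_antiderivative (fun t => col_mx (X t) (Y t)) (fun t => col_mx (X' t) (Y' t)).
Proof.
move=> dX dY i j t t1; rewrite -[i](splitK i); case: (fintype.split i) => k /=.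
  by rewrite col_mxEu; under eq_fun do rewrite col_mxEu; exact: dX.
by rewrite col_mxEd; under eq_fun do rewrite col_mxEd; exact: dY.
Qed.

Lemma mx_antiderivative_lsub (R : realType) p q1 q2 (X X' : R -> 'M[R]_(p, q1 + q2)) :
  mx_antiderivative X X' ->
  mx_antiderivative (fun t => lsubmx (X t)) (fun t => lsubmx (X' t)).
Proof. by move=> dX i j t t1; rewrite mxE; under eq_fun do rewrite mxE; exact: dX. Qed.

Lemma mx_antiderivative_rsub (R : realType) p q1 q2 (X X' : R -> 'M[R]_(p, q1 + q2)) :
  mx_antiderivative X X' ->
  mx_antiderivative (fun t => rsubmx (X t)) (fun t => rsubmx (X' t)).
Proof. by move=> dX i j t t1; rewrite mxE; under eq_fun do rewrite mxE; exact: dX. Qed.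

(** * Costate, gain and perturbed pairs along the optimal pair *)

Section legendre.
Context {R : realType} {n m : nat}.
Local Notation V3 := ('rV[R]_n * 'rV[R]_n * 'rV[R]_m)%type.
Variables (Q : set 'rV[R]_n) (C : 'rV[R]_n -> 'rV[R]_n -> 'rV[R]_m -> R).
Variables (f : 'rV[R]_n -> 'rV[R]_n -> 'rV[R]_m -> 'rV[R]_n).
Variables (T : R) (q0 v0 qT vT : 'rV[R]_n).
Variables (q kappa : R -> 'rV[R]_n) (u : R -> 'rV[R]_m).
Hypotheses (oQ : open Q) (sm : smooth_data Q C f) (T0 : 0 < T).
Hypothesis foc : first_order_conditions Q C f T q0 v0 qT vT q kappa u.
Local Notation I := (`[0, T]%classic : set R).
Local Notation dt := (derive_on I).
Local Notation D := (@state_control_domain R n m Q).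
Local Notation F := (dyn_map f).
Local Notation S := (cost_map C).

Let cS : class_C 2 D S := sm.1.
Let cF : class_C 2 D F := sm.2.
Let oD : open D := open_state_control_domain oQ.
Let T0' : 0 <= T := ltW T0.

Definition reference (t : R) : V3 := (q (clamp T t), dt q (clamp T t), u (clamp T t)).
Local Notation z := reference.

Let adm : admissible Q f T q0 v0 qT vT q u := foc_adm foc.

Lemma reference_id (t : R) : 0 <= t <= T -> z t = (q t, dt q t, u t).
Proof. by move=> tT; rewrite /reference clamp_id. Qed.

Lemma reference_clamp (t : R) : z (clamp T t) = z t.
Proof. by rewrite /reference [clamp T (clamp T t)]clamp_id// clamp_itv. Qed.

Lemma reference_domain t : D (z t).
Proof. by apply: (adm_dom adm); rewrite /= in_itv/= clamp_itv. Qed.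

Lemma reference_continuous : continuous z.
Proof.
have [cq [_ [cv _]]] := adm_q adm.
have c1 := continuous_clamp T0' cq; have c2 := continuous_clamp T0' cv.
have c3 := continuous_clamp T0' (adm_u adm).
by move=> t; exact: (cvg_pair (cvg_pair (c1 t) (c2 t)) (c3 t)).
Qed.

Lemma momentum_termE (t : R) : 0 <= t <= T ->
  momentum_term C f T q kappa u t =
  (grad_v S (z t) - jac_v F (z t) *m (kappa t)^T)^T.
Proof.
move=> tT; have Qt : Q (q t) by apply: (adm_dom adm); rewrite /= in_itv.
rewrite /momentum_term grad_slice_v (pullback_slice_v oQ cF)// -reference_id//.
by rewrite linearB.
Qed.

(** The costate is l = (p - kappa', kappa) with p the momentum term dC/dv - kappa df/dv. The adjoint
    equation of [kappa], which is of second order, is the derivative of the first block; the second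
    block only restates the definition of p. *)
Lemma exists_costate : exists l l' : R -> 'cV[R]_(n + n),
  [/\ mx_antiderivative l l',
    forall t : R, 0 <= t <= T -> l' t = - (state_mx F (z t) *m l t - state_grad S (z t)),
    forall t : R, 0 <= t <= T -> control_mx F (z t) *m l t = grad_u S (z t) &
    forall t : R, 0 <= t <= T -> dsubmx (l t) = (kappa t)^T].
Proof.
have II (t : R) : 0 <= t <= T -> I t by rewrite /= in_itv.
have [ck [dk [ck1 [dk1 [ck2 _]]]]] := foc_kappa foc.
have [Xk [dXk Xkk]] := antiderivative_extension T0 dk ck ck1.
pose p := momentum_term C f T q kappa u.
pose pk t := p t - dt kappa t.
have dpk (t : R) : 0 <= t <= T -> derivable_on I pk t /\
    dt pk t = (grad_q S (z t) - jac_q F (z t) *m (kappa t)^T)^T.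
  move=> tT; have It := II t tT; have Qt : Q (q t) := adm_dom adm It.
  have [d1 ->] := derive_on_sub T0 tT (foc_der foc It) (dk1 t It); split => //.
  rewrite (foc_adj foc It) grad_slice_q (pullback_slice_q oQ cF)// -reference_id//.
  by rewrite linearB/= !opprD !opprK addrA addrA subrr add0r.
have cpk : {within I, continuous pk}.
  apply: derivable_on_continuous => t; rewrite /= in_itv/= => tT.
  by have [] := dpk t tT.
have ckc := continuous_clamp T0' ck.
(* Continuity comes from the adjoint equation, which expresses this derivative by first derivatives
   of C and f along the reference. *)
have cpk1 : {within I, continuous (dt pk)}.
  pose g t := (grad_q S (z t) - jac_q F (z t) *m (kappa (clamp T t))^T)^T.
  apply: (@continuous_eq_within _ _ _ _ g).
    apply: continuous_trmx => t; apply: cvgB.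
      exact: (grad_q_continuous reference_continuous reference_domain (class_CS cS)).
    apply: cvg_mulmx.
      exact: (jac_q_continuous oD cF reference_continuous reference_domain).
    exact: (continuous_trmx ckc).
  by move=> t tT; rewrite (dpk t tT).2 /g clamp_id.
have dpk' t : I t -> derivable_on I pk t.
  by rewrite /= in_itv/= => tT; have [] := dpk t tT.
have [Xp [dXp Xpp]] := antiderivative_extension T0 dpk' cpk cpk1.
exists (fun t => col_mx (Xp t)^T (Xk t)^T),
  (fun t => col_mx (dt pk (clamp T t))^T (dt kappa (clamp T t))^T).
split.
- by apply: mx_antiderivative_col; exact: mx_antiderivative_tr.
- move=> t tT; rewrite clamp_id// mul_state_mx col_mxKu col_mxKd Xpp// Xkk//.
  rewrite (dpk t tT).2 trmxK /state_grad opp_col_mx add_col_mx opp_col_mx.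
  have cancel (W : zmodType) (a b k : W) : - (a - b - k + b - a) = k.
    by rewrite [a - b - k]addrAC subrK addrAC subrr add0r opprK.
  have pkE : (pk t)^T = grad_v S (z t) - jac_v F (z t) *m (kappa t)^T - (dt kappa t)^T.
    by rewrite /pk /p momentum_termE// linearB/= trmxK.
  have E2 : (dt kappa t)^T =
      - ((pk t)^T + jac_v F (z t) *m (kappa t)^T - grad_v S (z t)).
    by rewrite pkE; exact/esym/cancel.
  exact: (congr2 col_mx (esym (opprB _ _)) E2).
- move=> t tT; have It := II t tT; have Qt : Q (q t) := adm_dom adm It.
  rewrite mul_control_mx col_mxKd Xkk//.
  have /esym/eqP := foc_stat foc It; rewrite subr_eq0 => /eqP.
  rewrite grad_slice_u (pullback_slice_u oQ cF)// -reference_id//.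
  by move/trmx_inj.
- by move=> t tT; rewrite col_mxKd Xkk.
Qed.

(** By continuity the second derivative along w stays above half its value at t0, for times near t0
    and controls near the reference. The first derivative vanishes along the reference, so Taylor's
    inequality bounds the increment below by a multiple of s^2, where s will be the height of the
    tent. *)
Lemma needle_gain (t0 : R) (w : 'rV[R]_m) (rho : R) (l : R -> 'cV[R]_(n + n)) :
  0 <= t0 <= T -> 0 < rho ->
  (forall t : R, 0 <= t <= T -> control_mx F (z t) *m l t = grad_u S (z t)) ->
  (forall t : R, 0 <= t <= T -> dsubmx (l t) = (kappa t)^T) ->
  0 < (w *m hessian (new_lagrangian C f (q t0) (kappa t0) (dt q t0)
         (dt kappa t0)) (u t0) *m w^T) 0 0 ->
  exists (eta del c0 : R), [/\ 0 < del, 0 < c0, `|eta *: w| <= rho / 2 &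
    forall t s : R, 0 <= t <= T -> `|t - t0| <= del -> 0 <= s <= 1 ->
      c0 * s ^+ 2 <= (dyn_dev F (z t) 0 (s *: (eta *: w)) *m l t) 0 0 -
        cost_dev S (z t) 0 (s *: (eta *: w))].
Proof.
move=> t0T rho0 lB lk; have II (t : R) : 0 <= t <= T -> I t by rewrite /= in_itv.
have Qt0 := adm_dom adm (II t0 t0T).
rewrite (hessian_new_lagrangian _ _ _ _ _ oQ cS cF Qt0) -reference_id//.
have [ck _] := foc_kappa foc; have ckc := continuous_clamp T0' ck.
pose e : V3 := dir_u w.
(* Phi is the second derivative of the Lagrangian along w as a function of time and point jointly;
   the clamp on [kappa] makes it continuous in t on the whole line. *)
have [Phi PhiE] : exists Phi : R -> V3 -> R, forall t x,
    Phi t x = lincomb 0 (fun j => kappa (clamp T t) 0 j)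
      (fun j => 'D_e ('D_e (fun x => F x 0 j))) ('D_e ('D_e S)) x.
  by exists (fun t x => lincomb 0 (fun j => kappa (clamp T t) 0 j)
      (fun j => 'D_e ('D_e (fun x => F x 0 j))) ('D_e ('D_e S)) x).
have PhiE' (t : R) x : 0 <= t <= T -> Phi t x =
    lincomb 0 (fun j => kappa t 0 j)
      (fun j => 'D_e ('D_e (fun x => F x 0 j))) ('D_e ('D_e S)) x.
  by move=> tT; rewrite PhiE clamp_id.
rewrite -PhiE'//.
move=> Phi0; have c10 : 0 < Phi t0 (z t0) / 2 by rewrite divr_gt0.
have cFj j : class_C 2 D (fun x => F x 0 j) by exact: class_C_coord.
have cPhi : {for (t0, z t0), continuous (fun y : R * V3 => Phi y.1 y.2)}.
  have Dz0 := reference_domain t0.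
  have -> : (fun y : R * V3 => Phi y.1 y.2) = (fun y : R * V3 =>
      lincomb 0 (fun j => kappa (clamp T y.1) 0 j)
      (fun j => 'D_e ('D_e (fun x => F x 0 j))) ('D_e ('D_e S)) y.2).
    by apply/funext => y; exact: PhiE.
  apply: cvgB; last first.
    apply: (@continuous_comp _ _ _ snd ('D_e ('D_e S))); first exact: cvg_snd.
    exact: (class_C_continuous (class_C_D e (class_C_D e cS)) Dz0).
  apply: cvgD; first exact: cvg_cst.
  apply: (cvg_big (U := R)) => [|j _]; first exact: add_continuous.
  apply: cvgM.
    apply: (@continuous_comp _ _ _ fst (fun t => kappa (clamp T t) 0 j)).
      exact: cvg_fst.
    exact: (continuous_mx_coord ckc).
  apply: (@continuous_comp _ _ _ snd ('D_e ('D_e (fun x => F x 0 j)))).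
    exact: cvg_snd.
  exact: (class_C_continuous (class_C_D e (class_C_D e (cFj j))) Dz0).
have [r [r0 rP]] : exists r : R, 0 < r /\ forall (t : R) x, `|t - t0| < r ->
    `|x - z t0| < r -> Phi t0 (z t0) / 2 <= Phi t x.
  have /cvgrPdist_le /(_ _ c10) [[A1 A2] /= [/nbhs_ballP[d1 /= d10 B1]
    /nbhs_ballP[d2 /= d20 B2]] AB] := cPhi.
  exists (Num.min d1 d2); split; first by rewrite lt_min d10.
  move=> t x; rewrite !lt_min => /andP[td _] /andP[_ xd].
  have h1 : A1 t by apply: B1; rewrite /ball/= distrC.
  have h2 : A2 x by apply: B2; rewrite -ball_normE/= distrC.
  have := AB (t, x) (conj h1 h2); rewrite /= => h3.
  have := le_trans (ler_norm _) h3.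
  by rewrite lerBlDr {1}(splitr (Phi t0 (z t0))) lerD2l.
have r20 : 0 < r / 2 by rewrite divr_gt0.
have [d [d0 dP]] : exists d : R, 0 < d /\
    forall t : R, `|t - t0| < d -> `|z t - z t0| < r / 2.
  have /cvgrPdist_lt /(_ _ r20) /nbhs_ballP[d /= d0 B] := @reference_continuous t0.
  exists d; split => // t td; rewrite distrC; apply: B.
  by rewrite /ball/= distrC.
(* Height of the needle: eta |w| < r / 2 keeps the perturbed point where Phi is at least half its
   initial value, and eta |w| < rho / 2 meets the demand of the perturbation argument. *)
pose eta := Num.min (r / 2) (rho / 2) / (`|w| + 1).
have w1 : 0 < `|w| + 1 by rewrite ltr_wpDl.
have mm0 : 0 < Num.min (r / 2) (rho / 2) by rewrite lt_min r20 divr_gt0.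
have eta0 : 0 < eta by rewrite divr_gt0.
have etaw : eta * `|w| < Num.min (r / 2) (rho / 2).
  by rewrite /eta mulrAC ltr_pdivrMr// ltr_pM2l// ltrDl.
exists eta, (Num.min (r / 2) (d / 2)), (Phi t0 (z t0) / 2 * eta ^+ 2 / 2); split.
- by rewrite lt_min r20 divr_gt0.
- by rewrite divr_gt0// mulr_gt0// exprn_gt0.
- rewrite normrZ gtr0_norm// (le_trans (ltW etaw))//.
  by rewrite ge_min lexx orbT.
move=> t s tT; rewrite le_min => /andP[tr td] /andP[s0 s1].
have Qt := adm_dom adm (II t tT).
have se0 : 0 <= s * eta by rewrite mulr_ge0// ltW.
have devE : dev 0 (s *: (eta *: w)) = (s * eta) *: e.
  by rewrite /dev /e /dir_u !linear0 scalerA scalepE scalepE !scaler0.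
have hE : (dyn_dev F (z t) 0 (s *: (eta *: w)) *m l t) 0 0 -
    cost_dev S (z t) 0 (s *: (eta *: w)) =
    lincomb 0 (fun j => kappa t 0 j) (fun j x => F x 0 j) S (z t + (s * eta) *: e) -
    lincomb 0 (fun j => kappa t 0 j) (fun j x => F x 0 j) S (z t).
  rewrite /dyn_dev /cost_dev devE linear0 -{1}[l t]vsubmxK mul_row_col mul0mx add0r.
  rewrite lk// mxE /lincomb !add0r.
  have -> : \sum_j (F (z t + (s * eta) *: e) - F (z t)) 0 j * (kappa t)^T j 0 =
      \sum_j kappa t 0 j * F (z t + (s * eta) *: e) 0 j -
      \sum_j kappa t 0 j * F (z t) 0 j.
    by rewrite -sumrB; apply: eq_bigr => j _; rewrite !mxE; ring.
  by ring.
rewrite hE; have -> : Phi t0 (z t0) / 2 * eta ^+ 2 / 2 * s ^+ 2 =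
    Phi t0 (z t0) / 2 * (s * eta) ^+ 2 / 2 by ring.
have zD (a : R) : 0 <= a <= s * eta -> D (z t + a *: e).
  move=> _; have -> : z t + a *: e = (q t, dt q t, u t + a *: w).
    by rewrite reference_id// /e /dir_u !scalepE !addpE !scaler0 !addr0.
  exact: Qt.
(* Stationarity in u at every time t, read off from control_mx l = grad_u, whose only contributing
   block of l is [kappa]. *)
have stat : lincomb 0 (fun j => kappa t 0 j) (fun j => 'D_e (fun x => F x 0 j))
    ('D_e S) (z t) = 0.
  rewrite /lincomb add0r; apply/eqP; rewrite subr_eq0; apply/eqP.
  have de (G : V3 -> R) : class_C 2 D G -> 'D_e G (z t) = (w *m grad_u G (z t)) 0 0.
    move=> cG; have -> : e = dev 0 w by rewrite /e /dev /dir_u !linear0.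
    rewrite (derive_dev _ _ oD (class_CS cG) (reference_domain t)).
    by rewrite mul0mx add0r.
  rewrite (de _ cS) -lB// mul_control_mx lk// mulmxA mxE.
  apply: eq_bigr => j _; rewrite (de _ (cFj j)) mulrC; congr (_ * _); last first.
    by rewrite mxE.
  rewrite mxE [RHS]mxE; apply: eq_bigr => i _; congr (_ * _).
  by rewrite [RHS]mxE.
have pos (a : R) : 0 <= a <= s * eta -> Phi t0 (z t0) / 2 <=
    lincomb 0 (fun j => kappa t 0 j)
      (fun j => 'D_e ('D_e (fun x => F x 0 j))) ('D_e ('D_e S)) (z t + a *: e).
  move=> /andP[a0 ae]; rewrite -PhiE'//.
  have m1 : Num.min (r / 2) (rho / 2) <= r / 2 by rewrite ge_min lexx.
  have half (y : R) : 0 < y -> y / 2 < y.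
    by move=> y0; rewrite ltr_pdivrMr// ltr_pMr// ltr1n.
  apply: rP; first exact: le_lt_trans tr (half r r0).
  have zt : `|z t - z t0| < r / 2 by apply: dP; exact: le_lt_trans td (half d d0).
  have ew : `|e| <= `|w| by rewrite triple_norm_le /= !normr0 normr_ge0 lexx.
  have ae2 : `|a *: e| < r / 2.
    rewrite normrZ ger0_norm//; apply: le_lt_trans (lt_le_trans etaw m1).
    by rewrite ler_pM// (le_trans ae)// ler_piMl// ltW.
  by rewrite addrAC (le_lt_trans (ler_normD _ _))// (splitr r) ltrD.
exact: (line_second_order cFj cS se0 zD stat pos).
Qed.

Lemma perturbed_admissible (x x' : R -> 'rV[R]_(n + n)) (nu : R -> 'rV[R]_m)
    (rho : R) :
  (forall t h, 0 <= t <= T -> `|h| <= rho -> D (z t + h)) ->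
  mx_antiderivative x x' -> continuous nu -> x 0 = 0 -> x T = 0 ->
  (forall t : R, 0 <= t <= T ->
    [/\ x' t = dyn_dev F (z t) (x t) (nu t), `|x t| <= rho & `|nu t| <= rho]) ->
  exists q1 u1, [/\ admissible Q f T q0 v0 qT vT q1 u1 &
    cost C T q1 u1 - cost C T q u =
    prim (fun t => cost_dev S (z t) (x (clamp T t)) (nu (clamp T t))) T].
Proof.
move=> zD dx cnu x0 xT xd.
have II (t : R) : 0 <= t <= T -> I t by rewrite /= in_itv.
have TT : 0 <= T <= T by rewrite T0' lexx.
have [cq [dq [cq1 [dq1 [cq2 _]]]]] := adm_q adm.
(* The reference position and velocity are replaced by extensions with two-sided derivatives, to
   which the deviation x can be added. *)
have [Xq [dXq Xqq]] := antiderivative_extension T0 dq cq cq1.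
have [Xv [dXv Xvv]] := antiderivative_extension T0 dq1 cq1 cq2.
have dxq := mx_antiderivativeD dXq (mx_antiderivative_lsub dx).
have dxv := mx_antiderivativeD dXv (mx_antiderivative_rsub dx).
pose q1 t := Xq t + lsubmx (x t).
pose v1 t := Xv t + rsubmx (x t).
pose u1 t := u t + nu t.
have Dx (t : R) : 0 <= t <= T -> D (z t + dev (x t) (nu t)).
  by move=> tT; have [_ h1 h2] := xd t tT; apply: zD => //; exact: dev_norm.
have pt (t : R) : 0 <= t <= T -> z t + dev (x t) (nu t) = (q1 t, v1 t, u1 t).
  by move=> tT; rewrite reference_id// /dev !addpE /q1 /v1 Xqq// Xvv.
have dq1E (t : R) : 0 <= t <= T -> derivable_on I q1 t /\ dt q1 t = v1 t.
  move=> tT; have [h1 h2] := derive_on_antiderivative T0 dxq tT; split => //.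
  rewrite h2 (clamp_id tT) /v1 (Xvv t tT); have [-> _ _] := xd t tT.
  by rewrite /dyn_dev row_mxKl.
have ode (t : R) : 0 <= t <= T -> derivable_on I (dt q1) t /\
    dt (dt q1) t = F (z t + dev (x t) (nu t)).
  move=> tT; have dE (s : R) : 0 <= s <= T -> dt q1 s = v1 s.
    by move=> sT; have [] := dq1E s sT.
  have [h1 h2] := derive_on_antiderivative_eq T0 dxv dE tT; split => //.
  rewrite h2 (clamp_id tT); have [-> _ _] := xd t tT.
  rewrite /dyn_dev row_mxKr (adm_ode adm (II t tT)).
  have -> : f (q t) (dt q t) (u t) = F (z t) by rewrite reference_id.
  by rewrite addrC subrK.
have cxc := mx_antiderivative_continuous T0' dx.
have cnc : continuous (fun t => nu (clamp T t)).
  by move=> t; apply: continuous_comp; [exact: clamp_continuous|exact: cnu].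
have Dxc t : D (z t + dev (x (clamp T t)) (nu (clamp T t))).
  by rewrite -reference_clamp; apply: Dx; exact: clamp_itv.
have cdev := dev_continuous cxc cnc.
have cz := reference_continuous.
exists q1, u1; split; first split.
- split; first by apply: derivable_on_continuous => t; rewrite /= in_itv/= => /dq1E[].
  split; first by move=> t; rewrite /= in_itv/= => /dq1E[].
  split; first by apply: derivable_on_continuous => t; rewrite /= in_itv/= => /ode[].
  split; first by move=> t; rewrite /= in_itv/= => /ode[].
  split; last by [].
  (* Nothing is known about continuity of x'. The second derivative of the new curve is continuous
     because the differential equation equates it with f along continuous data. *)
  have cy := value_continuous cz cF cdev Dxc.
  apply: (continuous_eq_within cy) => t tT.
  by have [_ ->] := ode t tT; rewrite (clamp_id tT).
- have cuc := continuous_clamp T0' (adm_u adm).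
  have cy : continuous (fun t => u (clamp T t) + nu (clamp T t)).
    by move=> t; apply: cvgD; [exact: cuc|exact: cnc].
  by apply: (continuous_eq_within cy) => t tT; rewrite clamp_id.
- by move=> t; rewrite /= in_itv/= => tT; have := Dx t tT; rewrite pt.
- move=> t; rewrite /= in_itv/= => tT.
  by have [_ ->] := ode t tT; rewrite pt// (dq1E t tT).2.
- have Z : 0 <= (0 : R) <= T by rewrite lexx.
  have [h1 h2] := adm_init adm.
  by rewrite (dq1E 0 Z).2 /q1 /v1 x0 !linear0 !addr0 Xqq// Xvv.
- have [h1 h2] := adm_final adm.
  by rewrite (dq1E T TT).2 /q1 /v1 xT !linear0 !addr0 Xqq// Xvv.
have c0 : continuous (fun t => S (z t)).
  move=> t; apply: (@continuous_comp _ _ _ z S); first exact: cz.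
  exact: class_C_continuous cS (reference_domain t).
have c1 := value_continuous cz cS cdev Dxc.
have E : prim (fun t => cost_dev S (z t) (x (clamp T t)) (nu (clamp T t))) T =
    prim (fun t => S (z t + dev (x (clamp T t)) (nu (clamp T t)))) T -
    prim (fun t => S (z t)) T by exact: primB c1 c0 T0'.
rewrite E -(integral_prim T0 c1) -(integral_prim T0 c0).
congr (_ - _); apply: eq_Rintegral => t; rewrite inE/= in_itv/= => tT.
  by rewrite clamp_id// pt// (dq1E t tT).2.
by rewrite reference_id.
Qed.

End legendre.

Theorem theorem4p1 (R : realType) (n m : nat) (Q : set 'rV[R]_n)
    (C : 'rV[R]_n -> 'rV[R]_n -> 'rV[R]_m -> R)
    (f : 'rV[R]_n -> 'rV[R]_n -> 'rV[R]_m -> 'rV[R]_n)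
    (T : R) (q0 v0 qT vT : 'rV[R]_n)
    (q kappa : R -> 'rV[R]_n) (u : R -> 'rV[R]_m)
    (hQ : open Q)
    (hCf : smooth_data Q C f)
    (hT : 0 < T)
    (hopt : optimal Q C f T q0 v0 qT vT q u)
    (hnormal : normal C f T q u)
    (hcorank : has_corank C f T q u 1)
    (hfoc : first_order_conditions Q C f T q0 v0 qT vT q kappa u) :
  forall t : R, `[0, T]%classic t ->
    negative_semidefinite
      (hessian
         (new_lagrangian C f (q t) (kappa t)
            (derive_on `[0, T]%classic q t) (derive_on `[0, T]%classic kappa t))
         (u t)).
Proof.
move=> t0; rewrite /= in_itv/= => t0T w; rewrite leNgt; apply/negP => hpos.
have T0' := ltW hT.
have cz := reference_continuous hT hfoc.
have Dz := reference_domain hT hfoc.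
have oD := @open_state_control_domain _ _ m _ hQ.
have [rho [K [rho0 K0 rem]]] := deviation_remainder T oD hCf.2 hCf.1 cz Dz.
have [l [l' [dl lA lB lk]]] := exists_costate hQ hCf hT hfoc.
have [eta [del [c0 [del0 c00 wrho gain]]]] :=
  needle_gain hQ hCf hT hfoc t0T rho0 lB lk hpos.
have zD (t : R) h : 0 <= t <= T -> `|h| <= rho ->
    state_control_domain Q (reference T q u t + h).
  by move=> tT; exact: (rem t tT).1.
have Dx (x : R -> 'rV[R]_(n + n)) (nu : R -> 'rV[R]_m) :
    (forall t, `|x t| <= rho /\ `|nu t| <= rho) ->
    forall t, state_control_domain Q (reference T q u t + dev (x t) (nu t)).
  move=> xr t; rewrite -reference_clamp//; apply: zD; first exact: clamp_itv.
  by have [h1 h2] := xr t; exact: dev_norm.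
have cA := state_mx_continuous oD hCf.2 cz Dz.
have [] := @needle_improvement R (n + n) m T rho K
  (fun t => state_mx (dyn_map f) (reference T q u t))
  (fun t => control_mx (dyn_map f) (reference T q u t))
  (fun t => dyn_dev (dyn_map f) (reference T q u t))
  (fun t => state_grad (cost_map C) (reference T q u t))
  (fun t => grad_u (cost_map C) (reference T q u t))
  (fun t => cost_dev (cost_map C) (reference T q u t)) l l' t0 del c0 (eta *: w)
  hT rho0 K0 cA (control_mx_continuous oD hCf.2 cz Dz).
- by move=> t _; rewrite /dyn_dev dev0 addr0 subrr linear0 row_mx0.
- by move=> t x1 x2 u1 u2 r tT rr a1 a2 a3 a4;
    have [] := (rem t tT).2 x1 x2 u1 u2 r rr a1 a2 a3 a4.
- move=> x nu cx cnu xr.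
  under eq_fun do rewrite reference_clamp//.
  exact: (dyn_dev_continuous hCf.2 cz Dz cx cnu (Dx x nu xr)).
(* Normality and corank 1 enter here, as controllability of the linearised system. *)
- move=> k k' dk kA kB.
  apply: (no_abnormal_costate hQ hCf.2 hT _ cA hnormal hcorank dk kA kB) => t tT.
  by rewrite reference_id//; split => //; apply: (adm_dom (foc_adm hfoc)); rewrite /= in_itv.
- by move=> t _; rewrite /cost_dev dev0 addr0 subrr.
- by move=> t x1 x2 u1 u2 r tT rr a1 a2 a3 a4;
    have [] := (rem t tT).2 x1 x2 u1 u2 r rr a1 a2 a3 a4.
- move=> x nu cx cnu xr.
  under eq_fun do rewrite reference_clamp//.
  exact: (cost_dev_continuous hCf.1 cz Dz cx cnu (Dx x nu xr)).
- exact: dl.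
- exact: lA.
- exact: lB.
- exact: t0T.
- exact: del0.
- exact: c00.
- exact: wrho.
- exact: gain.
move=> x [x' [nu [dx cnu x0 xT [xd]]]].
under [X in prim X _]eq_fun do rewrite reference_clamp//.
have [q1 [u1 [adm1 <-]]] := perturbed_admissible hCf hT hfoc zD dx cnu x0 xT xd.
by rewrite subr_lt0 ltNge (hopt.2 _ _ adm1).
Qed.
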